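(* Let $0<r<1/2$ and $s=\frac{2r}{1-2r}$ (so $r=\frac{s}{2+2s}$). With respect to the orthonormal system $\phi_j(t)=\sqrt2\cos(\pi jt)$, $j\ge1$, for every $P_0>0$ the body $\bar{\mathbb{B}}^s_{2\infty}(P_0)$ is a maxiset for the Cramér–von Mises test statistics.
   Context: Observations $X_1,\dots,X_n$ are i.i.d. on $(0,1)$ with density $1+f$, $f=\sum_{j\ge1}\theta_j\phi_j\in\mathbb{L}_2(0,1)$, $\phi_j(t)=\sqrt2\cos(\pi jt)$; $H_0: f=0$. With $\hat F_n$ the empirical distribution function, $F_0(x)=x$ and $T^2(G)=\int_0^1G^2$, a Cramér–von Mises test rejects $H_0$ iff $nT^2(\hat F_n-F_0)$ exceeds a threshold. $\alpha(K)$, $\beta(K,f)$ denote type I and type II error probabilities. For $n_i\to\infty$, a (sub)sequence of alternatives $f_{n_i}$ ($1+f_{n_i}$ densities) is consistent if for every $\alpha\in(0,1)$ and every sequence of Cramér–von Mises tests $K_{n_i}$ with $\alpha(K_{n_i})=\alpha(1+o(1))$, $\limsup_i\beta(K_{n_i},f_{n_i})<1-\alpha$; inconsistent if for every sequence of Cramér–von Mises tests $K_{n_i}$, $\liminf_i(\alpha(K_{n_i})+\beta(K_{n_i},f_{n_i}))\ge1$. $\bar{\mathbb{B}}^s_{2\infty}(P_0)=\{f=\sum_j\theta_j\phi_j:\ \sup_{\lambda>0}\lambda^{2s}\sum_{j>\lambda}\theta_j^2\le P_0\}$. A set $U$ is ortho-symmetric if $\sum_j\theta_j\phi_j\in U$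 implies $\sum_j\pm\theta_j\phi_j\in U$ for all sign choices; for closed bounded convex $U$, $\Im_U=\bigcup_{\gamma>0}\gamma U$. A bounded closed set $U$ is a maxiset if: (i) $U$ is convex; (ii) $U$ is ortho-symmetric; (iii) for any $0<c<C$, every subsequence of alternatives $f_{n_i}\in U$ with $cn_i^{-r}<\|f_{n_i}\|<Cn_i^{-r}$, $n_i\to\infty$, is consistent; (iv) for every $f=\sum_j\theta_j\phi_j\notin\Im_U$ satisfying condition D, every convex ortho-symmetric set $V$ containing $f$ contains an inconsistent subsequence $f_{n_i}\in V$ with $cn_i^{-r}<\|f_{n_i}\|<Cn_i^{-r}$ for some $0<c<C$, $n_i\to\infty$. Condition D: there is $l_0$ such that for all $l>l_0$ the function $1+\sum_{j>l}\theta_j\phi_j$ is nonnegative (a density). *)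

(* Defs.v *)
From HB Require Import structures.
From mathcomp Require Import all_boot all_order all_algebra.
From mathcomp Require Import all_classical all_reals all_analysis.
Set Implicit Arguments. Unset Strict Implicit. Unset Printing Implicit Defensive.
Import Order.TTheory GRing.Theory Num.Theory.
Import numFieldNormedType.Exports.
Local Open Scope classical_set_scope.
Local Open Scope ring_scope.

Section CvM.
Variable R : realType.

Definition unit_oi : set R := `]0%R, 1%R[.
Definition leb : measure _ _ := (@lebesgue_measure R).

Definition phi (j : nat) (t : R) : R := Num.sqrt 2 * cos (pi * j%:R * t).

Definition coef (f : R -> R) (j : nat) : R :=
  Rintegral leb unit_oi (fun t => f t * phi j t).

(* f lies in the closed linear span of (phi_j)_{j>=1} in L2(0,1), i.e.
   f is square integrable on (0,1) and orthogonal to constants. *)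
Definition L2_0 (f : R -> R) : Prop :=
  [/\ measurable_fun unit_oi f,
      (\int[leb]_(t in unit_oi) ((f t) ^+ 2)%:E < +oo)%E
    & Rintegral leb unit_oi f = 0].

Definition L2norm (f : R -> R) : R :=
  Num.sqrt (fine (\int[leb]_(t in unit_oi) ((f t) ^+ 2)%:E)).

(* 1 + f is a probability density on (0,1) *)
Definition dens_alt (f : R -> R) : Prop :=
  L2_0 f /\ {ae leb, forall t, unit_oi t -> 0 <= 1 + f t}.

(* n-fold iterated integral against the product density prod_i p(x_i)
   on (0,1)^n : the expectation of g(X_1,...,X_n) for i.i.d. X_i ~ p. *)
Fixpoint iterint (n : nat) (p : R -> R) (g : seq R -> \bar R) : \bar R :=
  match n with
  | 0 => g [::]
  | k.+1 => (\int[leb]_(x in unit_oi)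
              ((p x)%:E * iterint k p (fun xs => g (x :: xs))))%E
  end.

Definition Pn (n : nat) (f : R -> R) (A : set (seq R)) : R :=
  fine (iterint n (fun x => 1 + f x) (fun xs => (\1_A xs)%:E)).

Definition Fhat (xs : seq R) (x : R) : R :=
  (count (fun X => X <= x) xs)%:R / (size xs)%:R.

(* n T^2(Fhat_n - F_0), F_0(x) = x, T^2(G) = int_0^1 G^2 *)
Definition cvm_stat (xs : seq R) : R :=
  (size xs)%:R * Rintegral leb unit_oi (fun x => (Fhat xs x - x) ^+ 2).

Definition reject (t : R) : set (seq R) := [set xs | t < cvm_stat xs].

Definition alpha_err (n : nat) (t : R) : R := Pn n (fun=> 0) (reject t).
Definition beta_err (n : nat) (t : R) (f : R -> R) : R :=
  Pn n f (~` reject t).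

Definition consistent (n : nat -> nat) (f : nat -> R -> R) : Prop :=
  forall a : R, 0 < a < 1 ->
  forall t : nat -> R,
    (fun i => alpha_err (n i) (t i)) @ \oo --> a ->
    (limn_esup (fun i => (beta_err (n i) (t i) (f i))%:E) < (1 - a)%:E)%E.

Definition inconsistent (n : nat -> nat) (f : nat -> R -> R) : Prop :=
  forall t : nat -> R,
    (1%:E <= limn_einf (fun i =>
       (alpha_err (n i) (t i) + beta_err (n i) (t i) (f i))%:E))%E.

Definition nat_gt (lam : R) (j : nat) : bool := lam < j%:R.

Definition Bbar (s P0 : R) : set (R -> R) :=
  [set f | L2_0 f /\
     forall lam : R, 0 < lam ->
       ((lam `^ (2 * s))%:E *
         (\sum_(j <oo | nat_gt lam j) ((coef f j) ^+ 2)%:E) <= P0%:E)%E].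

Definition convex_set (U : set (R -> R)) : Prop :=
  forall f g, U f -> U g -> forall l : R, 0 <= l <= 1 ->
    U (fun x => l * f x + (1 - l) * g x).

Definition ortho_sym (U : set (R -> R)) : Prop :=
  forall f, U f -> forall eps : nat -> bool, forall g, L2_0 g ->
    (forall j, (0 < j)%N -> coef g j = (-1) ^+ eps j * coef f j) -> U g.

Definition bounded_L2 (U : set (R -> R)) : Prop :=
  exists M : R, forall f, U f -> L2norm f <= M.

Definition closed_L2 (U : set (R -> R)) : Prop :=
  forall (fk : nat -> R -> R) g, (forall k, U (fk k)) -> L2_0 g ->
    (fun k => L2norm (fun x => fk k x - g x)) @ \oo --> 0 -> U g.

Definition cone (U : set (R -> R)) : set (R -> R) :=
  [set f | exists gam : R, 0 < gam /\ exists g, U g /\ f = (fun x => gam * g x)].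

Definition condD (f : R -> R) : Prop :=
  exists l0 : nat, forall l : nat, (l0 < l)%N ->
    forall g, L2_0 g ->
      (forall j, (0 < j)%N -> coef g j = if (l < j)%N then coef f j else 0) ->
      {ae leb, forall x, unit_oi x -> 0 <= 1 + g x}.

Definition rate_band (r c C : R) (n : nat -> nat) (f : nat -> R -> R) : Prop :=
  forall i, c * (n i)%:R `^ (- r) < L2norm (f i) < C * (n i)%:R `^ (- r).

Definition maxiset (r : R) (U : set (R -> R)) : Prop :=
  [/\ U `<=` L2_0 /\ bounded_L2 U /\ closed_L2 U,
   (* (i) *) convex_set U,
   (* (ii) *) ortho_sym U,
   (forall c C : R, 0 < c -> c < C ->
     forall (n : nat -> nat) (f : nat -> R -> R),
       (fun i => (n i)%:R : R) @ \oo --> +oo ->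
       (forall i, U (f i) /\ dens_alt (f i)) ->
       rate_band r c C n f -> consistent n f)
   &
   (forall f, L2_0 f -> ~ cone U f -> condD f ->
     forall V : set (R -> R), V `<=` L2_0 -> convex_set V -> ortho_sym V ->
       V f ->
       exists c C : R, 0 < c /\ c < C /\
       exists (n : nat -> nat) (g : nat -> R -> R),
         [/\ (fun i => (n i)%:R : R) @ \oo --> +oo,
             (forall i, V (g i) /\ dens_alt (g i)),
             rate_band r c C n g & inconsistent n g])].

End CvM.

(* Main.v *)
Require Import Defs.
From HB Require Import structures.
From mathcomp Require Import all_boot all_order all_algebra.
From mathcomp Require Import all_classical all_reals all_analysis.
From mathcomp Require Import measurable_realfun ring lra.
Set Implicit Arguments. Unset Strict Implicit. Unset Printing Implicit Defensive.
Import Order.TTheory GRing.Theory Num.Theory.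
Import numFieldNormedType.Exports.
Local Open Scope classical_set_scope.
Local Open Scope ring_scope.

(** The statistic equals [sum_j lam_j Z_j^2] with [lam_j = 1 / (pi j)^2], where [Z_j] is the
    normalized empirical coefficient on [phi_j], of mean [h_j = sqrt n * theta_j]; this rests on
    the closed form of [sum_j cos (pi j t) / (pi j)^2]. When [||f|| -> 0], a Lindeberg exchange
    compares finitely many [Z_j] with a Gaussian vector centred at [h], and the remaining ones
    are controlled by their second moments. By Anderson's inequality in a strict form, a shift [h]
    with [sum_j lam_j h_j^2] bounded below lowers the acceptance probability by a fixed amount,
    while [sum_j lam_j h_j^2 -> 0] leaves it unchanged in the limit. For [f] in the body with
    [||f|| ~ n^-r], the frequencies up to order [n^(r/s)] carry half of the energy, which bounds
    [n * sum_j lam_j theta_j^2] below; for [f] outside the cone, tails of [f] along suitable cutoffs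
    have [n * sum_j lam_j theta_j^2 -> 0] when [n] is matched to their norm. *)

(** No product space, random vector or limit law is built. A law acts as the operator averaging a
    function over one more observation, and an error probability is an [n]-th iterate applied to an
    indicator. These operators commute by Tonelli, so the Lindeberg exchange telescopes, and
    Taylor's formula is applied to the smoothed indicator alone. Thresholds and alternatives vary
    with [n] arbitrarily. Each approximation is therefore uniform over densities of norm at most
    some [e1] and thresholds below some [T]; Markov's inequality deals with larger thresholds. The
    number of coordinates treated as Gaussian is chosen after the gains it must preserve, so gains
    and anticoncentration have constants independent of it. Membership in [L2_0] means square
    integrability and mean zero, so comparing a norm with its coefficients requires completeness of
    the cosines. The closed form that diagonalizes the statistic provides it: it gives equality in
    Bessel's inequality for centred indicators of half-lines, and averages over short windows extend
    the bound to all of [L2_0]. *)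

(** * Probability laws given by a density *)

Section density.
Context {R : realType}.
Local Notation mu := (@lebesgue_measure R).
Local Open Scope ereal_scope.

(** Bundled so that [dens p] can carry the structures of a measure and of a probability. *)
Record pdf := Pdf {
  pdf_fun :> R -> R;
  pdf_measurable : measurable_fun setT pdf_fun;
  pdf_ge0 : forall x, (0 <= pdf_fun x)%R;
  pdf_int1 : \int[mu]_x (pdf_fun x)%:E = 1 }.

Definition dens (p : pdf) (A : set R) : \bar R := \int[mu]_(x in A) (p x)%:E.

Variable p : pdf.

Let dens0 : dens p set0 = 0.
Proof. by rewrite /dens integral_set0. Qed.

Let dens_ge0 A : 0 <= dens p A.
Proof. by apply: integral_ge0 => x _; rewrite lee_fin pdf_ge0. Qed.

Let measurable_pdfE : measurable_fun setT (EFin \o p).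
Proof. by apply/measurable_EFinP; exact: pdf_measurable. Qed.

Let dens_sigma_additive : semi_sigma_additive (dens p).
Proof.
move=> /= F mF tF mUF; rewrite /dens; apply: cvg_toP.
  apply: ereal_nondecreasing_is_cvgn => m n mn.
  apply: lee_sum_nneg_natr => // k _ _.
  by apply: integral_ge0 => /= x Fkx; rewrite lee_fin pdf_ge0.
rewrite ge0_integral_bigcup//=.
- by apply: measurable_funTS.
- by move=> x _; rewrite lee_fin pdf_ge0.
Qed.

HB.instance Definition _ := isMeasure.Build _ _ _ (dens p)
  dens0 dens_ge0 dens_sigma_additive.

Let dens_setT : dens p [set: _] = 1%:E.
Proof. by rewrite /dens pdf_int1. Qed.

HB.instance Definition _ := @Measure_isProbability.Build _ _ R
  (dens p) dens_setT.

Import HBNNSimple.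

Let integral_dens_nnsfun (f : {nnsfun R >-> R}) :
  \int[dens p]_x (f x)%:E = \int[mu]_x ((p x)%:E * (f x)%:E).
Proof.
under [LHS]eq_integral do rewrite fimfunE -fsumEFin//.
rewrite [LHS]ge0_integral_fsum//; last 2 first.
  - by move=> r; exact/measurable_EFinP/measurableT_comp.
  - by move=> n x _; rewrite EFinM nnfun_muleindic_ge0.
have mi r : measurable_fun setT (EFin \o (fun x : R => r * \1_(f @^-1` [set r]) x)%R).
  exact/measurable_EFinP/measurableT_comp.
have mj r : measurable_fun setT (EFin \o (\1_(f @^-1` [set r]) : R -> R)).
  exact/measurable_EFinP/measurable_indic.
have -> : \int[mu]_x ((p x)%:E * (f x)%:E) = \int[mu]_x
    (\sum_(r \in range f) ((p x)%:E * (r * \1_(f @^-1` [set r]) x)%:E)).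
  apply: eq_integral => x _; rewrite {1}fimfunE -fsumEFin// ge0_mule_fsumr//.
  by move=> r; rewrite EFinM nnfun_muleindic_ge0.
rewrite [RHS]ge0_integral_fsum//; last 2 first.
  - by move=> r; apply: emeasurable_funM; [exact: measurable_pdfE|exact: mi].
  - move=> n x _; apply: mule_ge0; first by rewrite lee_fin pdf_ge0.
    by rewrite EFinM nnfun_muleindic_ge0.
apply: eq_fsbigr => r _.
rewrite integralZl_indic_nnsfun//= integral_indic//= setIT /dens.
under [RHS]eq_integral do rewrite EFinM muleCA.
have [r0|r0] := leP 0%R r; last first.
  rewrite preimage_nnfun0//.
  rewrite integral_set0 mule0 [RHS]integral0_eq//.
  by move=> x _; rewrite indicE in_set0/= mule0 mule0.
rewrite [RHS]ge0_integralZl//; last 2 first.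
- by apply: emeasurable_funM; [exact: measurable_pdfE|exact: mj].
- by move=> x _; rewrite mule_ge0 ?lee_fin ?pdf_ge0.
congr (_ * _).
rewrite [LHS]integral_mkcond; apply: eq_integral => x _.
by rewrite patchE indicE; case: ifPn => _; rewrite ?mule1 ?mule0.
Qed.

(** The identity holds for simple functions; both sides pass to the limit by monotone
    convergence. *)
Lemma ge0_integral_dens (f : R -> \bar R) : measurable_fun setT f ->
  (forall x, 0 <= f x) -> \int[dens p]_x f x = \int[mu]_x ((p x)%:E * f x).
Proof.
move=> mf f0; pose f_ := nnsfun_approx measurableT mf.
have mfn n : measurable_fun setT (EFin \o (f_ n : R -> R)) by exact/measurable_EFinP.
transitivity (limn (fun n => \int[dens p]_x (f_ n x)%:E)).
  rewrite -monotone_convergence//.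
  - by apply: eq_integral => y _; apply/esym/cvg_lim => //; exact: cvg_nnsfun_approx.
  - by move=> n y _; rewrite lee_fin.
  - by move=> y _ m n mn; rewrite lee_fin; exact/lefP/nd_nnsfun_approx.
under eq_fun do rewrite integral_dens_nnsfun.
rewrite -monotone_convergence//.
- apply: eq_integral => y _; apply/cvg_lim => //.
  by apply: cvgeZl => //; exact: cvg_nnsfun_approx.
- move=> n; apply: emeasurable_funM; first exact: measurable_pdfE.
  exact: mfn.
- by move=> n y _; rewrite mule_ge0 ?lee_fin ?pdf_ge0.
- move=> y _ m n mn; rewrite lee_wpmul2l ?lee_fin ?pdf_ge0//.
  by have /lefP := nd_nnsfun_approx measurableT mf mn; exact.
Qed.

End density.

(** * Averaging operators on functions of a sequence *)

Section steps.
Context {R : realType}.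
Local Open Scope ereal_scope.
Local Notation Z := (nat -> R).

Definition zadd (z u : Z) : Z := fun j => (z j + u j)%R.

(* Measurability along every measurable family, so that no sigma-algebra on [Z] is needed. *)
Definition mZ (g : Z -> \bar R) : Prop :=
  forall d (T : measurableType d) (zt : T -> Z),
    (forall j, measurable_fun setT (fun t => zt t j)) ->
    measurable_fun setT (fun t => g (zt t)).

(** Nonnegativity lets Tonelli and monotone convergence handle every integral of such a [g],
    infinite values included, without integrability conditions. *)
Definition good (g : Z -> \bar R) : Prop := mZ g /\ forall z, 0 <= g z.

Lemma good_mZ g : good g -> mZ g. Proof. by case. Qed.
Lemma good_ge0 g z : good g -> 0 <= g z. Proof. by case. Qed.

Lemma good_cst (c : R) : (0 <= c)%R -> good (fun=> c%:E).
Proof. by move=> c0; split=> [d T zt _|z]; [exact: measurable_cst|rewrite lee_fin]. Qed.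

Lemma goodD g1 g2 : good g1 -> good g2 -> good (fun z => g1 z + g2 z).
Proof.
move=> [m1 p1] [m2 p2]; split=> [d T zt mzt|z]; last exact: adde_ge0.
by apply: emeasurable_funD; [exact: m1|exact: m2].
Qed.

Lemma goodM g1 g2 : good g1 -> good g2 -> good (fun z => g1 z * g2 z).
Proof.
move=> [m1 p1] [m2 p2]; split=> [d T zt mzt|z]; last exact: mule_ge0.
by apply: emeasurable_funM; [exact: m1|exact: m2].
Qed.

Lemma good_series (g : nat -> Z -> \bar R) : (forall j, good (g j)) ->
  good (fun z => \sum_(j <oo) g j z).
Proof.
move=> gg; split=> [d T zt mzt|z].
  apply: ge0_emeasurable_sum => // [j t _ _|j _]; first exact: good_ge0.
  exact: good_mZ.
by apply: nneseries_ge0 => j _ _; exact: good_ge0.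
Qed.

Lemma good_EFin (F : Z -> R) : (forall z, 0 <= F z)%R ->
  (forall d (T : measurableType d) (zt : T -> Z),
    (forall j, measurable_fun setT (fun t => zt t j)) ->
    measurable_fun setT (fun t => F (zt t))) -> good (fun z => (F z)%:E).
Proof.
move=> F0 mF; split=> [d T zt mzt|z]; last by rewrite lee_fin.
by apply/measurable_EFinP; exact: mF.
Qed.

Lemma good_indic_le (g : Z -> \bar R) (t : \bar R) : mZ g ->
  good (fun z => (g z <= t)%E%:R%:E).
Proof.
move=> mg; split=> [d T zt mzt|z]; last by rewrite lee_fin; case: (_ <= _).
rewrite (_ : (fun u => _) = EFin \o \1_[set u | g (zt u) <= t]).
  apply/measurable_EFinP/measurable_indic.
  rewrite -[X in measurable X]setTI.
  by apply: emeasurable_fun_infty_c => //; exact: mg.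
by apply/funext => u /=; rewrite indicE mem_setE/=.
Qed.

Section step.
Context {d} {T : measurableType d} (mu : probability T R) (v : T -> Z).

(* One observation [x] moves the state [z] to [z + v x]; a test based on the sums of the
   [v x_i] is thus evaluated by the [n]-th iterate of [stepop]. *)
Definition stepop (g : Z -> \bar R) (z : Z) : \bar R := \int[mu]_x g (zadd z (v x)).

Hypothesis mv : forall j, measurable_fun setT (fun x => v x j).

Lemma measurable_shift g z : mZ g -> measurable_fun setT (fun x => g (zadd z (v x))).
Proof. by move=> mg; apply: mg => j; apply: measurable_funD. Qed.

(** The average is a partial integral on the product of the parameter space [T'] and the sample
    space [T], and Tonelli's theorem provides its measurability. *)
Lemma stepop_good g : good g -> good (stepop g).
Proof.
move=> [mg g0]; split=> [d' T' zt mzt|z]; last by apply: integral_ge0 => x _.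
rewrite /stepop.
have := @measurable_fun_fubini_tonelli_F _ _ _ _ _ mu
   (fun tx : T' * T => g (zadd (zt tx.1) (v tx.2))).
apply => //; apply: mg => j; apply: measurable_funD.
  by apply: (measurableT_comp (mzt j)).
by apply: (measurableT_comp (mv j)).
Qed.

Lemma le_stepop g1 g2 z : good g1 -> good g2 -> (forall z, g1 z <= g2 z) ->
  stepop g1 z <= stepop g2 z.
Proof.
move=> [m1 p1] [m2 p2] g12; apply: ge0_le_integral => //.
- exact: measurable_shift.
- exact: measurable_shift.
Qed.

Lemma stepopD g1 g2 z : good g1 -> good g2 ->
  stepop (fun z => g1 z + g2 z) z = stepop g1 z + stepop g2 z.
Proof.
move=> [m1 p1] [m2 p2]; apply: ge0_integralD => //.
- exact: measurable_shift.
- exact: measurable_shift.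
Qed.

Lemma stepop_cst c z : stepop (fun=> c) z = c.
Proof. by rewrite /stepop integral_cst//= probability_setT mule1. Qed.

Lemma stepop_series (g : nat -> Z -> \bar R) z : (forall j, good (g j)) ->
  stepop (fun z => \sum_(j <oo) g j z) z = \sum_(j <oo) stepop (g j) z.
Proof.
move=> gg; rewrite /stepop integral_nneseries//.
  by move=> j; apply: measurable_shift; exact: good_mZ.
by move=> j x _; exact: good_ge0.
Qed.

Lemma stepopZ (c : R) g z : (0 <= c)%R -> good g ->
  stepop (fun z => c%:E * g z) z = c%:E * stepop g z.
Proof.
move=> c0 [mg g0]; rewrite /stepop ge0_integralZl//; exact: measurable_shift.
Qed.

End step.

(** The properties of averaging that pass to compositions and iterates. Stated for abstract
    operators, they serve observations, Gaussian steps and weighted squares alike. *)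
Definition op_ok (A : (Z -> \bar R) -> Z -> \bar R) : Prop :=
  [/\ (forall g, good g -> good (A g)),
      (forall g1 g2, good g1 -> good g2 -> (forall z, g1 z <= g2 z) ->
         forall z, A g1 z <= A g2 z),
      (forall g1 g2, good g1 -> good g2 -> forall z,
         A (fun z => g1 z + g2 z) z = A g1 z + A g2 z),
      (forall c, (0 <= c)%R -> forall g, good g -> forall z,
         A (fun z => c%:E * g z) z = c%:E * A g z)
    & (forall c z, A (fun=> c) z = c)].

Definition op_comm (A B : (Z -> \bar R) -> Z -> \bar R) : Prop :=
  forall g, good g -> A (B g) = B (A g).

Lemma stepop_ok d (T : measurableType d) (mu : probability T R) (v : T -> Z) :
  (forall j, measurable_fun setT (fun x => v x j)) -> op_ok (stepop mu v).
Proof.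
move=> mv; split => *; [exact: stepop_good|exact: le_stepop|exact: stepopD|exact: stepopZ|exact: stepop_cst].
Qed.

Lemma zaddAC z u w : zadd (zadd z u) w = zadd (zadd z w) u.
Proof. by apply/funext => j; rewrite /zadd addrAC. Qed.

Lemma stepop_comm d (T : measurableType d) (mu : probability T R) (v : T -> Z)
   d' (T' : measurableType d') (mu' : probability T' R) (v' : T' -> Z) :
  (forall j, measurable_fun setT (fun x => v x j)) ->
  (forall j, measurable_fun setT (fun x => v' x j)) ->
  op_comm (stepop mu v) (stepop mu' v').
Proof.
move=> mv mv' g [mg g0]; apply/funext => z; rewrite /stepop.
rewrite (fubini_tonelli (fun xy : T * T' => g (zadd (zadd z (v xy.1)) (v' xy.2))))//.
  by apply: eq_integral => y _; apply: eq_integral => x _ /=; rewrite zaddAC.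
apply: mg => j; apply: measurable_funD.
  by apply: measurable_funD => //; apply: (measurableT_comp (mv j)).
by apply: (measurableT_comp (mv' j)).
Qed.

Lemma op_ok_id : op_ok id. Proof. by split. Qed.

Lemma op_ok_comp A B : op_ok A -> op_ok B -> op_ok (A \o B).
Proof.
move=> [Ag Al AD AZ Ac] [Bg Bl BD BZ Bc]; split=> /=.
- by move=> g gg; apply/Ag/Bg.
- by move=> g1 g2 h1 h2 h z; apply: Al => //; [exact: Bg|exact: Bg|exact: Bl].
- move=> g1 g2 h1 h2 z; rewrite -AD; [|exact: Bg|exact: Bg].
  by congr (A _ z); apply/funext => u; exact: BD.
- move=> c c0 g gg z; rewrite -AZ//; last exact: Bg.
  by congr (A _ z); apply/funext => u; exact: BZ.
- by move=> c z; rewrite (_ : B (fun=> c) = (fun=> c)) ?Ac//; apply/funext => u; exact: Bc.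
Qed.

Lemma op_ok_iter n A : op_ok A -> op_ok (iter n A).
Proof.
by move=> okA; elim: n => [|n IH]; [exact: op_ok_id|exact: (op_ok_comp okA IH)].
Qed.

Lemma op_comm_sym A B : op_comm A B -> op_comm B A.
Proof. by move=> AB g gg; rewrite AB. Qed.

Lemma op_comm_id A : op_comm A id. Proof. by []. Qed.

Lemma op_comm_comp A B C : op_ok B -> op_ok C -> op_comm A B -> op_comm A C ->
  op_comm A (B \o C).
Proof.
move=> [Bg _ _ _ _] [Cg _ _ _ _] AB AC g gg /=.
by rewrite AB ?AC//; exact: Cg.
Qed.

Lemma op_comm_iter n A B : op_ok A -> op_ok B -> op_comm A B -> op_comm A (iter n B).
Proof.
move=> okA okB AB; elim: n => [|n IH]; first exact: op_comm_id.
by apply: (@op_comm_comp A B (iter n B)) => //; exact: op_ok_iter.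
Qed.

Lemma iter_comp_comm n A B g : op_ok A -> op_ok B -> op_comm A B -> good g ->
  iter n (A \o B) g = iter n A (iter n B g).
Proof.
move=> okA okB AB gg; elim: n => //= n IH.
rewrite IH; congr (A _).
have := op_comm_iter n okB okA (op_comm_sym AB) => ->//.
by have [+ _ _ _ _] := op_ok_iter n okB; exact.
Qed.

Lemma op_addc A (c : R) g z : op_ok A -> (0 <= c)%R -> good g ->
  A (fun z => g z + c%:E) z = A g z + c%:E.
Proof.
by move=> [Ag _ AD _ Ac] c0 gg; rewrite AD//; [rewrite Ac|exact: good_cst].
Qed.

(** The telescoping exchange: each of the [n] replacements of [A] by [B] costs [e]. By commutation
    the replacement can always be made next to [g] itself, so the one-step comparison is required
    for [g] only and not for the intermediate averages. *)
Lemma iter_swap_le n A B (e : R) g : op_ok A -> op_ok B -> op_comm A B -> good g ->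
  (0 <= e)%R -> (forall z, A g z <= B g z + e%:E) ->
  forall z, iter n A g z <= iter n B g z + (n%:R * e)%:E.
Proof.
move=> okA okB AB gg e0 AgB; elim: n => [|n IH] z.
  by rewrite /= mul0r adde0.
have okAn := op_ok_iter n okA; have okBn := op_ok_iter n okB.
have [Ag Al _ _ _] := okA; have [Bg Bl _ _ _] := okB.
have [Ang Anl _ _ _] := okAn; have [Bng Bnl _ _ _] := okBn.
rewrite iterSr (le_trans (Anl _ _ _ _ AgB z))//.
- exact: Ag.
- by apply: goodD; [exact: Bg|exact: good_cst].
rewrite (op_addc _ okAn)//; last exact: Bg.
rewrite -(op_comm_iter n okB okA (op_comm_sym AB))//.
have h : forall z, iter n A g z <= iter n B g z + (n%:R * e)%:E by [].
apply: (@le_trans _ _ (B (fun z => iter n B g z + (n%:R * e)%:E) z + e%:E)).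
  rewrite leeD2r//; apply: Bl => //; [exact: Ang|].
  by apply: goodD; [exact: Bng|apply: good_cst; rewrite mulr_ge0].
rewrite (op_addc _ okB) ?mulr_ge0//; last exact: Bng.
by rewrite /= -addeA -EFinD -[in leRHS]natr1 mulrDl mul1r.
Qed.

Lemma iter_drift n A (c : R) g : op_ok A -> good g -> (0 <= c)%R ->
  (forall z, A g z <= g z + c%:E) ->
  forall z, iter n A g z <= g z + (n%:R * c)%:E.
Proof.
move=> okA gg c0 h z.
have := @iter_swap_le n A id c g okA op_ok_id (@op_comm_id A) gg c0 h z.
by rewrite (_ : iter n id g = g)//; elim: (n) => //= k ->.
Qed.

End steps.

(** * Alternatives as laws, nested integrals as iterates *)

Section dens_alternative.
Context {R : realType}.
Local Notation mu := (@lebesgue_measure R).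
Local Notation U := (@unit_oi R).
Local Notation Z := (nat -> R).

Lemma measurable_unit_oi : measurable (U : set (measurableTypeR R)).
Proof. exact: measurable_itv. Qed.

Lemma mu_unit_oi : mu U = 1%:E.
Proof. by rewrite /unit_oi lebesgue_measure_itv/= lte_fin ltr01 oppr0 adde0. Qed.

Lemma bounded_integrable_unit (g : R -> R) (M : R) : measurable_fun U g ->
  (forall x, U x -> `|g x| <= M) -> mu.-integrable U (EFin \o g).
Proof.
move=> mg gM; apply: measurable_bounded_integrable => //.
- exact: measurable_unit_oi.
- by rewrite [X in (X < _)%E]mu_unit_oi ltry.
- exists M; split; first by rewrite num_real.
  by move=> N MN x Ux /=; rewrite (le_trans (gM _ Ux))// ltW.
Qed.

Lemma sqr_integrable (f : R -> R) : measurable_fun U f ->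
  (\int[mu]_(t in U) ((f t) ^+ 2)%:E < +oo)%E ->
  mu.-integrable U (EFin \o (fun t => f t ^+ 2)).
Proof.
move=> mf f2; apply/integrableP; split.
  by apply/measurable_EFinP; exact: measurable_funX.
by under eq_integral do rewrite /= ger0_norm ?sqr_ge0//.
Qed.

Lemma L2M_integrable (f g : R -> R) : measurable_fun U f -> measurable_fun U g ->
  mu.-integrable U (EFin \o (fun t => f t ^+ 2)) ->
  mu.-integrable U (EFin \o (fun t => g t ^+ 2)) ->
  mu.-integrable U (EFin \o (fun t => f t * g t)).
Proof.
move=> mf mg f2 g2.
apply: (le_integrable measurable_unit_oi _ _ (integrableD measurable_unit_oi f2 g2)).
  by apply/measurable_EFinP; exact: measurable_funM.
move=> x _ /=; rewrite lee_fin [X in _ <= X]ger0_norm ?addr_ge0 ?sqr_ge0// normrM.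
rewrite -(real_normK (num_real (f x))) -(real_normK (num_real (g x))).
by have := normr_ge0 (f x); have := normr_ge0 (g x); nra.
Qed.

Lemma L2_integrable (f : R -> R) : measurable_fun U f ->
  (\int[mu]_(t in U) ((f t) ^+ 2)%:E < +oo)%E ->
  mu.-integrable U (EFin \o f).
Proof.
move=> mf f2.
have := @L2M_integrable f (fun=> 1) mf (measurable_cst _ ) (sqr_integrable mf f2).
rewrite (_ : (fun t => f t * 1) = f); last by apply/funext => t; rewrite mulr1.
apply; apply: (@bounded_integrable_unit _ 1) => [|x _]; first exact: measurable_cst.
by rewrite expr1n normr1.
Qed.

Lemma L2_0_integrable (f : R -> R) : L2_0 f -> mu.-integrable U (EFin \o f).
Proof. by case=> mf f2 _; exact: L2_integrable. Qed.

Lemma bounded_M_integrable (f g : R -> R) (M : R) :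
  mu.-integrable U (EFin \o f) -> measurable_fun U g ->
  (forall x, U x -> `|g x| <= M) ->
  mu.-integrable U (EFin \o (fun t => f t * g t)).
Proof.
move=> fi mg gM.
apply: (le_integrable measurable_unit_oi _ _ (integrableZl measurable_unit_oi M fi)).
  apply/measurable_EFinP; apply: measurable_funM => //.
  by apply/measurable_EFinP; case/integrableP : fi.
move=> x Ux /=; rewrite lee_fin !normrM mulrC ler_wpM2r//.
by rewrite (le_trans (gM _ Ux))// ler_norm.
Qed.

Lemma EFin_Rintegral_unit (f : R -> R) : mu.-integrable U (EFin \o f) ->
  (Rintegral (@leb R) U f)%:E = (\int[mu]_(x in U) (f x)%:E)%E.
Proof.
move=> fi; rewrite /Rintegral fineK//.
by apply: (@integrable_fin_num _ _ _ mu) => //; exact: measurable_unit_oi.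
Qed.

(** The truncation at 0 is there because [dens_alt] gives nonnegativity almost everywhere, whereas
    [pdf] demands it at every point. *)
Definition alt_w (f : R -> R) (x : R) : R := if x \in U then Num.max 0 (1 + f x) else 0.

Lemma alt_w_ge0 f x : 0 <= alt_w f x.
Proof. by rewrite /alt_w; case: ifP => // _; rewrite le_max lexx. Qed.

Lemma measurable_alt_w f : measurable_fun U f -> measurable_fun setT (alt_w f).
Proof.
move=> mf; rewrite (_ : alt_w f = (fun x => Num.max 0 (1 + f x)) \_ U).
  apply/(measurable_restrictT _ measurable_unit_oi).
  by apply: measurable_maxr => //; exact: measurable_funD.
by apply/funext => x; rewrite patchE.
Qed.

Lemma ge0_integral_alt_w (f : R -> R) (h : R -> \bar R) : dens_alt f ->
  measurable_fun setT h -> (forall x, 0 <= h x)%E ->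
  (\int[mu]_x ((alt_w f x)%:E * h x) = \int[mu]_(x in U) ((1 + f x)%:E * h x))%E.
Proof.
move=> [[mf _ _] fae] mh h0.
transitivity (\int[mu]_(x in U) ((alt_w f x)%:E * h x))%E.
  rewrite [RHS]integral_mkcond; apply: eq_integral => x _.
  by rewrite patchE /alt_w; case: ifP => //; rewrite mul0e.
apply: ae_eq_integral => //.
- exact: measurable_unit_oi.
- apply: emeasurable_funM; last exact: measurable_funTS.
  by apply/measurable_EFinP/measurable_funTS; exact: measurable_alt_w.
- apply: emeasurable_funM; last exact: measurable_funTS.
  by apply/measurable_EFinP; exact: measurable_funD.
apply: filterS fae; first exact: (ae_filter_ringOfSetsType mu).
move=> x fx Ux.
by rewrite /alt_w mem_set// (max_idPr _)//; exact: fx.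
Qed.

Lemma alt_w_int1 f : dens_alt f -> (\int[mu]_x (alt_w f x)%:E = 1)%E.
Proof.
move=> fd; have := @ge0_integral_alt_w f (fun=> 1%E) fd (measurable_cst _) (fun=> lee01).
under eq_integral do rewrite mule1.
move=> ->; under eq_integral do rewrite mule1.
have [f2 _] := fd; have [mf _ f0] := f2.
have fi := L2_0_integrable f2.
under eq_integral do rewrite EFinD.
rewrite integralD_EFin//.
- rewrite integral_cst ?mu_unit_oi ?mule1; last exact: measurable_unit_oi.
  have := EFin_Rintegral_unit fi; rewrite f0 => <-.
  by rewrite adde0 mul1e; exact: mu_unit_oi.
- exact: measurable_unit_oi.
- apply: (@bounded_integrable_unit (fun=> 1) 1) => [|x _]; first exact: measurable_cst.
  by rewrite normr1.
Qed.

Definition alt_pdf (f : R -> R) (fd : dens_alt f) : pdf :=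
  Pdf (measurable_alt_w (let: conj (And3 mf _ _) _ := fd in mf))
      (alt_w_ge0 f) (alt_w_int1 fd).

Lemma ge0_integral_alt (f : R -> R) (fd : dens_alt f) (h : R -> \bar R) :
  measurable_fun setT h -> (forall x, 0 <= h x)%E ->
  (\int[dens (alt_pdf fd)]_x h x = \int[mu]_(x in U) ((1 + f x)%:E * h x))%E.
Proof. by move=> mh h0; rewrite ge0_integral_dens// ge0_integral_alt_w. Qed.

Lemma prob_bounded_integrable d (T : measurableType d) (P : probability T R)
  (F : T -> R) (M : R) :
  measurable_fun setT F -> (forall x, `|F x| <= M) -> P.-integrable setT (EFin \o F).
Proof.
move=> mF FM; apply: measurable_bounded_integrable => //.
- by rewrite [X in (X < _)%E](probability_setT P) ltry.
- exists M; split; first by rewrite num_real.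
  by move=> N MN x _ /=; rewrite (le_trans (FM _))// ltW.
Qed.

Lemma integral_alt (f : R -> R) (fd : dens_alt f) (F : R -> R) (M : R) :
  measurable_fun setT F -> (forall x, `|F x| <= M) ->
  (\int[dens (alt_pdf fd)]_x (F x)%:E =
    (Rintegral (@leb R) U F + Rintegral (@leb R) U (fun x => f x * F x))%:E)%E.
Proof.
move=> mF FM.
have mFU : measurable_fun U F by exact: measurable_funTS.
have [f2 _] := fd; have fi := L2_0_integrable f2; have [mf _ f0] := f2.
have M0 : 0 <= M by rewrite (le_trans _ (FM 0)).
have iF := prob_bounded_integrable (dens (alt_pdf fd)) mF FM.
have cst1 : mu.-integrable U (EFin \o (fun=> 1 : R)).
  by apply: (@bounded_integrable_unit _ 1) => [|x _]; [exact: measurable_cst|rewrite normr1].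
have iFU : mu.-integrable U (EFin \o F) by apply: (@bounded_integrable_unit _ M).
have ifF := bounded_M_integrable fi mFU (fun x _ => FM x).
(* The change of density is known for nonnegative integrands; it is applied to [F + M], and [M] is
   subtracted at the end. *)
have h0 x : (0 <= (F x + M)%:E)%E.
  by rewrite lee_fin -lerBlDr sub0r lerNl (le_trans _ (FM x))// -normrN ler_norm.
have mFM : measurable_fun setT (fun x => (F x + M)%:E).
  by apply/measurable_EFinP; exact: measurable_funD.
have := @ge0_integral_alt f fd (fun x => (F x + M)%:E) mFM h0.
rewrite [X in X = _ -> _](_ : _ = \int[dens (alt_pdf fd)]_x (F x)%:E + M%:E)%E; last first.
  under eq_integral do rewrite EFinD.
  rewrite integralD_EFin//; first by rewrite integral_cst//= probability_setT mule1.
  by apply: (@prob_bounded_integrable _ _ _ (fun=> M) M) => [|x]; [exact: measurable_cst|rewrite ger0_norm].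
have -> : (\int[mu]_(x in U) ((1 + f x)%:E * (F x + M)%:E) =
   (Rintegral (@leb R) U F + Rintegral (@leb R) U (fun x => f x * F x))%:E + M%:E)%E.
  transitivity (Rintegral (@leb R) U (fun x => (F x + f x * F x) + (M * 1 + M * f x)))%:E.
    rewrite EFin_Rintegral_unit; last first.
      exact: (integrableD measurable_unit_oi (integrableD measurable_unit_oi iFU ifF)
        (integrableD measurable_unit_oi (integrableZl measurable_unit_oi M cst1)
           (integrableZl measurable_unit_oi M fi))).
    by apply: eq_integral => x _ /=; congr EFin; ring.
  have i1 : mu.-integrable U (EFin \o (fun x => M * 1)).
    exact: (integrableZl measurable_unit_oi M cst1).
  have i2 : mu.-integrable U (EFin \o (fun x => M * f x)).
    exact: (integrableZl measurable_unit_oi M fi).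
  rewrite RintegralD//; first last.
  - exact: (integrableD measurable_unit_oi i1 i2).
  - exact: (integrableD measurable_unit_oi iFU ifF).
  - exact: measurable_unit_oi.
  rewrite !RintegralD//; try exact: measurable_unit_oi.
  rewrite !RintegralZl//; try exact: measurable_unit_oi.
  rewrite f0 mulr0 addr0 Rintegral_cst; last exact: measurable_unit_oi.
  by rewrite mul1r [X in M * fine X](mu_unit_oi) mulr1 EFinD.
by move=> /(congr1 (fun u => u - M%:E)%E); rewrite !addeK.
Qed.

(** The state [z] accumulates the observations already integrated out, so a function of the list
    that factors through the sums of [v] becomes an iterate. Lists with entries in [U] are enough
    because every nested integral runs over [U]. *)
Lemma iterint_stepop n (f : R -> R) (fd : dens_alt f) (v : R -> Z) (g : Z -> \bar R) (z : Z)
    (G : seq R -> \bar R) :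
  (forall j, measurable_fun setT (fun x => v x j)) -> good g ->
  (forall xs, size xs = n -> (forall x, x \in xs -> U x) ->
     G xs = g (zadd z (fun j => \sum_(x <- xs) v x j))) ->
  iterint n (fun x => 1 + f x) G = iter n (stepop (dens (alt_pdf fd)) v) g z.
Proof.
move=> mv gg; elim: n z G => [|n IH] z G GE.
  rewrite /= GE//; congr g; apply/funext => j.
  by rewrite /zadd big_nil addr0.
have [mg g0] : good (iter n (stepop (dens (alt_pdf fd)) v) g).
  have [+ _ _ _ _] := op_ok_iter n (stepop_ok (dens (alt_pdf fd)) mv).
  exact.
rewrite iterS [RHS]/stepop ge0_integral_alt//; last exact: measurable_shift.
apply: eq_integral => x /set_mem Ux; congr (_ * _)%E.
apply: IH => xs sxs xsU; rewrite GE/= ?sxs//.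
  congr g; apply/funext => j; rewrite /zadd big_cons; ring.
by move=> y; rewrite inE => /orP[/eqP->//|/xsU].
Qed.

End dens_alternative.

(** * Gaussian steps *)

Section lebesgue_invariance.
Context {R : realType}.
Local Notation mu := (@lebesgue_measure R).
Local Open Scope ereal_scope.

Lemma lebesgue_measure_shift (a : R) (A : set R) : measurable A ->
  pushforward mu ((fun x => x + a)%R : _ -> measurableTypeR R) A = mu A.
Proof.
move=> mA.
have mshift : measurable_fun setT ((fun x : R => x + a)%R : measurableTypeR R -> measurableTypeR R).
  exact: measurable_funD.
apply/esym.
pose H := isMeasurableFun.Build _ _ _ _ _ mshift.
pose F : {mfun _ >-> _} := HB.pack ((fun x : R => x + a)%R : measurableTypeR R -> measurableTypeR R) H.
apply: (@lebesgue_measure_unique R (pushforward mu F)) => // _ [[u v]] _ <-.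
transitivity (mu `](u - a)%R, (v - a)%R]%classic); last first.
  rewrite /pushforward; congr (mu _).
  by apply/seteqP; split=> x /=; rewrite !in_itv/= ltrBlDr lerBrDr.
rewrite !lebesgue_measure_itv/= !lte_fin ltrD2r; case: ifP => // _.
by rewrite -!EFinB; congr EFin; ring.
Qed.

Lemma ge0_integral_shift (a : R) (h : R -> \bar R) : measurable_fun setT h ->
  (forall x, 0 <= h x) -> \int[mu]_x h (x + a)%R = \int[mu]_x h x.
Proof.
move=> mh h0.
have mshift : measurable_fun setT ((fun x : R => x + a)%R : measurableTypeR R -> measurableTypeR R).
  exact: measurable_funD.
have := @ge0_integral_pushforward _ _ _ _ R _ mshift mu setT h measurableT mh (fun x _ => h0 x).
rewrite preimage_setT => <-.
by apply: eq_measure_integral => A mA _; exact: lebesgue_measure_shift.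
Qed.

Lemma ge0_integral_opp (h : R -> \bar R) : measurable_fun setT h ->
  (forall x, 0 <= h x) -> \int[mu]_x h (- x)%R = \int[mu]_x h x.
Proof.
move=> mh h0.
have mopp : measurable_fun setT ((fun x : R => - x)%R : measurableTypeR R -> measurableTypeR R).
  exact: measurableT_comp.
have := @ge0_integral_pushforward _ _ _ _ R _ mopp mu setT h measurableT mh (fun x _ => h0 x).
rewrite preimage_setT => <-.
by apply: eq_measure_integral => A mA _; exact: lebesgue_measureN.
Qed.

End lebesgue_invariance.

Section gaussian.
Context {R : realType}.
Local Notation mu := (@lebesgue_measure R).
Local Notation Z := (nat -> R).

Definition gpdf (s : R) : @pdf R :=
  Pdf (measurable_normal_pdf 0 s) (normal_pdf_ge0 0 s) (integral_normal_pdf 0 s).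

Definition gauss (s : R) := dens (gpdf s).

Lemma gpdfE s x : 0 < s -> gpdf s x = normal_peak s * expR (- x ^+ 2 / (s ^+ 2 *+ 2)).
Proof. by move=> s0; rewrite /= normal_pdfE ?gt_eqF// /normal_fun subr0. Qed.

Lemma gpdf_gt0 s x : 0 < s -> 0 < gpdf s x.
Proof. by move=> s0; rewrite gpdfE// mulr_gt0 ?expR_gt0// normal_peak_gt0 ?gt_eqF. Qed.

Lemma gpdfN s x : 0 < s -> gpdf s (- x) = gpdf s x.
Proof. by move=> s0; rewrite !gpdfE// sqrrN. Qed.

Lemma gpdf_le s x y : 0 < s -> `|x| <= `|y| -> gpdf s y <= gpdf s x.
Proof.
move=> s0 xy; rewrite !gpdfE// ler_wpM2l ?normal_peak_ge0// ler_expR.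
rewrite !mulNr lerN2 ler_wpM2r ?invr_ge0 ?mulrn_wge0 ?sqr_ge0//.
by rewrite -(real_normK (num_real x)) -(real_normK (num_real y)) lerXn2r ?nnegrE.
Qed.

Lemma gpdf1_le1 x : gpdf 1 x <= 1.
Proof.
rewrite gpdfE// -[leRHS]mulr1 ler_pM ?normal_peak_ge0 ?expR_ge0//; last first.
  by rewrite -expR0 ler_expR mulNr oppr_le0 mulr_ge0 ?sqr_ge0 ?invr_ge0.
rewrite /normal_peak expr1n mul1r invf_le1; last by rewrite sqrtr_gt0 mulrn_wgt0// pi_gt0.
rewrite -[leLHS]sqrtr1 ler_wsqrtr//.
have := @pi_ge2 R; rewrite mulr2n; lra.
Qed.

Lemma normal_peakM (s t c d : R) : 0 < s -> 0 < t -> 0 < c -> 0 < d -> s * t = c * d ->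
  normal_peak s * normal_peak t = normal_peak c * normal_peak d.
Proof.
move=> s0 t0 c0 d0 stcd; rewrite /normal_peak -!invfM; congr (_^-1).
have p0 u : 0 <= u ^+ 2 * pi *+ 2 :> R by rewrite mulrn_wge0// mulr_ge0 ?sqr_ge0 ?pi_ge0.
rewrite -sqrtrM// -sqrtrM//; apply: (congr1 Num.sqrt).
have -> : (s ^+ 2 * pi *+ 2) * (t ^+ 2 * pi *+ 2) = (s * t) ^+ 2 * pi ^+ 2 *+ 4 by ring.
by rewrite stcd; ring.
Qed.

(** Completing the square: the joint density of the first summand [x] and the sum [y] is the density
    of the sum times the conditional density of [x] given [y]. The latter integrates to 1, which
    gives stability under convolution. *)
Lemma gpdf_conv_split (s t x y : R) : 0 < s -> 0 < t ->
  gpdf s x * gpdf t (y - x) =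
  gpdf (Num.sqrt (s ^+ 2 + t ^+ 2)) y *
  normal_pdf (y * s ^+ 2 / (s ^+ 2 + t ^+ 2)) (s * t / Num.sqrt (s ^+ 2 + t ^+ 2)) x.
Proof.
move=> s0 t0; set c := Num.sqrt _.
have c20 : 0 < s ^+ 2 + t ^+ 2 by rewrite addr_gt0 ?exprn_gt0.
have c0 : 0 < c by rewrite sqrtr_gt0.
have c2 : c ^+ 2 = s ^+ 2 + t ^+ 2 by rewrite sqr_sqrtr// ltW.
have d0 : 0 < s * t / c by rewrite divr_gt0 ?mulr_gt0.
rewrite !gpdfE// normal_pdfE ?gt_eqF// /normal_fun.
rewrite mulrACA [RHS]mulrACA; congr (_ * _).
  by apply: normal_peakM => //; rewrite mulrCA divff ?mulr1 ?gt_eqF.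
rewrite -!expRD; congr expR.
rewrite !exprMn exprVn c2.
field; rewrite !gt_eqF//.
Qed.

Lemma gauss_stable (s t : R) (h : R -> \bar R) : 0 < s -> 0 < t ->
  measurable_fun setT h -> (forall x, 0 <= h x)%E ->
  (\int[gauss s]_x \int[gauss t]_y h (x + y)%R =
   \int[gauss (Num.sqrt (s ^+ 2 + t ^+ 2))%R]_x h x)%E.
Proof.
move=> s0 t0 mh h0.
have mgE (u : R) : measurable_fun setT (EFin \o gpdf u).
  by apply/measurable_EFinP; exact: pdf_measurable.
have mhx (x : R) : measurable_fun setT (fun y : R => h (x + y)%R).
  by apply: measurableT_comp => //; exact: measurable_funD.
have mtx (x : R) : measurable_fun setT (fun y : R => (gpdf t (y - x))%:E * h y)%E.
  apply: emeasurable_funM => //.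
  by apply: (measurableT_comp (mgE t)); exact: measurable_funB.
have tx0 (x y : R) : (0 <= (gpdf t (y - x))%:E * h y)%E.
  by apply: mule_ge0 => //; rewrite lee_fin pdf_ge0.
have inner (x : R) : (\int[gauss t]_y h (x + y)%R = \int[mu]_y ((gpdf t (y - x))%:E * h y))%E.
  rewrite [LHS](ge0_integral_dens _ (mhx x)); last by move=> y; exact: h0.
  rewrite -[RHS](ge0_integral_shift x (mtx x)); last by move=> y; exact: tx0.
  by apply: eq_integral => y _; rewrite addrK addrC.
have m2 : measurable_fun setT (fun xy : R * R => ((gpdf s xy.1)%:E * ((gpdf t (xy.2 - xy.1))%:E * h xy.2))%E).
  apply: emeasurable_funM.
    by apply: (measurableT_comp (mgE s)).
  apply: emeasurable_funM; last by apply: (measurableT_comp mh).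
  by apply: (measurableT_comp (mgE t)); exact: measurable_funB.
transitivity (\int[mu]_x \int[mu]_y ((gpdf s x)%:E * ((gpdf t (y - x))%:E * h y)))%E.
  rewrite ge0_integral_dens; last 2 first.
  - have := @measurable_fun_fubini_tonelli_F _ _ _ _ _ (gauss t) (fun xy : R * R => h (xy.1 + xy.2)%R).
    apply => //; apply: (measurableT_comp mh); exact: measurable_funD.
  - by move=> x; apply: integral_ge0.
  apply: eq_integral => x _; rewrite inner.
  apply/esym/(@ge0_integralZl _ _ _ mu setT measurableT _ (mtx x)).
    by move=> y _; exact: tx0.
  by rewrite lee_fin pdf_ge0.
have := @fubini_tonelli _ _ _ _ _ mu mu _ m2; move=> ->; last first.
  move=> x; apply: mule_ge0; first by rewrite lee_fin pdf_ge0.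
  by apply: mule_ge0; first by rewrite lee_fin pdf_ge0.
rewrite [RHS](ge0_integral_dens _ mh); last by move=> y; exact: h0.
apply: eq_integral => y _.
pose nm := normal_pdf (y * s ^+ 2 / (s ^+ 2 + t ^+ 2)) (s * t / Num.sqrt (s ^+ 2 + t ^+ 2)).
transitivity (\int[mu]_x (((gpdf (Num.sqrt (s ^+ 2 + t ^+ 2)) y)%:E * h y) * (nm x)%:E))%E.
  apply: eq_integral => x _; rewrite muleA -EFinM gpdf_conv_split; [|exact: s0|exact: t0].
  by rewrite EFinM muleAC.
rewrite (@ge0_integralZl _ _ _ mu setT measurableT).
- by rewrite integral_normal_pdf mule1.
- by apply/measurable_EFinP; exact: measurable_normal_pdf.
- by move=> x _; rewrite lee_fin normal_pdf_ge0.
- by apply: mule_ge0; [rewrite lee_fin pdf_ge0|exact: h0].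
Qed.

End gaussian.

Section gaussian_moments.
Context {R : realType}.
Local Notation mu := (@lebesgue_measure R).

Lemma is_derive_gpdf (s : R) (x : R) : 0 < s ->
  is_derive x 1 (gpdf s : R -> R) (- (x / s ^+ 2) * gpdf s x).
Proof.
move=> s0.
have -> : (gpdf s : R -> R) = (fun x => normal_peak s * expR (- x ^+ 2 / (s ^+ 2 *+ 2))).
  by apply/funext => y; exact: gpdfE.
apply: is_derive_eq; rewrite /GRing.scale/= -mulr_natl.
by field; rewrite ?gt_eqF.
Qed.

Lemma is_derive_Xn n (x : R) : is_derive x 1 (fun y : R => y ^+ n) (n%:R * x ^+ n.-1).
Proof.
rewrite (_ : (fun y : R => y ^+ n) = (@id R) ^+ n); last by apply/funext => y; rewrite exprfctE.
by apply: is_derive_eq; rewrite /GRing.scale/= mulr1.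
Qed.

(** Gaussian integration by parts in the form of an antiderivative; it links the moments of orders
    [k + 2] and [k]. *)
Lemma is_derive_gauss_parts (s : R) k (x : R) : 0 < s ->
  is_derive x 1 (fun y : R => - s ^+ 2 * y ^+ k.+1 * gpdf s y)
    (x ^+ k.+2 * gpdf s x - k.+1%:R * s ^+ 2 * (x ^+ k * gpdf s x)).
Proof.
move=> s0; have := is_derive_gpdf x s0; move: (gpdf s : R -> R) => g H.
have HX := is_derive_Xn k.+1 x.
apply: is_derive_eq; rewrite /GRing.scale/= !exprS.
by field; rewrite ?gt_eqF.
Qed.

Lemma continuous_gpdf (s : R) : 0 < s -> continuous (gpdf s : R -> R).
Proof. by move=> s0; apply: continuous_normal_pdf; rewrite gt_eqF. Qed.

Lemma gauss_parts (s : R) k (n : nat) : 0 < s ->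
  (\int[mu]_(x in `[(- n.+1%:R)%R, n.+1%:R%R]) (x ^+ k.+2 * gpdf s x - k.+1%:R * s ^+ 2 * (x ^+ k * gpdf s x))%:E =
   (- s ^+ 2 * n.+1%:R ^+ k.+1 * gpdf s n.+1%:R)%:E
   - (- s ^+ 2 * (- n.+1%:R) ^+ k.+1 * gpdf s n.+1%:R)%:E)%E.
Proof.
move=> s0; rewrite -{2}(gpdfN n.+1%:R s0).
pose F := (fun y : R => - s ^+ 2 * y ^+ k.+1 * gpdf s y).
have dF x : derivable F x 1 by have [] := is_derive_gauss_parts k x s0.
have cF : continuous F by move=> x; apply/differentiable_continuous/derivable1_diffP.
have cX j : continuous (fun x : R => x ^+ j) by exact: exprn_continuous.
have := @continuous_FTC2 R (fun x => x ^+ k.+2 * gpdf s x - k.+1%:R * s ^+ 2 * (x ^+ k * gpdf s x))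
  F (- n.+1%:R) n.+1%:R.
apply.
- by rewrite -subr_gt0 opprK -natrD ltr0n.
- apply: continuous_subspaceT => x.
  apply: cvgB; first by apply: cvgM; [exact: cX|exact: continuous_gpdf].
  apply: cvgM; first exact: cvg_cst.
  by apply: cvgM; [exact: cX|exact: continuous_gpdf].
- split; first by move=> x _; exact: dF.
  + by apply: cvg_at_right_filter; exact: cF.
  + by apply: cvg_at_left_filter; exact: cF.
- by move=> x _; rewrite derive1E; have [_ ->] := is_derive_gauss_parts k x s0.
Qed.

Let I (n : nat) : set R := `[- n.+1%:R, n.+1%:R]%classic.

Lemma gauss_int_cvg (h : R -> R) : measurable_fun setT h -> (forall x, 0 <= h x) ->
  (\int[mu]_(x in I n) (h x)%:E @[n --> \oo] --> \int[mu]_x (h x)%:E)%E.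
Proof.
move=> mh h0; have -> : (\int[mu]_x (h x)%:E = \int[mu]_(x in \bigcup_n I n) (h x)%:E)%E.
  congr (integral _ _ _); apply/esym/seteqP; split => // x _.
  have [k xk] : exists k : nat, `|x : R| < k%:R.
    by exists (Num.bound `|x : R|); apply: archi_boundP; exact: normr_ge0.
  exists k => //; rewrite /I /= in_itv/= -ler_norml (le_trans (ltW xk))// ler_nat.
  exact: leqnSn.
apply: ge0_nondecreasing_set_cvg_integral.
- apply/nondecreasing_seqP => n; apply/subsetPset => x; rewrite /I/= !in_itv/= -!ler_norml.
  by move=> /le_trans; apply; rewrite ler_nat.
- by move=> i; exact: measurable_itv.
- by move=> i; apply/measurable_EFinP/measurable_funTS.
- by move=> i x _; rewrite lee_fin.
Qed.

Lemma measurable_Xgpdf (s : R) k : measurable_fun setT (fun x : R => x ^+ k * gpdf s x).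
Proof.
apply: measurable_funM; last exact: pdf_measurable.
exact: measurable_funX.
Qed.

Lemma Xgpdf_ge0 (s : R) k (x : R) : ~~ odd k -> 0 <= x ^+ k * gpdf s x.
Proof. by move=> ek; rewrite mulr_ge0 ?pdf_ge0// exprn_even_ge0. Qed.

Lemma gauss_partsE (s : R) k (n : nat) : 0 < s -> ~~ odd k ->
  (\int[mu]_(x in I n) (x ^+ k.+2 * gpdf s x)%:E + (2 * s ^+ 2 * n.+1%:R ^+ k.+1 * gpdf s n.+1%:R)%:E =
   (k.+1%:R * s ^+ 2)%:E * \int[mu]_(x in I n) (x ^+ k * gpdf s x)%:E)%E.
Proof.
move=> s0 ek.
have ci j : mu.-integrable (I n) (EFin \o (fun x : R => x ^+ j * gpdf s x)).
  apply: continuous_compact_integrable; first exact: segment_compact.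
  apply: continuous_subspaceT => x; apply: cvgM; first exact: exprn_continuous.
  exact: continuous_gpdf.
have := gauss_parts k n s0.
have mI : measurable (I n : set (measurableTypeR R)) by exact: measurable_itv.
under eq_integral do rewrite EFinB.
rewrite integralB_EFin; [|exact: mI|exact: ci|exact: (integrableZl mI _ (ci k))].
rewrite [X in (_ - X)%E = _ -> _](_ : _ = (k.+1%:R * s ^+ 2)%:E * \int[mu]_(x in I n) (x ^+ k * gpdf s x)%:E)%E; last first.
  by rewrite -integralZl//; apply: ci.
have f1 := integrable_fin_num mI (ci k.+2).
have f2 := integrable_fin_num mI (ci k).
rewrite -(fineK f1) -(fineK f2) -!EFinM -!EFinB -EFinD => -[] h; congr EFin.
move: h; rewrite exprNn -signr_odd /= ek expr1 => h; lra.
Qed.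

Lemma gauss_tail0 (s : R) : 0 < s -> (2 * s ^+ 2 * n.+1%:R ^+ 1 * gpdf s n.+1%:R : R) @[n --> \oo] --> 0.
Proof.
move=> s0.
have ub n : 2 * s ^+ 2 * n.+1%:R ^+ 1 * gpdf s n.+1%:R <= 4 * s ^+ 4 * normal_peak s * n.+1%:R^-1 :> R.
  rewrite gpdfE// expr1.
  have n0 : 0 < n.+1%:R :> R by rewrite ltr0n.
  have p0 := normal_peak_ge0 s.
  set u := n.+1%:R ^+ 2 / (s ^+ 2 *+ 2) : R.
  have u0 : 0 < u by rewrite divr_gt0 ?exprn_gt0// mulrn_wgt0// exprn_gt0.
  have eu : expR (- u) <= u^-1.
    rewrite expRN lef_pV2 ?posrE ?expR_gt0//.
    by rewrite (le_trans _ (expR_ge1Dx u))// lerDr.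
  rewrite mulNr -/u.
  have -> : 4 * s ^+ 4 * normal_peak s * n.+1%:R^-1 = 2 * s ^+ 2 * n.+1%:R * (normal_peak s * u^-1).
    rewrite /u invf_div mulr2n; field; rewrite gt_eqF// gt_eqF//.
  apply: ler_wpM2l; first by rewrite ?mulr_ge0 ?(ltW s0) ?(ltW n0).
  by apply: ler_wpM2l.
apply: (@squeeze_cvgr _ _ _ _ (fun=> 0) (fun n => 4 * s ^+ 4 * normal_peak s * n.+1%:R^-1)).
- near=> n; rewrite ub andbT ?mulr_ge0 ?(ltW s0) ?pdf_ge0//.
- exact: cvg_cst.
- rewrite -[X in _ --> X](mulr0 (4 * s ^+ 4 * normal_peak s)).
  apply: cvgM; [exact: cvg_cst|exact: cvg_harmonic].
Unshelve. all: by end_near.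
Qed.

Lemma gauss_var (s : R) : 0 < s -> (\int[mu]_x (x ^+ 2 * gpdf s x)%:E = (s ^+ 2)%:E)%E.
Proof.
move=> s0.
have c2 := @gauss_int_cvg _ (measurable_Xgpdf s 2) (fun x => Xgpdf_ge0 s x (k := 2) isT).
have c0 := @gauss_int_cvg _ (measurable_Xgpdf s 0) (fun x => Xgpdf_ge0 s x (k := 0) isT).
have ct : ((2 * s ^+ 2 * n.+1%:R ^+ 1 * gpdf s n.+1%:R)%:E @[n --> \oo] --> (0:R)%:E)%E.
  by apply: cvg_EFin; [exact: nearW|exact: gauss_tail0].
have l1 := cvgeD _ c2 ct.
have l2 : ((s ^+ 2)%:E * \int[mu]_(x in I n) (x ^+ 0 * gpdf s x)%:E @[n --> \oo] -->
  (s ^+ 2)%:E * \int[mu]_x (x ^+ 0 * gpdf s x)%:E)%E by apply: cvgeZl.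
move: l2; rewrite [X in _ --> X -> _](_ : _ = (s ^+ 2)%:E); last first.
  rewrite (_ : (\int[mu]_x _)%E = 1%E) ?mule1// -[RHS](pdf_int1 (gpdf s)).
  by apply: eq_integral => x _; rewrite expr0 mul1r.
have -> : (fun n => (s ^+ 2)%:E * \int[mu]_(x in I n) (x ^+ 0 * gpdf s x)%:E)%E =
  (fun n => \int[mu]_(x in I n) (x ^+ 2 * gpdf s x)%:E + (2 * s ^+ 2 * n.+1%:R ^+ 1 * gpdf s n.+1%:R)%:E)%E.
  by apply/funext => n; rewrite gauss_partsE// mul1r.
move=> l2; have h : (\int[mu]_x (x ^+ 2 * gpdf s x)%:E +? 0%:E)%E by rewrite fin_num_adde_defl.
apply: (cvg_unique (@ereal_hausdorff R) _ l2).
by have := l1 _ h; rewrite adde0 => l3; exact: l3.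
Qed.

(** An upper bound suffices here, so the boundary term of the integration by parts is dropped by its
    sign instead of being sent to 0. *)
Lemma gauss_fourth (s : R) : 0 < s -> (\int[mu]_x (x ^+ 4 * gpdf s x)%:E <= (3 * s ^+ 4)%:E)%E.
Proof.
move=> s0.
have c4 := @gauss_int_cvg _ (measurable_Xgpdf s 4) (fun x => Xgpdf_ge0 s x (k := 4) isT).
rewrite -(cvg_lim _ c4)//; apply: lime_le; first by apply/cvg_ex; eexists; exact: c4.
apply: nearW => n.
apply: (@le_trans _ _ ((3 * s ^+ 2)%:E * \int[mu]_(x in I n) (x ^+ 2 * gpdf s x)%:E)%E).
  rewrite -(@gauss_partsE s 2 n s0 isT) leeDl// lee_fin.
  by rewrite ?mulr_ge0 ?exprn_ge0 ?(ltW s0) ?pdf_ge0.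
rewrite (_ : 3 * s ^+ 4 = 3 * s ^+ 2 * s ^+ 2); last by ring.
rewrite [X in (_ <= X)%E]EFinM; apply: lee_wpmul2l; first by rewrite lee_fin ?mulr_ge0 ?(ltW s0).
rewrite -gauss_var//.
apply: ge0_subset_integral => //; first exact: measurable_itv.
  by apply/measurable_EFinP; exact: measurable_Xgpdf.
by move=> x _; rewrite lee_fin Xgpdf_ge0.
Qed.

Lemma gauss_sqr (s : R) (a c : R) : 0 < s ->
  (\int[gauss s]_x ((a + c * x) ^+ 2)%:E = (a ^+ 2 + c ^+ 2 * s ^+ 2)%:E)%E.
Proof.
move=> s0.
have m1 (u w : R) : measurable_fun setT (fun x : R => ((u + w * x) ^+ 2)%:E).
  apply/measurable_EFinP; apply: measurable_funX; exact: measurable_funD.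
have E (u w : R) : (\int[gauss s]_x ((u + w * x) ^+ 2)%:E = \int[mu]_x (gpdf s x * (u + w * x) ^+ 2)%:E)%E.
  rewrite ge0_integral_dens; [|exact: m1|by move=> x; rewrite lee_fin sqr_ge0].
  by apply: eq_integral => x _; rewrite EFinM.
have mE u w : measurable_fun setT (fun x : R => (gpdf s x * (u + w * x) ^+ 2)%:E).
  apply/measurable_EFinP; apply: measurable_funM; first exact: pdf_measurable.
  by apply/measurable_EFinP; exact: m1.
(* Adding the reflected integral cancels the cross term pointwise, so that all integrands stay
   nonnegative. *)
have symm : (\int[mu]_x (gpdf s x * (a + c * x) ^+ 2)%:E = \int[mu]_x (gpdf s x * (a + - c * x) ^+ 2)%:E)%E.
  rewrite -[LHS](@ge0_integral_opp _ (fun x => (gpdf s x * (a + c * x) ^+ 2)%:E)).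
  - by apply: eq_integral => x _; rewrite gpdfN// mulrN mulNr.
  - exact: mE.
  - by move=> x; rewrite lee_fin mulr_ge0 ?pdf_ge0 ?sqr_ge0.
have sum : (\int[mu]_x (gpdf s x * (a + c * x) ^+ 2)%:E + \int[mu]_x (gpdf s x * (a + - c * x) ^+ 2)%:E =
   (2 * (a ^+ 2 + c ^+ 2 * s ^+ 2))%:E)%E.
  rewrite -ge0_integralD; [| exact: measurableT| | exact: mE| | exact: mE]; last 2 first.
  - by move=> x _; rewrite lee_fin mulr_ge0 ?pdf_ge0 ?sqr_ge0.
  - by move=> x _; rewrite lee_fin mulr_ge0 ?pdf_ge0 ?sqr_ge0.
  transitivity (\int[mu]_x ((2 * a ^+ 2)%:E * (gpdf s x)%:E + (2 * c ^+ 2)%:E * (x ^+ 2 * gpdf s x)%:E))%E.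
    by apply: eq_integral => x _; rewrite -!EFinM -!EFinD; congr EFin; ring.
  have k1 : 0 <= 2 * a ^+ 2 by rewrite mulr_ge0 ?sqr_ge0.
  have k2 : 0 <= 2 * c ^+ 2 by rewrite mulr_ge0 ?sqr_ge0.
  have mg : measurable_fun setT (fun x : R => (gpdf s x)%:E).
    by apply/measurable_EFinP; exact: pdf_measurable.
  have mg2 : measurable_fun setT (fun x : R => (x ^+ 2 * gpdf s x)%:E).
    by apply/measurable_EFinP; exact: measurable_Xgpdf.
  rewrite ge0_integralD; [|exact: measurableT| | | |]; last 4 first.
  - by move=> x _; rewrite mule_ge0 ?lee_fin ?pdf_ge0.
  - by apply: measurable_funeM; exact: mg.
  - by move=> x _; rewrite mule_ge0 ?lee_fin ?Xgpdf_ge0.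
  - by apply: measurable_funeM; exact: mg2.
  rewrite ge0_integralZl; [|exact: measurableT|exact: mg|by move=> x _; rewrite lee_fin pdf_ge0|by rewrite lee_fin].
  rewrite ge0_integralZl; [|exact: measurableT|exact: mg2|by move=> x _; rewrite lee_fin Xgpdf_ge0|by rewrite lee_fin].
  rewrite pdf_int1 gauss_var// mule1 -EFinM -EFinD; congr EFin; ring.
rewrite E; move: sum; rewrite -symm.
case: (\int[mu]_x _)%E => // r; rewrite -EFinD => -[] h; congr EFin; lra.
Qed.

End gaussian_moments.

Section gauss_op.
Context {R : realType}.
Local Notation mu := (@lebesgue_measure R).
Local Notation Z := (nat -> R).

Lemma integral_prob_cst d (T : measurableType d) (P : probability T R) (c : \bar R) :
  (\int[P]__ c = c)%E.
Proof. by rewrite integral_cst//= probability_setT mule1. Qed.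

Definition unitv (j : nat) (x : R) : Z := fun k => if k == j then x else 0.

Definition gstep (s : R) (j : nat) := stepop (gauss s) (unitv j).

Lemma measurable_unitv j k : measurable_fun setT (fun x => unitv j x k).
Proof. by rewrite /unitv; case: (k == j) => //; exact: measurable_cst. Qed.

Lemma gstep_ok s j : op_ok (gstep s j).
Proof. by apply: stepop_ok => k; exact: measurable_unitv. Qed.

Lemma gstep_comm s j s' j' : op_comm (gstep s j) (gstep s' j').
Proof. by apply: stepop_comm => k; exact: measurable_unitv. Qed.

Fixpoint gauss_op (s : R) (m : nat) : (Z -> \bar R) -> Z -> \bar R :=
  match m with 0 => id | k.+1 => gstep s k \o gauss_op s k end.

Lemma gauss_op_ok s m : op_ok (gauss_op s m).
Proof.
elim: m => [|m IH]; first exact: op_ok_id.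
by apply: (@op_ok_comp _ (gstep s m) (gauss_op s m)) => //; exact: gstep_ok.
Qed.

Lemma gauss_op_comm s m A : op_ok A -> (forall j, op_comm A (gstep s j)) ->
  op_comm A (gauss_op s m).
Proof.
move=> okA AC; elim: m => [|m IH]; first exact: op_comm_id.
apply: (@op_comm_comp _ A (gstep s m) (gauss_op s m)) => //.
  exact: gstep_ok.
exact: gauss_op_ok.
Qed.

Lemma zadd_unitv (z : Z) j (x y : R) :
  zadd (zadd z (unitv j x)) (unitv j y) = zadd z (unitv j (x + y)).
Proof.
apply/funext => k; rewrite /zadd /unitv; case: ifP => _; first by rewrite addrA.
by rewrite !addr0.
Qed.

Lemma sqrt_natM_step (s : R) n : 0 < s ->
  Num.sqrt n.+2%:R * s = Num.sqrt (s ^+ 2 + (Num.sqrt n.+1%:R * s) ^+ 2).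
Proof.
move=> s0; have -> : s ^+ 2 + (Num.sqrt n.+1%:R * s) ^+ 2 = (Num.sqrt n.+2%:R * s) ^+ 2.
  by rewrite 2!exprMn !sqr_sqrtr ?ler0n// -(natr1 n.+1); ring.
by rewrite sqrtr_sqr ger0_norm// mulr_ge0 ?sqrtr_ge0// ltW.
Qed.

Lemma gstep_iter (s : R) j n g : 0 < s -> good g ->
  iter n.+1 (gstep s j) g = gstep (Num.sqrt n.+1%:R * s) j g.
Proof.
move=> s0 gg; elim: n => [|n IH]; first by rewrite sqrtr1 mul1r.
rewrite iterS IH; apply/funext => z; rewrite /gstep /stepop.
have mz : measurable_fun setT (fun x => g (zadd z (unitv j x))).
  by apply: measurable_shift; [move=> k; exact: measurable_unitv|exact: good_mZ].
rewrite (_ : Num.sqrt n.+2%:R * s = Num.sqrt (s ^+ 2 + (Num.sqrt n.+1%:R * s) ^+ 2)).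
  rewrite -(gauss_stable s0 _ mz).
  - by apply: eq_integral => x _; apply: eq_integral => y _; rewrite zadd_unitv.
  - by rewrite mulr_gt0// sqrtr_gt0 ltr0n.
  - by move=> x; exact: good_ge0.
exact: sqrt_natM_step.
Qed.

(** Splits a standard Gaussian vector into [n + 1] independent equal parts, one to be exchanged
    against each observation. *)
Lemma gauss_op_iter m n g : good g ->
  iter n.+1 (gauss_op (Num.sqrt n.+1%:R)^-1 m) g = gauss_op 1 m g.
Proof.
move=> gg; elim: m => [|m IH]; first by elim: n.+1 => //= k ->.
have s0 : 0 < (Num.sqrt n.+1%:R)^-1 :> R by rewrite invr_gt0 sqrtr_gt0 ltr0n.
pose s := (Num.sqrt n.+1%:R)^-1 : R.
transitivity (iter n.+1 (gstep s m) (iter n.+1 (gauss_op s m) g)).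
  apply: iter_comp_comm; [exact: gstep_ok|exact: gauss_op_ok| |exact: gg].
  by apply: gauss_op_comm => [|j]; [exact: gstep_ok|exact: gstep_comm].
rewrite IH gstep_iter; [|exact: s0|by have [+ _ _ _ _] := gauss_op_ok 1 m; exact].
by rewrite /s mulfV// gt_eqF// sqrtr_gt0 ltr0n.
Qed.

Lemma gauss_op_local s m g1 g2 z : (forall z', (forall k, (m <= k)%N -> z' k = z k) -> g1 z' = g2 z') ->
  gauss_op s m g1 z = gauss_op s m g2 z.
Proof.
elim: m z => [|m IH] z h /=; first exact: h.
apply: eq_integral => x _; apply: IH => z' h'; apply: h => k mk.
rewrite h'; last exact: ltnW.
by rewrite /zadd /unitv gt_eqF ?addr0.
Qed.

(* The centred Gaussian vector of variance s^2 realizes [gauss_op s m] as a single step. *)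
Lemma gauss_op_step (s : R) m : 0 < s ->
  exists d (T : measurableType d) (P : probability T R) (y : T -> Z),
  [/\ (forall j, measurable_fun setT (fun t => y t j)),
      (forall g, good g -> stepop P y g = gauss_op s m g),
      (forall t j, (m <= j)%N -> y t j = 0),
      (forall a (c : nat -> R), \int[P]_t ((a + \sum_(j < m) c j * y t j) ^+ 2)%:E =
          (a ^+ 2 + s ^+ 2 * \sum_(j < m) c j ^+ 2)%:E)%E
    & (forall j, (j < m)%N -> \int[P]_t ((y t j) ^+ 4)%:E <= (3 * s ^+ 4)%:E)%E].
Proof.
move=> s0; elim: m => [|m [d [T [P [y [my yE ym y2 y4]]]]]].
  exists _, R, (gauss s), (fun _ _ => 0); split => //.
  - move=> g gg; apply/funext => z; rewrite /stepop (_ : (fun x => _) = (fun=> g z)).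
      exact: integral_prob_cst.
    by apply/funext => x; congr g; apply/funext => j; rewrite /zadd addr0.
  - move=> a c; rewrite [in RHS]big_ord0 mulr0 addr0.
    rewrite (_ : (fun t => _) = (fun=> (a ^+ 2)%:E)).
      exact: integral_prob_cst.
    by apply/funext => t; rewrite big_ord0 addr0.
pose y' (tx : T * R) : Z := fun j => if j == m then tx.2 else y tx.1 j.
exists _, (T * R)%type, (P \x gauss s)%E, y'.
have my' j : measurable_fun setT (fun t => y' t j).
  rewrite /y'; case: (j == m); first exact: measurable_snd.
  exact: (measurableT_comp (my j)).
split => //.
- move=> g gg; rewrite /= -yE//.
  have -> : stepop (P \x gauss s)%E y' g = stepop P y (gstep s m g).
    apply/funext => z; rewrite /stepop fubini_tonelli1/=.
    + apply: eq_integral => t _; apply: eq_integral => x _; congr g.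
      apply/funext => k; rewrite /zadd /y' /unitv/=; case: eqP => [->|_].
        by rewrite ym// addr0.
      by rewrite addr0.
    + by apply: measurable_shift => //; exact: good_mZ.
    + by move=> tx; exact: good_ge0.
  by apply: stepop_comm => // j; exact: measurable_unitv.
- by move=> t j mj; rewrite /y' gt_eqF// ym// ltnW.
- move=> a c.
  rewrite fubini_tonelli1/=; last 2 first.
  + apply/measurable_EFinP; apply: measurable_funX; apply: measurable_funD => //.
    by apply: measurable_sum => i; apply: measurable_funM => //; exact: my'.
  + by move=> tx; rewrite lee_fin sqr_ge0.
  rewrite /fubini_F.
  transitivity (\int[P]_t (((a + \sum_(j < m) c j * y t j) ^+ 2)%:E + (c m ^+ 2 * s ^+ 2)%:E))%E.
    apply: eq_integral => t _; rewrite -EFinD -gauss_sqr//.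
    apply: eq_integral => x _; congr ((_ ^+ 2)%:E).
    rewrite big_ord_recr/= addrA /y'/= eqxx; congr (_ + _ + _).
    by apply: eq_bigr => i _; rewrite (ltn_eqF (ltn_ord i)).
  rewrite ge0_integralD//=; last 3 first.
  + by move=> t _; rewrite lee_fin sqr_ge0.
  + apply/measurable_EFinP; apply: measurable_funX; apply: measurable_funD => //.
    by apply: measurable_sum => i; apply: measurable_funM.
  + by move=> t _; rewrite lee_fin mulr_ge0 ?sqr_ge0.
  rewrite y2 integral_prob_cst -EFinD; congr EFin.
  by rewrite big_ord_recr/=; ring.
- move=> j; rewrite ltnS leq_eqVlt => /orP[/eqP ->|jm].
  + rewrite fubini_tonelli1/=; last 2 first.
    * by apply/measurable_EFinP; apply: measurable_funX; exact: my'.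
    * by move=> tx; rewrite lee_fin exprn_even_ge0.
    rewrite /fubini_F /y'/= eqxx.
    rewrite integral_prob_cst.
    apply: le_trans (gauss_fourth s0).
    rewrite ge0_integral_dens; last 2 first.
    * by apply/measurable_EFinP; exact: measurable_funX.
    * by move=> x; rewrite lee_fin exprn_even_ge0.
    by under eq_integral do rewrite -EFinM mulrC.
  + rewrite fubini_tonelli1/=; last 2 first.
    * by apply/measurable_EFinP; apply: measurable_funX; exact: my'.
    * by move=> tx; rewrite lee_fin exprn_even_ge0.
    rewrite /fubini_F /y'/= (ltn_eqF jm).
    under eq_integral do rewrite integral_prob_cst.
    exact: y4.
Qed.

End gauss_op.

(** * Anderson's inequality on the line and its strict form *)

Section anderson.
Context {R : realType}.
Local Notation mu := (@lebesgue_measure R).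
Local Notation Z := (nat -> R).
Local Notation G := (@gpdf R 1).

Lemma measurable_compD (k : R -> R) (c : R) : measurable_fun setT k ->
  measurable_fun setT (fun y : R => k (y + c)).
Proof. by move=> mk; apply: (measurableT_comp mk); exact: measurable_funD. Qed.

Lemma ge0_gauss1E (k : R -> R) : measurable_fun setT k -> (forall y, 0 <= k y) ->
  (\int[gauss 1]_y (k y)%:E = \int[mu]_y (G y * k y)%:E)%E.
Proof.
move=> mk k0; rewrite ge0_integral_dens.
- by apply: eq_integral => y _; rewrite EFinM.
- exact/measurable_EFinP.
- by move=> y; rewrite lee_fin.
Qed.

Lemma measurable_GM (k : R -> R) (b c : R) : measurable_fun setT k ->
  measurable_fun setT (fun y : R => (G (y + b) * k (y + c))%:E).
Proof.
move=> mk; apply/measurable_EFinP; apply: measurable_funM.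
  by apply: measurable_compD; exact: pdf_measurable.
exact: measurable_compD.
Qed.

Lemma ge0_integral_addR (f g : R -> R) : measurable_fun setT f -> measurable_fun setT g ->
  (forall y, 0 <= f y) -> (forall y, 0 <= g y) ->
  (\int[mu]_y (f y)%:E + \int[mu]_y (g y)%:E = \int[mu]_y (f y + g y)%:E)%E.
Proof.
move=> mf mg f0 g0; rewrite -ge0_integralD.
- by apply: eq_integral => y _; rewrite EFinD.
- exact: measurableT.
- by move=> y _; rewrite lee_fin.
- exact/measurable_EFinP.
- by move=> y _; rewrite lee_fin.
- exact/measurable_EFinP.
Qed.

(* With [b = a / 2], both [E k(N)] and [E k(N + a)] are written in two ways around the
   midpoint; the difference of the sums is the integral of a product of two factors of
   the same sign. *)
Lemma anderson1 (k e : R -> R) (a : R) : measurable_fun setT k -> (forall y, 0 <= k y) ->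
  (forall y y', `|y| <= `|y'| -> k y' <= k y) ->
  measurable_fun setT e -> (forall y, 0 <= e y) ->
  (forall y, e y <= (k (y - a / 2) - k (y + a / 2)) * (G (y - a / 2) - G (y + a / 2))) ->
  (\int[gauss 1]_y (k (y + a))%:E + \int[gauss 1]_y (k (y + a))%:E + \int[mu]_y (e y)%:E <=
   \int[gauss 1]_y (k y)%:E + \int[gauss 1]_y (k y)%:E)%E.
Proof.
move=> mk k0 kd me e0 eb; set b := a / 2.
have ab : a = b + b by rewrite /b; field.
have kN y : k (- y) = k y by apply/eqP; rewrite eq_le !kd// normrN.
have GN y : G (- y) = G y by rewrite gpdfN.
have B c c' y : (0 <= (G (y + c) * k (y + c'))%:E)%E by rewrite lee_fin mulr_ge0 ?pdf_ge0.
have A0 c : (\int[mu]_y (G y * k y)%:E = \int[mu]_y (G (y + c) * k (y + c))%:E)%E.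
  rewrite -(ge0_integral_shift c)//.
  - by have := measurable_GM 0 0 mk; under eq_fun do rewrite !addr0.
  - by move=> y; rewrite lee_fin mulr_ge0 ?pdf_ge0.
have B1 : (\int[gauss 1]_y (k (y + a))%:E = \int[mu]_y (G (y - b) * k (y + b))%:E)%E.
  rewrite ge0_gauss1E; [|exact: measurable_compD|by []].
  have := @ge0_integral_shift _ (- b) (fun y => (G y * k (y + a))%:E) => <-.
  - by apply: eq_integral => y _; rewrite ab -addrA; congr ((_ * k (_ + _))%:E); ring.
  - by have := measurable_GM 0 a mk; under eq_fun do rewrite addr0.
  - by move=> y; rewrite lee_fin mulr_ge0 ?pdf_ge0.
have B2 : (\int[gauss 1]_y (k (y + a))%:E = \int[mu]_y (G (y + b) * k (y - b))%:E)%E.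
  rewrite B1 -(ge0_integral_opp (h := fun y => (G (y - b) * k (y + b))%:E)).
  - apply: eq_integral => y _; rewrite -(GN (- y - b)) -(kN (- y + b)).
    by rewrite !opprD !opprK.
  - exact: measurable_GM.
  - by move=> y; exact: B.
rewrite {1}B1 B2 ge0_gauss1E// {1}(A0 b) (A0 (- b)).
have mGG c c' : measurable_fun setT (fun y : R => G (y + c) * k (y + c')).
  by apply/measurable_EFinP; exact: measurable_GM.
have GG0 c c' y : 0 <= G (y + c) * k (y + c') by rewrite mulr_ge0 ?pdf_ge0.
rewrite 2?(ge0_integral_addR (mGG _ _) (mGG _ _) (GG0 _ _) (GG0 _ _)).
rewrite ge0_integral_addR; [|by apply: measurable_funD; exact: mGG|exact: me|
  by move=> y; rewrite addr_ge0 ?GG0|exact: e0].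
apply: ge0_le_integral; first exact: measurableT.
- by move=> y _; rewrite lee_fin !addr_ge0 ?GG0.
- apply/measurable_EFinP; apply: measurable_funD; last exact: me.
  by apply: measurable_funD; exact: mGG.
- by apply/measurable_EFinP; apply: measurable_funD; exact: mGG.
move=> y _; rewrite lee_fin; have := eb y; rewrite -/b; lra.
Qed.

Lemma anderson_prod_ge0 (k : R -> R) (b y : R) : (forall y y', `|y| <= `|y'| -> k y' <= k y) ->
  0 <= (k (y - b) - k (y + b)) * (G (y - b) - G (y + b)).
Proof.
move=> kd; have [h|/ltW h] := leP `|y - b| `|y + b|.
  by rewrite mulr_ge0// subr_ge0; [exact: kd|exact: gpdf_le].
by rewrite mulr_le0// subr_le0; [exact: kd|exact: gpdf_le].
Qed.

Lemma half_le (x y : \bar R) : (0 <= x)%E -> (x + x <= y + y)%E -> (x <= y)%E.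
Proof.
case: x => [x| |]; case: y => [y| |] //; rewrite -?EFinD ?lee_fin ?leey// => _; lra.
Qed.

Lemma anderson (k : R -> R) (a : R) : measurable_fun setT k -> (forall y, 0 <= k y) ->
  (forall y y', `|y| <= `|y'| -> k y' <= k y) ->
  (\int[gauss 1]_y (k (y + a))%:E <= \int[gauss 1]_y (k y)%:E)%E.
Proof.
move=> mk k0 kd; apply: half_le; first by apply: integral_ge0 => y _; rewrite lee_fin.
have := @anderson1 k (fun=> 0) a mk k0 kd (measurable_cst _) (fun=> lexx 0)
   (fun y => anderson_prod_ge0 (a / 2) y kd).
by rewrite integral0 adde0.
Qed.

Lemma integral_bump (e0 l u : R) : 0 <= e0 -> l <= u ->
  (\int[mu]_y (e0 * \1_`]l, u] y)%:E = (e0 * (u - l))%:E)%E.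
Proof.
move=> e00 lu; under eq_integral do rewrite EFinM.
rewrite ge0_integralZl//; [|exact/measurable_EFinP/measurable_indic].
rewrite integral_indic//= setIT lebesgue_measure_itv/= lte_fin.
rewrite lt_neqAle lu andbT; case: eqVneq => [->|_] /=.
  by rewrite subrr mulr0 mule0.
by rewrite -EFinB -EFinM.
Qed.

(** The product in [anderson1] is bounded below on an interval of length at least the minimum of
    [w0] and [a0]. With [z = y - a / 2] between 0 and [w1], the ratio of [G (z + a)] to [G z] is at
    most [expR (- (a ^+ 2 / 2))]. The final division by 2 undoes the doubling in [anderson1]; the
    gain depends on [w0], [w1], [a0] only. *)
Lemma anderson_strict_pos (w w0 w1 a a0 : R) : 0 < w0 -> w0 <= w <= w1 -> 0 < a0 -> a0 <= a ->
  (\int[gauss 1]_y ((`|y + a| <= w)%R%:R)%:E +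
    (G w1 * (1 - expR (- (a0 ^+ 2 / 2))) * Num.min w0 a0 / 2)%:E <=
   \int[gauss 1]_y ((`|y| <= w)%R%:R)%:E)%E.
Proof.
move=> w00 /andP[w0w ww1] a00 a0a; set e0 := G w1 * _.
pose k (y : R) : R := (`|y| <= w)%R%:R.
have a_gt0 : 0 < a by exact: lt_le_trans a0a.
have w_gt0 : 0 < w by exact: lt_le_trans w0w.
have mk : measurable_fun setT k.
  rewrite (_ : k = \1_`[- w, w]); first exact: measurable_indic.
  by apply/funext => y; rewrite indicE mem_setE/= in_itv/= -ler_norml.
have k0 y : 0 <= k y by rewrite /k ler0n.
have kd y y' : `|y| <= `|y'| -> k y' <= k y.
  by move=> yy'; rewrite /k ler_nat; case: (leP `|y'| w) => // /(le_trans yy') ->.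
have e00 : 0 <= e0.
  rewrite mulr_ge0 ?pdf_ge0// subr_ge0 -[leRHS]expR0 ler_expR oppr_le0.
  by rewrite divr_ge0 ?sqr_ge0.
(* For [y] in []l, u]] the point [y - a / 2] lies in [[0, w]] while [y + a / 2] is beyond [w]; the
   length [u - l] is the minimum of [w] and [a]. *)
set l := Num.max (a / 2) (w - a / 2); set u := a / 2 + w.
have lu : l <= u by rewrite ge_max /u; apply/andP; split; lra.
have ul : Num.min w0 a0 <= u - l.
  rewrite lerBrDl -lerBrDr ge_max /u.
  have m1 : Num.min w0 a0 <= w0 by rewrite ge_min lexx.
  have m2 : Num.min w0 a0 <= a0 by rewrite ge_min lexx orbT.
  by apply/andP; split; lra.
have := @anderson1 k (fun y => e0 * \1_`]l, u] y) a mk k0 kd _ _ _.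
rewrite integral_bump// => H.
have {}H : (\int[gauss 1]_y (k (y + a))%:E + \int[gauss 1]_y (k (y + a))%:E +
   (e0 * (u - l))%:E <= \int[gauss 1]_y (k y)%:E + \int[gauss 1]_y (k y)%:E)%E.
  apply: H.
  - by apply: measurable_funM => //; exact: measurable_indic.
  - by move=> y; rewrite mulr_ge0// indicE ler0n.
  move=> y; rewrite indicE mem_setE/= in_itv/=.
  case: (boolP (l < y <= u)) => [/andP[]|_]; last first.
    by rewrite mulr0 anderson_prod_ge0.
  rewrite gt_max => /andP[y1 y2] y3; rewrite mulr1.
  have -> : k (y - a / 2) = 1.
    by rewrite /k ler_norml (_ : _ && _ = true)//; apply/andP; split; rewrite /u in y3; lra.
  have -> : k (y + a / 2) = 0.
    rewrite /k (_ : (_ <= _) = false)//; apply/negP; rewrite ler_norml => /andP[_]; lra.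
  rewrite subr0 mul1r.
  set z := y - a / 2; have -> : y + a / 2 = z + a by rewrite /z; field.
  have z0 : 0 <= z by rewrite /z; lra.
  have zw : z <= w1 by rewrite /z; rewrite /u in y3; lra.
  have Gz : G w1 <= G z by apply: gpdf_le => //; rewrite !ger0_norm// (le_trans z0).
  apply: (@le_trans _ _ (G z * (1 - expR (- (a0 ^+ 2 / 2))))).
    rewrite ler_wpM2r// subr_ge0 -[leRHS]expR0 ler_expR oppr_le0.
    by rewrite divr_ge0 ?sqr_ge0.
  change (G z * (1 - expR (- (a0 ^+ 2 / 2))) <= G z - G (z + a)).
  rewrite mulrBr mulr1 lerD2l lerN2 (gpdfE z ltr01) (gpdfE (z + a) ltr01) -mulrA ler_wpM2l ?normal_peak_ge0//.
  rewrite -expRD ler_expR expr1n.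
  have : a0 ^+ 2 <= a ^+ 2 by rewrite lerXn2r ?nnegrE// ltW.
  have : 0 <= z * a by rewrite mulr_ge0// ltW.
  move=> h1 h2; rewrite (_ : (z + a) ^+ 2 = z ^+ 2 + 2 * (z * a) + a ^+ 2); last by ring.
  by clear -h1 h2; lra.
apply: half_le.
  apply: adde_ge0; first by apply: integral_ge0 => y _; rewrite lee_fin ler0n.
  by rewrite lee_fin divr_ge0// mulr_ge0// le_min (ltW w00) (ltW a00).
apply: le_trans H.
rewrite addeACA -EFinD leeD2l// lee_fin.
have : e0 * Num.min w0 a0 <= e0 * (u - l) by rewrite ler_wpM2l.
by lra.
Qed.

Lemma anderson_strict (w w0 w1 a a0 : R) : 0 < w0 -> w0 <= w <= w1 -> 0 < a0 -> a0 <= `|a| ->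
  (\int[gauss 1]_y ((`|y + a| <= w)%R%:R)%:E +
    (G w1 * (1 - expR (- (a0 ^+ 2 / 2))) * Num.min w0 a0 / 2)%:E <=
   \int[gauss 1]_y ((`|y| <= w)%R%:R)%:E)%E.
Proof.
move=> w00 ww a00 a0a; have [a_ge0|a_lt0] := leP 0 a.
  by apply: anderson_strict_pos => //; rewrite -(ger0_norm a_ge0).
rewrite (_ : (\int[gauss 1]_y ((`|y + a| <= w)%R%:R)%:E = \int[gauss 1]_y ((`|y + (- a)| <= w)%R%:R)%:E)%E).
  by apply: anderson_strict_pos => //; rewrite -(ltr0_norm a_lt0).
have mk c : measurable_fun setT (fun y : R => (`|y + c| <= w)%R%:R : R).
  rewrite (_ : (fun y => _) = \1_`[- w - c, w - c]); first exact: measurable_indic.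
  by apply/funext => y; rewrite indicE mem_setE/= in_itv/= ler_norml lerBlDr lerBrDr.
rewrite !ge0_gauss1E//.
rewrite -[LHS](@ge0_integral_opp _ (fun y => (G y * (`|y + a| <= w)%R%:R)%:E)).
- by apply: eq_integral => y _; rewrite gpdfN// -(normrN (- y + a)) opprD opprK.
- by have := measurable_GM 0 0 (mk a); under eq_fun do rewrite !addr0.
- by move=> y; rewrite lee_fin mulr_ge0 ?pdf_ge0.
Qed.

End anderson.

(** * Weighted sums of squared Gaussians *)

Section quadratic_mixtures.
Context {R : realType}.
Local Notation mu := (@lebesgue_measure R).
Local Notation Z := (nat -> R).
Local Notation G := (@gpdf R 1).

(** Weight of the frequency [j + 1]: the constant [phi 0] is outside the system, so every index from
    here on is shifted by one. *)
Definition lam (j : nat) : R := ((pi * j.+1%:R) ^+ 2)^-1.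

Lemma lam_gt0 j : 0 < lam j.
Proof. by rewrite invr_gt0 exprn_gt0// mulr_gt0 ?pi_gt0 ?ltr0n. Qed.

Definition Qm (m : nat) (z : Z) : R := \sum_(j < m) lam j * z j ^+ 2.

(** A scalar running sum is encoded as a sequence, with the same increment in every coordinate, so
    that the theory of [stepop] applies unchanged. *)
Definition kstep (j : nat) (a : R) := stepop (gauss 1) (fun (y : R) (_ : nat) => lam j * (y + a) ^+ 2).

Lemma measurable_kstep j a (k : nat) : measurable_fun setT (fun y : R => lam j * (y + a) ^+ 2).
Proof. by apply: measurable_funM => //; apply: measurable_funX; exact: measurable_funD. Qed.

Lemma kstep_ok j a : op_ok (kstep j a).
Proof. by apply: stepop_ok => k; exact: measurable_kstep. Qed.

Lemma kstep_comm j a j' a' : op_comm (kstep j a) (kstep j' a').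
Proof. by apply: stepop_comm => k; exact: measurable_kstep. Qed.

(* [KX P m a g z] is the mean of [g] at [z] plus the sum of [lam j * (N_j + a_j) ^+ 2] over
   the [j < m] with [P j], the [N_j] being independent standard Gaussians; only [z 0] matters. *)
Fixpoint KX (P : pred nat) (m : nat) (a : nat -> R) : (Z -> \bar R) -> Z -> \bar R :=
  match m with
  | 0 => id
  | k.+1 => if P k then kstep k (a k) \o KX P k a else KX P k a
  end.

Lemma KX_ok P m a : op_ok (KX P m a).
Proof.
elim: m => [|m IH] /=; first exact: op_ok_id.
by case: (P m) => //; apply: op_ok_comp => //; exact: kstep_ok.
Qed.

Lemma KX_comm P m a j b : op_comm (kstep j b) (KX P m a).
Proof.
elim: m => [|m IH] /=; first exact: op_comm_id.
case: (P m); last exact: IH.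
by apply: op_comm_comp; [exact: kstep_ok|exact: KX_ok|exact: kstep_comm|exact: IH].
Qed.

Lemma eq_KX P P' m a a' g : (forall j, (j < m)%N -> P j = P' j) ->
  (forall j, (j < m)%N -> a j = a' j) -> KX P m a g = KX P' m a' g.
Proof.
elim: m => //= m IH h1 h2.
have E : KX P m a g = KX P' m a' g.
  by apply: IH => j jm; [apply: h1|apply: h2]; exact: ltnW.
by rewrite h1 ?ltnSn//; case: (P' m) => /=; rewrite E// h2.
Qed.

(** By commutation any chosen coordinate can act directly on [g], so an estimate for one Gaussian
    variable transfers to the whole sum. *)
Lemma KX_extract (P : pred nat) m a j g : (j < m)%N -> P j -> good g ->
  KX P m a g = KX [pred i | P i && (i != j)] m a (kstep j (a j) g).
Proof.
elim: m => // m IH; rewrite ltnS leq_eqVlt => /orP[/eqP ->|jm] Pj gg /=.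
  rewrite Pj eqxx andbF /= (KX_comm P m a m (a m) gg).
  apply: eq_KX => // i im /=; by rewrite (ltn_eqF im) andbT.
rewrite (gtn_eqF jm) andbT; case: ifP => _ /=; rewrite IH//.
Qed.

Definition noninc (g : Z -> \bar R) := forall z z' : Z, z 0%N <= z' 0%N -> (g z' <= g z)%E.

Lemma kstep_noninc j a g : good g -> noninc g -> noninc (kstep j a g).
Proof.
move=> gg ng z z' zz'; apply: ge0_le_integral => //.
- by move=> y _; exact: good_ge0.
- by apply: measurable_shift; [move=> k; exact: measurable_kstep|exact: good_mZ].
- by apply: measurable_shift; [move=> k; exact: measurable_kstep|exact: good_mZ].
- by move=> y _; apply: ng; rewrite lerD2r.
Qed.

Lemma KX_noninc P m a g : good g -> noninc g -> noninc (KX P m a g).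
Proof.
move=> gg ng; elim: m => //= m IH; case: (P m) => //; apply: kstep_noninc => //.
by have [+ _ _ _ _] := KX_ok P m a; exact.
Qed.

Lemma KX_good P m a g : good g -> good (KX P m a g).
Proof. by move=> gg; have [+ _ _ _ _] := KX_ok P m a; exact. Qed.

Lemma kstep_good j a g : good g -> good (kstep j a g).
Proof. by move=> gg; have [+ _ _ _ _] := kstep_ok j a; exact. Qed.

Lemma le_KX P m a g1 g2 z : good g1 -> good g2 -> (forall z, g1 z <= g2 z)%E ->
  (KX P m a g1 z <= KX P m a g2 z)%E.
Proof. by move=> h1 h2 h; have [_ + _ _ _] := KX_ok P m a; apply. Qed.

Lemma le_kstep j a g1 g2 z : good g1 -> good g2 -> (forall z, g1 z <= g2 z)%E ->
  (kstep j a g1 z <= kstep j a g2 z)%E.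
Proof. by move=> h1 h2 h; have [_ + _ _ _] := kstep_ok j a; apply. Qed.

Lemma kstep_le_self j a g z : good g -> noninc g -> (kstep j a g z <= g z)%E.
Proof.
move=> gg ng; rewrite -[leRHS](integral_prob_cst (gauss 1) (g z)).
apply: ge0_le_integral => //.
- by move=> y _; exact: good_ge0.
- by apply: measurable_shift; [move=> k; exact: measurable_kstep|exact: good_mZ].
- by move=> y _; apply: ng; rewrite /zadd lerDl mulr_ge0 ?sqr_ge0// ltW// lam_gt0.
Qed.

Lemma KX_le_self P m a g z : good g -> noninc g -> (KX P m a g z <= g z)%E.
Proof.
move=> gg ng; elim: m z => //= m IH z; case: (P m) => //=.
by apply: le_trans (IH z); apply: kstep_le_self; [exact: KX_good|exact: KX_noninc].
Qed.

Lemma kstep_anderson j a g z : good g -> noninc g -> (forall z, g z <= 1)%E ->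
  (kstep j a g z <= kstep j 0 g z)%E.
Proof.
move=> gg ng g1.
have gf u : g u \is a fin_num.
  by rewrite ge0_fin_numE ?good_ge0// (le_lt_trans (g1 u))// ltry.
pose k (y : R) := fine (g (zadd z (fun=> lam j * y ^+ 2))).
have mk : measurable_fun setT k.
  apply/measurable_EFinP; rewrite (_ : EFin \o k = (fun y => g (zadd z (fun=> lam j * y ^+ 2)))).
    apply: (@measurable_shift _ _ _ (fun (y : R) (_ : nat) => lam j * y ^+ 2)).
      by move=> _; apply: measurable_funM => //; exact: measurable_funX.
    exact: good_mZ.
  by apply/funext => y /=; rewrite /k fineK.
have -> : kstep j a g z = (\int[gauss 1]_y (k (y + a))%:E)%E.
  by apply: eq_integral => y _; rewrite /k fineK.
have -> : kstep j 0 g z = (\int[gauss 1]_y (k y)%:E)%E.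
  apply: eq_integral => y _; rewrite /k fineK; last exact: gf.
  by congr g; apply/funext => i; rewrite /zadd addr0.
apply: (@anderson _ k a mk).
- by move=> y; rewrite /k fine_ge0// good_ge0.
- move=> y y' yy'; rewrite /k fine_le//; apply: ng; rewrite /zadd lerD2l.
  rewrite ler_wpM2l ?(ltW (lam_gt0 j))//.
  by rewrite -(real_normK (num_real y)) -(real_normK (num_real y')) lerXn2r ?nnegrE.
Qed.

Lemma KX_le1 P m a g : good g -> (forall z, g z <= 1)%E -> forall z, (KX P m a g z <= 1)%E.
Proof.
move=> gg g1 z; have [_ _ _ _ cK] := KX_ok P m a.
rewrite -[leRHS](cK 1%E z); apply: le_KX => //.
by apply: (@good_cst _ 1).
Qed.

(** The shifts are removed one coordinate at a time. Averaging over other squares keeps the function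
    nonincreasing in the running sum, hence even and decreasing in the modulus of the next variable,
    so the inequality on the line is enough. *)
Lemma KX_anderson P m a g z : good g -> noninc g -> (forall z, g z <= 1)%E ->
  (KX P m a g z <= KX P m (fun=> 0%R) g z)%E.
Proof.
move=> gg ng g1; elim: m z => //= m IH z; case: (P m) => //=.
apply: (@le_trans _ _ (kstep m (a m) (KX P m (fun=> 0%R) g) z)%E).
  by apply: le_kstep => //; exact: KX_good.
by apply: kstep_anderson; [exact: KX_good|exact: KX_noninc|exact: KX_le1].
Qed.

(** A function of the vector that depends on it through [Qm m] alone lives on a scalar state; the
    starting point [h] turns into the shifts. *)
Lemma gauss_op_KX m (F : R -> \bar R) (c : R) (h : Z) :
  measurable_fun setT F -> (forall x, 0 <= F x)%E ->
  gauss_op 1 m (fun z => F (c + Qm m z)) h = KX predT m h (fun z => F (z 0%N)) (fun=> c).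
Proof.
move=> mF F0; elim: m c h => [|m IH] c h.
  by rewrite /= /Qm big_ord0 addr0.
rewrite [LHS]/= [RHS]/=; apply: eq_integral => x _.
transitivity (gauss_op 1 m (fun z => F ((c + lam m * (x + h m) ^+ 2) + Qm m z)) (zadd h (unitv m x))).
  apply: gauss_op_local => z' hz'; congr F.
  rewrite /Qm big_ord_recr/= hz'// /zadd /unitv eqxx (addrC (h m)); ring.
rewrite IH; congr (_ _); apply: eq_KX => // j jm.
by rewrite /zadd /unitv (ltn_eqF jm) addr0.
Qed.

Definition ind (t : R) (z : Z) : \bar R := ((z 0%N <= t)%R%:R)%:E.

Lemma ind_good t : good (ind t).
Proof.
apply: good_EFin => [z|d T zt mzt]; first by rewrite ler0n.
rewrite (_ : (fun u => _) = \1_[set u | zt u 0%N <= t]).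
  apply: measurable_indic; rewrite -[X in measurable X]setTI.
  have := mzt 0%N measurableT `]-oo, t]%classic (measurable_itv _).
  by rewrite (_ : _ @^-1` _ = [set u | zt u 0%N <= t])//; apply/seteqP; split => u /=; rewrite in_itv.
by apply/funext => u; rewrite indicE mem_setE.
Qed.

Lemma ind_noninc t : noninc (ind t).
Proof.
move=> z z' zz'; rewrite lee_fin ler_nat.
by case: (leP (z' 0%N) t) => // h; rewrite (le_trans zz' h).
Qed.

Lemma ind_le1 t z : (ind t z <= 1)%E.
Proof. by rewrite lee_fin lern1 leq_b1. Qed.

Definition ind_band (t d : R) (z : Z) : \bar R := ((t < z 0%N <= t + d)%R%:R)%:E.

Lemma ind_band_good t d : good (ind_band t d).
Proof.
apply: good_EFin => [z|d' T zt mzt]; first by rewrite ler0n.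
rewrite (_ : (fun u => _) = \1_[set u | t < zt u 0%N <= t + d]).
  apply: measurable_indic; rewrite -[X in measurable X]setTI.
  have := mzt 0%N measurableT `]t, (t + d)]%classic (measurable_itv _).
  rewrite (_ : _ @^-1` _ = [set u | t < zt u 0%N <= t + d])//.
by apply/funext => u; rewrite indicE mem_setE.
Qed.

Lemma ind_bandE (t d : R) z : 0 <= d -> ind (t + d) z = (ind t z + ind_band t d z)%E.
Proof.
move=> d0; rewrite /ind /ind_band -EFinD; congr EFin.
case: (leP (z 0%N) t) => [zt|tz] /=; last by rewrite add0r.
by rewrite addr0 (le_trans zt)// lerDl.
Qed.

(** The values of [y] that put the sum in the band fill at most two symmetric intervals, each of
    length at most [Num.sqrt (d / lam j)] by subadditivity of the square root, and the Gaussian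
    density is at most 1. *)
Lemma kstep_band j (t d : R) z : 0 <= d ->
  (kstep j 0 (ind_band t d) z <= (2 * Num.sqrt (d / lam j))%:E)%E.
Proof.
move=> d0; have l0 := lam_gt0 j.
pose s := Num.sqrt (Num.max 0 (t - z 0%N) / lam j); pose s' := Num.sqrt (Num.max 0 (t + d - z 0%N) / lam j).
have ss' : s <= s'.
  rewrite ler_wsqrtr//; apply: ler_wpM2r; first by rewrite invr_ge0 ltW.
  rewrite ge_max !le_max lexx/=; apply/orP; right; lra.
have ds : s' <= s + Num.sqrt (d / lam j).
  rewrite -(@ler_pXn2r _ 2)// ?nnegrE ?addr_ge0 ?sqrtr_ge0//.
  rewrite sqrrD !sqr_sqrtr ?divr_ge0 ?le_max ?lexx ?(ltW l0)//.
  apply: (@le_trans _ _ (Num.max 0 (t - z 0%N) / lam j + d / lam j)).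
    rewrite -mulrDl; apply: ler_wpM2r; first by rewrite invr_ge0 ltW.
    rewrite ge_max.
    have : 0 <= Num.max 0 (t - z 0%N) by rewrite le_max lexx.
    have : t - z 0%N <= Num.max 0 (t - z 0%N) by rewrite le_max lexx orbT.
    by move=> *; apply/andP; split; lra.
  by rewrite lerD2r lerDl mulrn_wge0// mulr_ge0 ?sqrtr_ge0.
pose k (y : R) : R := \1_`[s, s'] y + \1_`[(- s'), (- s)] y.
have mk : measurable_fun setT k by apply: measurable_funD; exact: measurable_indic.
have kk (y : R) : ind_band t d (zadd z (fun=> lam j * (y + 0) ^+ 2)) = ((t < z 0%N + lam j * y ^+ 2 <= t + d)%R%:R)%:E.
  by rewrite /ind_band /zadd addr0.
apply: (@le_trans _ _ (\int[mu]_y (G y * k y)%:E)%E).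
  rewrite -ge0_gauss1E//; last by move=> y; rewrite addr_ge0// indicE ler0n.
  apply: ge0_le_integral => //.
  - by move=> y _; rewrite kk lee_fin ler0n.
  - apply: (@measurable_shift _ _ _ (fun (y : R) (_ : nat) => lam j * (y + 0) ^+ 2)).
      by move=> i; exact: measurable_kstep.
    by apply: good_mZ; exact: ind_band_good.
  - exact/measurable_EFinP.
  move=> y _; rewrite kk lee_fin.
  have k0 : 0 <= k y by rewrite /k !indicE addr_ge0// ler0n.
  case: (boolP (t < z 0%N + lam j * y ^+ 2 <= t + d)) => //= /andP[h1 h2].
  have y2 : y ^+ 2 <= Num.max 0 (t + d - z 0%N) / lam j.
    by rewrite ler_pdivlMr// mulrC le_max; apply/orP; right; lra.
  have y2' : Num.max 0 (t - z 0%N) / lam j <= y ^+ 2.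
    rewrite ler_pdivrMr// mulrC ge_max mulr_ge0 ?sqr_ge0 ?(ltW l0)//=; lra.
  have ys' : `|y| <= s'.
    by rewrite -(sqrtr_sqr y) ler_wsqrtr.
  have ys : s <= `|y|.
    by rewrite -(sqrtr_sqr y) ler_wsqrtr.
  rewrite /k !indicE !mem_setE !in_itv/=.
  have [y0|y0] := leP 0 y.
    rewrite ger0_norm// in ys ys'; rewrite ys ys'/= lerDl ler0n//.
  by rewrite ltr0_norm// in ys ys'; rewrite lerNl ys' lerNr ys/= lerDr ler0n.
apply: (@le_trans _ _ (\int[mu]_y (k y)%:E)%E).
  apply: ge0_le_integral => //.
  - by move=> y _; rewrite lee_fin mulr_ge0 ?pdf_ge0 ?addr_ge0// indicE ler0n.
  - apply/measurable_EFinP; apply: measurable_funM => //; exact: pdf_measurable.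
  - exact/measurable_EFinP.
  move=> y _; rewrite lee_fin ler_piMl ?gpdf1_le1// /k addr_ge0// indicE ler0n.
rewrite /k -ge0_integral_addR; [|exact: measurable_indic|exact: measurable_indic|
   by move=> y; rewrite indicE ler0n|by move=> y; rewrite indicE ler0n].
rewrite !integral_indic//= !setIT !lebesgue_measure_itv/= !lte_fin ltrN2.
case: ltP => ss; rewrite -?EFinB -?EFinD lee_fin; last by rewrite addr0 mulr_ge0 ?sqrtr_ge0.
by lra.
Qed.

(** A single coordinate already spreads the sum: the bound depends on the chosen [j] and not on
    [m]. *)
Lemma KX_band (P : pred nat) m j (t d : R) z : (j < m)%N -> P j -> 0 <= d ->
  (KX P m (fun=> 0%R) (ind (t + d)%R) z <=
   KX P m (fun=> 0%R) (ind t) z + (2 * Num.sqrt (d / lam j))%:E)%E.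
Proof.
move=> jm Pj d0; rewrite (_ : ind (t + d) = (fun z => ind t z + ind_band t d z)%E); last first.
  by apply/funext => u; exact: ind_bandE.
have [_ _ KD _ _] := KX_ok P m (fun=> 0).
rewrite KD; [|exact: ind_good|exact: ind_band_good].
apply: leeD2l.
rewrite (KX_extract _ jm Pj (ind_band_good t d)).
have [_ _ _ _ cK] := KX_ok [pred i | P i && (i != j)] m (fun=> 0).
rewrite -[leRHS](cK _ z); apply: le_KX => //.
- by apply: kstep_good; exact: ind_band_good.
- by apply: good_cst; rewrite mulr_ge0 ?sqrtr_ge0.
- by move=> u; exact: kstep_band.
Qed.

End quadratic_mixtures.

(** * Gains from a shift or a lower level, uniform in the dimension *)

Section gaps.
Context {R : realType}.
Local Notation mu := (@lebesgue_measure R).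
Local Notation Z := (nat -> R).
Local Notation G := (@gpdf R 1).
Local Notation o := ((fun=> 0%R) : Z).

Lemma ind_abs (t : R) (z : Z) j (x : R) : z 0%N <= t ->
  (z 0%N + lam j * x ^+ 2 <= t) = (`|x| <= Num.sqrt ((t - z 0%N) / lam j)).
Proof.
move=> zt; have l0 := @lam_gt0 R j.
have h0 : 0 <= (t - z 0%N) / lam j by rewrite divr_ge0 ?subr_ge0// ltW.
rewrite -(sqrtr_sqr x) ler_sqrt// ler_pdivlMr// lerBrDl.
by rewrite (mulrC (lam j)).
Qed.

(** When the other squares sum to [z 0], acceptance means that [y + a] has modulus at most [w],
    where [w ^+ 2 = (t - z 0) / lam j]. The margins on [z 0] and [t] keep [w] between [w0] and [w1],
    as the strict inequality requires. *)
Lemma gain_shift (j : nat) (c ka T : R) : 0 < c -> 0 < ka ->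
  exists2 d : R, 0 < d & forall (a t : R) (z : Z), c <= lam j * a ^+ 2 -> t <= T ->
   -1 < z 0%N <= t - ka -> (kstep j a (ind t) z + d%:E <= kstep j 0 (ind t) z)%E.
Proof.
move=> c0 ka0; have l0 := @lam_gt0 R j.
pose w0 : R := Num.sqrt (ka / lam j); pose w1 : R := Num.sqrt ((T + 1) / lam j); pose a0 : R := Num.sqrt (c / lam j).
have w00 : 0 < w0 by rewrite sqrtr_gt0 divr_gt0.
have a00 : 0 < a0 by rewrite sqrtr_gt0 divr_gt0.
exists (G w1 * (1 - expR (- (a0 ^+ 2 / 2))) * Num.min w0 a0 / 2).
  rewrite divr_gt0// !mulr_gt0 ?gpdf_gt0// ?lt_min ?w00 ?a00//.
  by rewrite subr_gt0 -[ltRHS]expR0 ltr_expR oppr_lt0 divr_gt0// exprn_gt0.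
move=> a t z ca tT /andP[z1 z2].
have zt : z 0%N <= t by lra.
have kE b : kstep j b (ind t) z = (\int[gauss 1]_y ((`|(y + b)%R| <= Num.sqrt ((t - z 0%N) / lam j))%R%:R)%:E)%E.
  by apply: eq_integral => y _; rewrite /ind /zadd ind_abs.
rewrite !kE; under [in leRHS]eq_integral do rewrite addr0.
apply: anderson_strict => //.
  have il0 : 0 <= (@lam R j)^-1 by rewrite invr_ge0 ltW.
  by apply/andP; split; apply: ler_wsqrtr; apply: (ler_wpM2r il0); lra.
rewrite -(sqrtr_sqr a) ler_wsqrtr// ler_pdivrMr// mulrC//.
Qed.

(** Lowering the level loses the interval []y1, y2]] for the Gaussian variable. The squares of its
    ends differ by at least [m / lam j] and their sum is at most [2 * w1], which bounds its length
    below; the density there is at least [G w1]. *)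
Lemma gain_level (j : nat) (c ka T : R) : 0 < c -> 0 < ka -> 0 <= T ->
  exists2 d : R, 0 < d & forall (t : R) (z : Z), t <= T ->
   -1 < z 0%N <= t - ka -> (kstep j 0 (ind (t - c)%R) z + d%:E <= kstep j 0 (ind t) z)%E.
Proof.
move=> c0 ka0 T0; have l0 := @lam_gt0 R j.
pose w1 : R := Num.sqrt ((T + 1) / lam j).
have w10 : 0 < w1 by rewrite sqrtr_gt0 divr_gt0//; lra.
pose m := Num.min c ka.
have m0 : 0 < m by rewrite lt_min c0 ka0.
exists (G w1 * (m / lam j / (2 * w1))).
  by rewrite mulr_gt0 ?gpdf_gt0// !divr_gt0// mulr_gt0.
move=> t z tT /andP[z1 z2].
rewrite [in leRHS](_ : ind t = (fun z => ind (t - c)%R z + ind_band (t - c) c z)%E); last first.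
  by apply/funext => u; rewrite -ind_bandE ?subrK// ltW.
have [_ _ kD _ _] := @kstep_ok R j 0; rewrite kD; [|exact: ind_good|exact: ind_band_good].
apply: leeD2l.
pose y1 : R := Num.sqrt (Num.max 0 (t - c - z 0%N) / lam j); pose y2 : R := Num.sqrt ((t - z 0%N) / lam j).
have il0 : 0 <= (@lam R j)^-1 by rewrite invr_ge0 ltW.
have y2w1 : y2 <= w1 by apply: ler_wsqrtr; apply: (ler_wpM2r il0); lra.
have dy2 : y2 ^+ 2 - y1 ^+ 2 >= m / lam j.
  rewrite !sqr_sqrtr ?divr_ge0 ?le_max ?lexx ?(ltW l0)//; last by lra.
  rewrite -mulrBl; apply: (ler_wpM2r il0); rewrite lerBrDr -lerBrDl ge_max.
  have : m <= c by rewrite ge_min lexx.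
  have : m <= ka by rewrite ge_min lexx orbT.
  by move=> *; apply/andP; split; lra.
have y10 : 0 <= y1 by exact: sqrtr_ge0.
have y20 : 0 <= y2 by exact: sqrtr_ge0.
have y12 : y1 <= y2.
  rewrite -(@ler_pXn2r _ 2)// ?nnegrE// -subr_ge0; apply: le_trans dy2.
  by rewrite divr_ge0// ltW.
have dy : m / lam j / (2 * w1) <= y2 - y1.
  rewrite ler_pdivrMr ?mulr_gt0//; apply: (le_trans dy2).
  by rewrite subr_sqr ler_wpM2l ?subr_ge0//; lra.
apply: (@le_trans _ _ (\int[mu]_y (G w1 * \1_`]y1, y2] y)%:E)%E).
  by rewrite integral_bump ?pdf_ge0// lee_fin ler_wpM2l ?pdf_ge0.
have -> : kstep j 0 (ind_band (t - c) c) z =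
   (\int[mu]_y (G y * ((t - c < z 0%N + lam j * y ^+ 2 <= t)%R%:R))%:E)%E.
  rewrite -ge0_gauss1E.
  - by apply: eq_integral => y _; rewrite /ind_band /zadd addr0 subrK.
  - have := @measurable_shift R _ _ (fun (y : R) (_ : nat) => lam j * (y + 0) ^+ 2)
      (fun i => measurable_kstep j 0 i) _ z (good_mZ (ind_band_good (t - c) c)).
    move=> /measurable_EFinP; rewrite (_ : (fun _ => _) = (fun y : R => (t - c < z 0%N + lam j * y ^+ 2 <= t)%R%:R))//.
    by apply/funext => y; rewrite /zadd addr0 subrK.
  - by move=> y; rewrite ler0n.
apply: ge0_le_integral => //.
- by move=> y _; rewrite lee_fin mulr_ge0 ?pdf_ge0// indicE ler0n.
- by apply/measurable_EFinP; apply: measurable_funM => //; exact: measurable_indic.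
- have := @measurable_shift R _ _ (fun (y : R) (_ : nat) => lam j * (y + 0) ^+ 2)
      (fun i => measurable_kstep j 0 i) _ z (good_mZ (ind_band_good (t - c) c)).
  move=> /measurable_EFinP mb; apply/measurable_EFinP; apply: measurable_funM; first exact: pdf_measurable.
  rewrite (_ : (fun _ => _) = (fun y : R => (t - c < zadd z (fun=> lam j * (y + 0) ^+ 2) 0%N <= t - c + c)%R%:R))//.
  by apply/funext => y; rewrite /zadd addr0 subrK.
move=> y _; rewrite lee_fin indicE mem_setE/= in_itv/=.
case: (boolP (y1 < y <= y2)) => [/andP[h1 h2]|_]; last first.
  by rewrite mulr0 mulr_ge0 ?normal_pdf_ge0.
have y0 : 0 <= y by lra.
have e2 : y ^+ 2 <= (t - z 0%N) / lam j.
  rewrite -[leRHS]sqr_sqrtr; last by rewrite divr_ge0 ?(ltW l0)//; lra.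
  by rewrite lerXn2r ?nnegrE.
have e1 : (t - c - z 0%N) / lam j < y ^+ 2.
  apply: (@le_lt_trans _ _ (y1 ^+ 2)); last by rewrite ltrXn2r ?nnegrE.
  rewrite sqr_sqrtr ?divr_ge0 ?le_max ?lexx ?(ltW l0)//; apply: (ler_wpM2r il0).
  by rewrite le_max lexx orbT.
rewrite ler_pdivlMr// in e2; rewrite ltr_pdivrMr// in e1.
have -> : (t - c < z 0%N + lam j * y ^+ 2 <= t) by rewrite (mulrC (lam j)); apply/andP; split; lra.
rewrite !mulr1; apply: (@gpdf_le R 1) => //; rewrite !ger0_norm//; lra.
Qed.

Lemma KX_ind_ge0 P m (a : nat -> R) (t b : R) : 0 < b ->
  (b%:E <= KX P m a (ind t) o)%E -> 0 <= t.
Proof.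
move=> b0 /le_trans /(_ (KX_le_self P m a o (ind_good t) (@ind_noninc R t))).
rewrite /ind lee_fin; case: (leP 0 t) => //= _; lra.
Qed.

(* A gain on [-1 < z 0 <= t - ka] in one coordinate survives the averaging over the
   others, because anticoncentration bounds their mass near the level [t]. *)
Lemma gap_core (j0 m : nat) (d ka b t : R) (g1 : Z -> \bar R) :
  (j0 < m)%N -> (1 < m)%N -> 0 <= d -> 0 < ka <= 1 -> 0 < b ->
  2 * Num.sqrt (ka / lam 0) <= b / 2 -> 2 * Num.sqrt (ka / lam 1) <= b / 2 ->
  good g1 ->
  (forall z : Z, g1 z + (d%:E * ind_band (-1) (t - ka + 1) z)%E <= kstep j0 0 (ind t) z)%E ->
  (b%:E <= KX predT m o (ind t) o)%E ->
  (KX [pred i | i != j0] m o g1 o + (d * (b / 2))%:E <= KX predT m o (ind t) o)%E.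
Proof.
move=> j0m m1 d0 /andP[ka0 ka1] b0 s0 s1 gg1 g1g bK.
have t0 := KX_ind_ge0 b0 bK.
set P' := [pred i | i != j0].
have KE : KX predT m o (ind t) = KX P' m o (kstep j0 0 (ind t)).
  rewrite (@KX_extract _ predT m o j0 (ind t))//; exact: ind_good.
have bK' : (b%:E <= KX P' m o (ind t) o)%E.
  apply: (le_trans bK); rewrite KE; apply: le_KX.
  - by apply: kstep_good; exact: ind_good.
  - exact: ind_good.
  - by move=> z; apply: kstep_le_self; [exact: ind_good|exact: ind_noninc].
have bk : ((b / 2)%:E <= KX P' m o (ind (t - ka)%R) o)%E.
  (* Anticoncentration needs a coordinate other than [j0]: index 0 serves unless [j0] is 0, and then
     index 1 does. *)
  have [j1 [j1m Pj1 sj1]] : exists j1, [/\ (j1 < m)%N, P' j1 & 2 * Num.sqrt (ka / lam j1) <= b / 2].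
    case: (eqVneq j0 0%N) => [j00|j00]; first by exists 1%N; split => //; rewrite /P'/= j00.
    by exists 0%N; split => //; [exact: ltnW|rewrite /P'/= eq_sym].
  have := @KX_band R P' m j1 (t - ka) ka o j1m Pj1 (ltW ka0).
  rewrite subrK => /(le_trans bK') h.
  have : (b%:E <= KX P' m o (ind (t - ka)%R) o + (b / 2)%:E)%E.
    by apply: (le_trans h); rewrite leeD2l// lee_fin.
  rewrite -leeBlDr// -EFinB; apply: le_trans; rewrite lee_fin; lra.
rewrite KE.
have band_good : good (fun z => d%:E * ind_band (-1) (t - ka + 1) z)%E.
  by apply: goodM; [exact: good_cst|exact: ind_band_good].
have [_ KL KD KZ _] := @KX_ok R P' m o.
apply: le_trans (KL _ _ _ _ g1g o); last 2 first.
- exact: goodD.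
- by apply: kstep_good; exact: ind_good.
rewrite KD// KZ//; last exact: ind_band_good.
apply: leeD2l; rewrite EFinM; apply: lee_wpmul2l; first by rewrite lee_fin.
apply: (le_trans bk).
(* Running sums start at 0 and only grow, so none is at most -1, and the band above -1 carries all
   the mass below [t - ka]. *)
rewrite (_ : ind (t - ka)%R = (fun z => ind (-1)%R z + ind_band (-1) (t - ka + 1) z)%E); last first.
  apply/funext => u; rewrite -ind_bandE; last by lra.
  by congr (ind _ u); ring.
rewrite KD; [|exact: ind_good|exact: ind_band_good].
rewrite -[leRHS]add0e; apply: leeD2r.
apply: (le_trans (KX_le_self P' m o o (ind_good (-1)) (@ind_noninc R (-1)))).
by rewrite /ind (_ : (0 <= -1) = false)//; apply/negbTE; rewrite -ltNge; lra.
Qed.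

(** A margin [ka] so thin that, by [KX_band] at index 0 or 1, it removes at most half of an
    acceptance probability [b]. *)
Lemma exists_kappa (b : R) : 0 < b -> exists2 ka : R, 0 < ka <= 1 &
  2 * Num.sqrt (ka / lam 0) <= b / 2 /\ 2 * Num.sqrt (ka / lam 1) <= b / 2.
Proof.
move=> b0; have l0 := @lam_gt0 R 0; have l1 := @lam_gt0 R 1.
have bp : 0 < (b / 4) ^+ 2 by rewrite exprn_gt0// divr_gt0.
exists (Num.min 1 (Num.min ((b / 4) ^+ 2 * lam 0) ((b / 4) ^+ 2 * lam 1))).
  by rewrite !lt_min ltr01 !mulr_gt0//= ge_min lexx.
suff H j : Num.min 1 (Num.min ((b / 4) ^+ 2 * lam 0) ((b / 4) ^+ 2 * lam 1)) <= (b / 4) ^+ 2 * lam j ->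
    2 * Num.sqrt (Num.min 1 (Num.min ((b / 4) ^+ 2 * lam 0) ((b / 4) ^+ 2 * lam 1)) / lam j) <= b / 2.
  by split; apply: H; rewrite !ge_min lexx ?orbT.
move: (Num.min 1 _) => x xj; have lj := @lam_gt0 R j.
apply: (@le_trans _ _ (2 * (b / 4))); last by lra.
rewrite ler_pM2l// -[leRHS]ger0_norm; last by rewrite divr_ge0// ltW.
by rewrite -sqrtr_sqr ler_wsqrtr// ler_pdivrMr.
Qed.

(** Anderson's inequality first discards the shifts other than [h j0], which can only raise the
    acceptance probability; the coordinate [j0] alone then supplies the gain, whatever [m] and the
    rest of [h]. *)
Lemma gap_shift (j0 : nat) (c b T : R) : 0 < c -> 0 < b ->
  exists2 eta : R, 0 < eta & forall (m : nat) (t : R) (h : Z), (j0 < m)%N -> (1 < m)%N -> t <= T ->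
  c <= lam j0 * h j0 ^+ 2 -> (b%:E <= KX predT m o (ind t) o)%E ->
  (KX predT m h (ind t) o + eta%:E <= KX predT m o (ind t) o)%E.
Proof.
move=> c0 b0; have [ka /andP[ka0 ka1] [s0 s1]] := exists_kappa b0.
have [d d0 H] := gain_shift j0 T c0 ka0.
exists (d * (b / 2)); first by rewrite mulr_gt0// divr_gt0.
move=> m t h j0m m1 tT ch bK.
have gg := kstep_good j0 (h j0) (ind_good t).
apply: le_trans (@gap_core j0 m d ka b t (kstep j0 (h j0) (ind t)) j0m m1 (ltW d0) _ b0 s0 s1 gg _ bK).
- apply: leeD2r; rewrite (@KX_extract _ predT m h j0 (ind t))//; last exact: ind_good.
  apply: KX_anderson => //.
  + by apply: kstep_noninc; [exact: ind_good|exact: ind_noninc].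
  + move=> z; apply: le_trans (ind_le1 t z).
    by apply: kstep_le_self; [exact: ind_good|exact: ind_noninc].
- by rewrite ka0 ka1.
- move=> z; rewrite /ind_band; case: (boolP (-1 < z 0%N <= _)) => hz; last first.
    rewrite mule0 adde0.
    by apply: kstep_anderson; [exact: ind_good|exact: ind_noninc|exact: ind_le1].
  rewrite mule1; apply: H => //.
  by case/andP: hz => h1 h2; rewrite h1/=; lra.
Qed.

(** Meant for a signal in the high frequencies: there the noise is small, so the signal acts like a
    constant added to the statistic, that is, like a lower level. *)
Lemma gap_level (c b T : R) : 0 < c -> 0 < b -> 0 <= T ->
  exists2 eta : R, 0 < eta & forall (m : nat) (t : R), (1 < m)%N -> t <= T ->
  (b%:E <= KX predT m o (ind t) o)%E ->
  (KX predT m o (ind (t - c)%R) o + eta%:E <= KX predT m o (ind t) o)%E.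
Proof.
move=> c0 b0 T0; have [ka /andP[ka0 ka1] [s0 s1]] := exists_kappa b0.
have [d d0 H] := gain_level 0 c0 ka0 T0.
exists (d * (b / 2)); first by rewrite mulr_gt0// divr_gt0.
move=> m t m1 tT bK.
have gg := kstep_good 0 0 (ind_good (t - c)).
apply: le_trans (@gap_core 0 m d ka b t (kstep 0 0 (ind (t - c)%R)) _ m1 (ltW d0) _ b0 s0 s1 gg _ bK).
- apply: leeD2r; rewrite (@KX_extract _ predT m o 0 (ind (t - c)%R))//; [exact: ltnW|exact: ind_good].
- exact: ltnW.
- by rewrite ka0 ka1.
- move=> z; rewrite /ind_band; case: (boolP (-1 < z 0%N <= _)) => hz; last first.
    rewrite mule0 adde0; apply: le_kstep; [exact: ind_good|exact: ind_good|].
    move=> u; rewrite /ind lee_fin ler_nat; case: (leP (u 0%N) (t - c)) => // hu.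
    by rewrite (_ : u 0%N <= t)//; lra.
  rewrite mule1; apply: H => //.
  by case/andP: hz => h1 h2; rewrite h1/=; lra.
Qed.

End gaps.

(** * Lindeberg exchange *)

Section spline.
Context {R : realType}.
Implicit Types x d : R.

Definition pos x : R := Num.max 0 x.

Lemma pos_ge0E x : 0 <= x -> pos x = x. Proof. by move=> h; rewrite /pos (max_idPr h). Qed.
Lemma pos_le0E x : x <= 0 -> pos x = 0. Proof. by move=> h; rewrite /pos (max_idPl h). Qed.
(** The distribution function of a sum of three independent uniform variables on (0,1). It is a
    twice continuously differentiable step from 0 to 1 whose Taylor remainder reduces to that of a
    cube of a positive part; [spl1] and [spl2] are its derivatives. *)
Definition spl x : R := (pos x ^+ 3 - 3 * pos (x - 1) ^+ 3 + 3 * pos (x - 2) ^+ 3 - pos (x - 3) ^+ 3) / 6.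
Definition spl1 x : R := (pos x ^+ 2 - 3 * pos (x - 1) ^+ 2 + 3 * pos (x - 2) ^+ 2 - pos (x - 3) ^+ 2) / 2.
Definition spl2 x : R := pos x - 3 * pos (x - 1) + 3 * pos (x - 2) - pos (x - 3).

Lemma cube_taylor x d :
  `|pos (x + d) ^+ 3 - pos x ^+ 3 - 3 * pos x ^+ 2 * d - 3 * pos x * d ^+ 2| <= `|d| ^+ 3.
Proof.
have [x0|x0] := leP 0 x; have [xd|xd] := leP 0 (x + d).
- rewrite !pos_ge0E// (_ : _ - _ = d ^+ 3); last by ring.
  by rewrite normrX.
- have d0 : d < 0 by lra.
  rewrite (pos_ge0E x0) (pos_le0E (ltW xd)) (ltr0_norm d0).
  rewrite (_ : _ - _ = - ((- d) ^+ 3 - (- (x + d)) ^+ 3)); last by ring.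
  have h1 : 0 <= (- (x + d)) ^+ 3 by rewrite exprn_ge0//; lra.
  have h2 : (- (x + d)) ^+ 3 <= (- d) ^+ 3 by rewrite lerXn2r ?nnegrE; lra.
  by rewrite normrN ger0_norm; lra.
- rewrite (pos_le0E (ltW x0)) (pos_ge0E xd) (_ : _ - _ = (x + d) ^+ 3); last by ring.
  rewrite normrX lerXn2r ?nnegrE// ger0_norm// ger0_norm; lra.
- by rewrite (pos_le0E (ltW x0)) (pos_le0E (ltW xd)) (_ : _ - _ = 0) ?normr0 ?exprn_ge0//; ring.
Qed.

(** The coefficients 1, 3, 3, 1 over 6 add up to 4/3, rounded up to 2. *)
Lemma spl_taylor x d :
  `|spl (x + d) - spl x - spl1 x * d - spl2 x / 2 * d ^+ 2| <= 2 * `|d| ^+ 3.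
Proof.
have h0 := cube_taylor x d; have h1 := cube_taylor (x - 1) d.
have h2 := cube_taylor (x - 2) d; have h3 := cube_taylor (x - 3) d.
rewrite /spl /spl1 /spl2.
rewrite (_ : x + d - 1 = x - 1 + d); last by ring.
rewrite (_ : x + d - 2 = x - 2 + d); last by ring.
rewrite (_ : x + d - 3 = x - 3 + d); last by ring.
have D0 : 0 <= `|d| ^+ 3 by rewrite exprn_ge0.
move: (`|d| ^+ 3) D0 h0 h1 h2 h3 => D D0.
rewrite !ler_norml => /andP[a0 b0] /andP[a1 b1] /andP[a2 b2] /andP[a3 b3].
by apply/andP; split; lra.
Qed.

Lemma spl_lo x : x <= 0 -> [/\ spl x = 0, spl1 x = 0 & spl2 x = 0].
Proof.
move=> x0; rewrite /spl /spl1 /spl2 !pos_le0E; try lra.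
by split; ring.
Qed.

Lemma spl_hi x : 3 <= x -> [/\ spl x = 1, spl1 x = 0 & spl2 x = 0].
Proof.
move=> x3; rewrite /spl /spl1 /spl2 !pos_ge0E; try lra.
by split; field.
Qed.

Lemma spl_bounds x : [/\ 0 <= spl x <= 1, `|spl1 x| <= 12 & `|spl2 x| <= 12].
Proof.
have [x0|x0] := leP x 0; first by have [-> -> ->] := spl_lo x0; rewrite !normr0; split; lra.
have [x3|x3] := leP 3 x; first by have [-> -> ->] := spl_hi x3; rewrite !normr0; split; lra.
rewrite /spl /spl1 /spl2 (pos_ge0E (ltW x0)) (@pos_le0E (x - 3)); last by lra.
have [x1|x1] := leP x 1.
  rewrite (@pos_le0E (x - 1)) ?(@pos_le0E (x - 2)); try lra.
  rewrite !expr0n/= !ler_norml; split; apply/andP; split; nra.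
rewrite (@pos_ge0E (x - 1)); last by lra.
have [x2|x2] := leP x 2.
  rewrite (@pos_le0E (x - 2)); last by lra.
  have [u [u0 u1 ->]] : exists u, [/\ 0 <= u, u <= 1 & x = u + 1] by exists (x - 1); split; lra.
  rewrite (_ : u + 1 - 1 = u); last by ring.
  by rewrite !expr0n/= !ler_norml; split; apply/andP; split; nra.
rewrite (@pos_ge0E (x - 2)); last by lra.
have [u [u0 u1 ->]] : exists u, [/\ 0 <= u, u <= 1 & x = 3 - u] by exists (3 - x); split; lra.
have u3 : 0 <= u ^+ 3 <= 1 by rewrite exprn_ge0//= exprn_ile1.
by rewrite !ler_norml; split; apply/andP; split;
  first [nra|rewrite (_ : _ / 6 = 1 - u ^+ 3 / 6); [lra|field]].
Qed.

Lemma measurable_spl : measurable_fun setT spl.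
Proof.
have mp c : measurable_fun setT (fun x => pos (x - c) ^+ 3).
  by apply: measurable_funX; apply: measurable_maxr => //; exact: measurable_funB.
have mp0 : measurable_fun setT (fun x => pos x ^+ 3).
  by apply: measurable_funX; exact: measurable_maxr.
apply: measurable_funM => //; apply: measurable_funB => //.
apply: measurable_funD; last exact: measurable_funM.
by apply: measurable_funB => //; exact: measurable_funM.
Qed.

(* [chi s tau] decreases from 1 to 0 on [tau - 3 / s, tau]. *)
Definition chi (s tau u : R) : R := spl (s * (tau - u)).
Definition chi1 (s tau u : R) : R := - s * spl1 (s * (tau - u)).
Definition chi2 (s tau u : R) : R := s ^+ 2 * spl2 (s * (tau - u)).

Lemma chi_taylor (s tau u d : R) : 0 < s ->
  `|chi s tau (u + d) - chi s tau u - chi1 s tau u * d - chi2 s tau u / 2 * d ^+ 2| <=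
  2 * s ^+ 3 * `|d| ^+ 3.
Proof.
move=> s0; have := spl_taylor (s * (tau - u)) (- (s * d)).
rewrite (_ : s * (tau - u) - s * d = s * (tau - (u + d))); last by ring.
rewrite normrN normrM (gtr0_norm s0) exprMn /chi /chi1 /chi2.
rewrite (_ : _ - _ = spl (s * (tau - (u + d))) - spl (s * (tau - u)) -
  - s * spl1 (s * (tau - u)) * d - s ^+ 2 * spl2 (s * (tau - u)) / 2 * d ^+ 2); last by field.
by move=> /le_trans; apply; rewrite mulrA.
Qed.

Lemma chi_far (s tau u : R) : 0 < s -> tau <= u ->
  [/\ chi s tau u = 0, chi1 s tau u = 0 & chi2 s tau u = 0].
Proof.
move=> s0 h; have : s * (tau - u) <= 0 by rewrite pmulr_rle0// subr_le0.
by move=> /spl_lo[e1 e2 e3]; rewrite /chi /chi1 /chi2 e1 e2 e3 !mulr0.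
Qed.

Lemma chi_bounds (s tau u : R) : 0 < s ->
  [/\ 0 <= chi s tau u <= 1, `|chi1 s tau u| <= 12 * s & `|chi2 s tau u| <= 12 * s ^+ 2].
Proof.
move=> s0; have [h0 h1 h2] := spl_bounds (s * (tau - u)).
have s20 : 0 <= s ^+ 2 by exact: sqr_ge0.
rewrite /chi /chi1 /chi2; split => //; rewrite normrM.
  by rewrite normrN (gtr0_norm s0) mulrC; apply: ler_wpM2r => //; exact: ltW.
by rewrite (ger0_norm s20) mulrC; apply: ler_wpM2r.
Qed.

Lemma chi_near (s tau u : R) : 0 < s -> u <= tau - 3 / s -> chi s tau u = 1.
Proof.
move=> s0 h; rewrite /chi; have [] // := @spl_hi (s * (tau - u)).
by rewrite -ler_pdivrMl// mulrC; lra.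
Qed.

(** Here [p] and [r] are the norms of the state and of the increment for the quadratic form and [b]
    is their inner product. The second-order terms in [b * r ^+ 2] and [r ^+ 4] go to the remainder.
    Cubic terms are split between [r ^+ 2] and [r ^+ 4] with a free weight [ka], so that second and
    fourth moments suffice later. *)
Lemma chi_quad_taylor (s T : R) : 0 < s -> 1 <= T -> exists2 C : R, 0 < C &
  forall (tau p r b ka : R), tau <= T -> 0 <= p -> 0 <= r -> `|b| <= p * r -> 0 < ka <= 1 ->
  `|chi s tau (p ^+ 2 + (2 * b + r ^+ 2)) - chi s tau (p ^+ 2) - 2 * chi1 s tau (p ^+ 2) * b
    - chi1 s tau (p ^+ 2) * r ^+ 2 - 2 * chi2 s tau (p ^+ 2) * b ^+ 2| <=
  C * (ka * r ^+ 2 + r ^+ 4 / ka).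
Proof.
move=> s0 T1.
pose C1 : R := 2 * s ^+ 3 * (2 * (T + 1) + 1) ^+ 3 + 12 * s ^+ 2 * (2 * (T + 1) + 1).
pose C2 : R := 1 + 24 * s * T + 12 * s + 24 * s ^+ 2 * T ^+ 2.
have s3 : 0 < s ^+ 3 by rewrite exprn_gt0.
have s2 : 0 < s ^+ 2 by rewrite exprn_gt0.
have C10 : 0 < C1 by rewrite addr_gt0 ?mulr_gt0 ?exprn_gt0//; lra.
have T0 : 0 <= T by lra.
have C21 : 1 <= C2 by rewrite /C2 -!addrA lerDl !addr_ge0 ?mulr_ge0 ?sqr_ge0// ltW.
have C20 : 0 < C2 by exact: lt_le_trans C21.
have sqrT (x : R) : T <= x -> T <= x ^+ 2.
  move=> Tx; apply: (le_trans Tx); rewrite expr2 ler_peMl//; first exact: le_trans Tx.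
  exact: le_trans T1 Tx.
exists (C1 + C2); first by rewrite addr_gt0.
move=> tau p r b ka tT p0 r0 bpr /andP[ka0 ka1].
have [_ c1 c2] := chi_bounds tau (p ^+ 2) s0.
have rk0 : 0 <= r ^+ 4 / ka by rewrite divr_ge0 ?exprn_ge0// ltW.
have kr0 : 0 <= ka * r ^+ 2 by rewrite mulr_ge0 ?exprn_ge0// ltW.
have amgm : 2 * r ^+ 3 <= ka * r ^+ 2 + r ^+ 4 / ka.
  have : 0 <= (ka * r - r ^+ 2) ^+ 2 / ka by rewrite divr_ge0 ?sqr_ge0// ltW.
  rewrite (_ : _ / ka = ka * r ^+ 2 + r ^+ 4 / ka - 2 * r ^+ 3); first by lra.
  by field; rewrite gt_eqF.
have r30 : 0 <= r ^+ 3 by rewrite exprn_ge0.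
have b2 : b ^+ 2 <= p ^+ 2 * r ^+ 2.
  by rewrite -(real_normK (num_real b)) -exprMn lerXn2r ?nnegrE ?mulr_ge0.
have farT : T <= p ^+ 2 -> [/\ chi s tau (p ^+ 2) = 0, chi1 s tau (p ^+ 2) = 0 & chi2 s tau (p ^+ 2) = 0].
  by move=> h; apply: chi_far => //; exact: le_trans tT h.
have [r1|r1] := leP r 1.
  have [pT|pT] := leP p (T + 1).
    have h := chi_taylor tau (p ^+ 2) (2 * b + r ^+ 2) s0.
    have bT : `|b| <= (T + 1) * r by rewrite (le_trans bpr)// ler_wpM2r.
    have rr : r ^+ 2 <= r by rewrite -[leRHS]mulr1 expr2 ler_wpM2l.
    have dT : `|2 * b + r ^+ 2| <= (2 * (T + 1) + 1) * r.
      rewrite (le_trans (ler_normD _ _))// normrM (@ger0_norm _ 2)// (@ger0_norm _ (r ^+ 2)) ?exprn_ge0//; lra.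
    have d3 : `|2 * b + r ^+ 2| ^+ 3 <= (2 * (T + 1) + 1) ^+ 3 * r ^+ 3.
      by rewrite -exprMn lerXn2r ?nnegrE// mulr_ge0//; lra.
    have t2 : `|chi2 s tau (p ^+ 2) * (2 * b * r ^+ 2 + r ^+ 4 / 2)| <= 12 * s ^+ 2 * ((2 * (T + 1) + 1) * r ^+ 3).
      rewrite normrM ler_pM//.
      have r4 : r ^+ 4 <= r ^+ 3 by rewrite [leLHS]exprSr -[leRHS]mulr1 ler_wpM2l.
      have r40 : 0 <= r ^+ 4 by rewrite exprn_ge0.
      have hb : `|b * r ^+ 2| <= (T + 1) * r ^+ 3.
        rewrite normrM (@ger0_norm _ (r ^+ 2)) ?exprn_ge0//.
        by rewrite (_ : (T + 1) * r ^+ 3 = (T + 1) * r * r ^+ 2); [rewrite ler_wpM2r ?exprn_ge0|ring].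
      by move: hb; rewrite !ler_norml => /andP[? ?]; apply/andP; split; lra.
    pose L := chi s tau (p ^+ 2 + (2 * b + r ^+ 2)) - chi s tau (p ^+ 2) -
      chi1 s tau (p ^+ 2) * (2 * b + r ^+ 2) -
      chi2 s tau (p ^+ 2) / 2 * (2 * b + r ^+ 2) ^+ 2.
    pose t := chi2 s tau (p ^+ 2) * (2 * b * r ^+ 2 + r ^+ 4 / 2).
    rewrite (_ : _ - _ - _ - _ - _ = L + t); last by rewrite /L /t; field.
    apply: (le_trans (ler_normD _ _)).
    apply: (@le_trans _ _ (C1 * r ^+ 3)).
      rewrite /C1 mulrDl; apply: lerD; last by rewrite -mulrA.
      apply: (le_trans h); rewrite -[leRHS]mulrA; apply: ler_wpM2l; last exact: d3.
      by apply: mulr_ge0 => //; exact: ltW.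
    apply: (@le_trans _ _ (C1 * (ka * r ^+ 2 + r ^+ 4 / ka))); first by rewrite ler_wpM2l ?(ltW C10)//; lra.
    by rewrite ler_wpM2r ?addr_ge0// lerDl ltW.
  (* A distant state and a short increment: the moved state has norm at least [p - r >= T], so both
     ends lie where [chi] vanishes. *)
  have [e0 e1 e2] : [/\ chi s tau (p ^+ 2) = 0, chi1 s tau (p ^+ 2) = 0 & chi2 s tau (p ^+ 2) = 0].
    by apply: farT; apply: sqrT; lra.
  have [-> _ _] : [/\ chi s tau (p ^+ 2 + (2 * b + r ^+ 2)) = 0,
     chi1 s tau (p ^+ 2 + (2 * b + r ^+ 2)) = 0 & chi2 s tau (p ^+ 2 + (2 * b + r ^+ 2)) = 0].
    apply: chi_far => //; apply: (le_trans tT).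
    move: bpr; rewrite ler_norml => /andP[h _].
    have : T ^+ 2 <= (p - r) ^+ 2 by rewrite lerXn2r ?nnegrE; lra.
    have := sqrT T (lexx T).
    have -> : (p - r) ^+ 2 = p ^+ 2 - 2 * (p * r) + r ^+ 2 by ring.
    lra.
  rewrite e0 e1 e2 !(mulr0, mul0r, subr0) normr0.
  by apply: mulr_ge0; [apply: addr_ge0; exact: ltW|exact: addr_ge0].
(* For a long increment no expansion is made: each term is separately at most a multiple of
   [r ^+ 2], hence of [r ^+ 4 / ka]. *)
have r21 : 1 <= r ^+ 2 by rewrite exprn_ege1// ltW.
have r42 : r ^+ 2 <= r ^+ 4.
  by rewrite (_ : r ^+ 4 = r ^+ 2 * r ^+ 2); [rewrite ler_peMl ?exprn_ge0|ring].
have k4 : r ^+ 4 <= r ^+ 4 / ka by rewrite ler_pdivlMr// ler_piMr ?exprn_ge0.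
have [/andP[x0 x1] _ _] := chi_bounds tau (p ^+ 2) s0.
have [/andP[x2 x3] _ _] := chi_bounds tau (p ^+ 2 + (2 * b + r ^+ 2)) s0.
have [pT|pT] := leP p T; last first.
  have [e0 e1 e2] := farT (sqrT _ (ltW pT)).
  rewrite e0 e1 e2 !(mulr0, mul0r, subr0) ger0_norm//.
  apply: (le_trans x3); apply: (@le_trans _ _ (C2 * 1)); first by rewrite mulr1.
  apply: ler_pM => //; [exact: ltW|by rewrite lerDr ltW|lra].
have bT : `|b| <= T * r ^+ 2.
  apply: (le_trans bpr); apply: ler_pM => //.
  by rewrite expr2 ler_peMr// ltW.
have b2T : b ^+ 2 <= T ^+ 2 * r ^+ 2.
  by apply: (le_trans b2); rewrite ler_wpM2r ?exprn_ge0// lerXn2r ?nnegrE//; lra.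
apply: (@le_trans _ _ (C2 * r ^+ 2)); last first.
  apply: (@le_trans _ _ (C2 * (ka * r ^+ 2 + r ^+ 4 / ka))).
    by rewrite ler_wpM2l ?(ltW C20)//; lra.
  by rewrite ler_wpM2r ?addr_ge0// lerDr ltW.
have e1 : `|2 * chi1 s tau (p ^+ 2) * b| <= 24 * s * T * r ^+ 2.
  rewrite -mulrA normrM (@ger0_norm _ 2)// normrM.
  have := ler_pM (normr_ge0 _) (normr_ge0 _) c1 bT; lra.
have e2 : `|chi1 s tau (p ^+ 2) * r ^+ 2| <= 12 * s * r ^+ 2.
  by rewrite normrM (@ger0_norm _ (r ^+ 2)) ?exprn_ge0// ler_wpM2r ?exprn_ge0.
have e3 : `|2 * chi2 s tau (p ^+ 2) * b ^+ 2| <= 24 * s ^+ 2 * T ^+ 2 * r ^+ 2.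
  rewrite -mulrA normrM (@ger0_norm _ 2)// normrM (@ger0_norm _ (b ^+ 2)) ?sqr_ge0//.
  have := ler_pM (normr_ge0 _) (sqr_ge0 b) c2 b2T; lra.
move: e1 e2 e3; rewrite /C2 !ler_norml => /andP[? ?] /andP[? ?] /andP[? ?].
by apply/andP; split; lra.
Qed.

End spline.

Section lindeberg_step.
Context {R : realType}.
Local Notation Z := (nat -> R).

Lemma cauchy_schwarz_sum (m : nat) (l a b : nat -> R) : (forall i, 0 <= l i) ->
  (\sum_(i < m) l i * a i * b i) ^+ 2 <=
  (\sum_(i < m) l i * a i ^+ 2) * (\sum_(i < m) l i * b i ^+ 2).
Proof.
move=> l0; elim: m => [|m IH]; first by rewrite !big_ord0 expr0n mul0r.
rewrite !big_ord_recr/=.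
have A0 : 0 <= \sum_(i < m) l i * a i ^+ 2 by apply: sumr_ge0 => i _; rewrite mulr_ge0 ?sqr_ge0.
have B0 : 0 <= \sum_(i < m) l i * b i ^+ 2 by apply: sumr_ge0 => i _; rewrite mulr_ge0 ?sqr_ge0.
move: (\sum_(i < m) l i * a i * b i) (\sum_(i < m) l i * a i ^+ 2) (\sum_(i < m) l i * b i ^+ 2) A0 B0 IH => C A B A0 B0 IH.
move: (l m) (a m) (b m) (l0 m) => L x y L0.
suff h : 2 * (C * x * y) <= A * y ^+ 2 + B * x ^+ 2.
  have : L * (2 * (C * x * y)) <= L * (A * y ^+ 2 + B * x ^+ 2) by rewrite ler_wpM2l.
  have -> : (C + L * x * y) ^+ 2 = C ^+ 2 + L * (2 * (C * x * y)) + L ^+ 2 * x ^+ 2 * y ^+ 2 by ring.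
  have -> : (A + L * x ^+ 2) * (B + L * y ^+ 2) = A * B + L * (A * y ^+ 2 + B * x ^+ 2) + L ^+ 2 * x ^+ 2 * y ^+ 2 by ring.
  lra.
have [A00|A00] := eqVneq A 0.
  have : C ^+ 2 <= 0 by rewrite (le_trans IH)// A00 mul0r.
  rewrite le_eqVlt ltNge sqr_ge0 orbF sqrf_eq0 => /eqP ->.
  by rewrite A00 !mul0r mulr0 add0r mulr_ge0 ?sqr_ge0.
have Ap : 0 < A by rewrite lt_neqAle eq_sym A00.
rewrite -(ler_pM2l Ap).
have : 0 <= (A * y - C * x) ^+ 2 by exact: sqr_ge0.
have : C ^+ 2 * x ^+ 2 <= A * B * x ^+ 2 by rewrite ler_wpM2r ?sqr_ge0.
have -> : (A * y - C * x) ^+ 2 = A ^+ 2 * y ^+ 2 - 2 * A * C * x * y + C ^+ 2 * x ^+ 2 by ring.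
lra.
Qed.

Lemma lam_le0 j : lam j <= lam 0 :> R.
Proof.
rewrite /lam lef_pV2 ?posrE ?exprn_gt0 ?mulr_gt0 ?pi_gt0 ?ltr0n//.
by rewrite lerXn2r ?nnegrE ?mulr_ge0 ?pi_ge0 ?ler0n// ler_wpM2l ?pi_ge0// ler_nat.
Qed.

Context {d} {T : measurableType d} (P : probability T R) (y : T -> Z) (m : nat).
Hypothesis my : forall j, measurable_fun setT (fun t => y t j).
Variable V : (nat -> R) -> R.

Let B (c : nat -> R) (t : T) : R := \sum_(j < m) c j * y t j.
Hypothesis y2 : forall a c, (\int[P]_t ((a + B c t) ^+ 2)%:E = (a ^+ 2 + V c)%:E)%E.
Local Notation E f := (Rintegral P setT f).
Local Notation I f := (P.-integrable setT (EFin \o f)).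

Let mB c : measurable_fun setT (B c).
Proof. by apply: measurable_sum => i; exact: measurable_funM. Qed.

Let iaB a c : I (fun t => (a + B c t) ^+ 2).
Proof.
apply/integrableP; split.
  by apply/measurable_EFinP; apply: measurable_funX; exact: measurable_funD.
under eq_integral do rewrite /= ger0_norm ?sqr_ge0//.
by rewrite y2 ltry.
Qed.

Let EaB a c : E (fun t => (a + B c t) ^+ 2) = a ^+ 2 + V c.
Proof. by rewrite /Rintegral y2. Qed.

Let BN c t : B (fun j => - c j) t = - B c t.
Proof. by rewrite /B -sumrN; apply: eq_bigr => i _; rewrite mulNr. Qed.

Let iB2 c : I (fun t => B c t ^+ 2).
Proof. by have := iaB 0 c; under eq_fun do rewrite add0r. Qed.

Let EB2 c : E (fun t => B c t ^+ 2) = V c.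
Proof. by have := EaB 0 c; under eq_fun do rewrite add0r; rewrite expr0n add0r. Qed.

Let VN c : V (fun j => - c j) = V c.
Proof.
rewrite -!EB2; congr (Rintegral _ _ _); apply/funext => t.
by rewrite BN sqrrN.
Qed.

(** Polarization: integrability of a linear form and the vanishing of its mean both follow from the
    second-moment hypothesis [y2]. *)
Let B4 c : B c = (fun t => 4^-1 * ((1 + B c t) ^+ 2 - (1 + B (fun j => - c j) t) ^+ 2)).
Proof. by apply/funext => t; rewrite BN; field. Qed.

Let iB c : I (B c).
Proof.
have h := integrableZl measurableT 4^-1
  (integrableB measurableT (iaB 1 c) (iaB 1 (fun j => - c j))).
by rewrite B4; exact: h.
Qed.

Let EB c : E (B c) = 0.
Proof.
rewrite B4 RintegralZl//; last exact: (integrableB measurableT (iaB 1 c) (iaB 1 _)).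
rewrite RintegralB//.
by rewrite !EaB VN subrr mulr0.
Qed.

Let dl (j : nat) : nat -> R := fun i => (i == j)%:R.

Let Bdl j t : (j < m)%N -> B (dl j) t = y t j.
Proof.
move=> jm; rewrite /B (bigD1 (Ordinal jm))//= /dl eqxx mul1r big1 ?addr0// => i ij.
by rewrite (_ : (i == j :> nat) = false) ?mul0r//; apply/negbTE; apply: contra ij => /eqP e; apply/eqP/val_inj.
Qed.

Let W t : R := Qm m (y t).

Let WE : W = (fun t => \sum_(j < m) lam j * B (dl j) t ^+ 2).
Proof. by apply/funext => t; rewrite /W /Qm; apply: eq_bigr => i _; rewrite Bdl. Qed.

Let I_sum (k : nat) (f : nat -> T -> R) : (forall j, (j < k)%N -> I (f j)) ->
  I (fun t => \sum_(j < k) f j t) /\ E (fun t => \sum_(j < k) f j t) = \sum_(j < k) E (f j).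
Proof.
elim: k => [|k IH] h.
  under eq_fun do rewrite big_ord0; rewrite big_ord0; split.
    exact: (integrable0 P).
  by rewrite /Rintegral integral0.
have [i1 e1] := IH (fun j jk => h j (ltnW jk)).
under eq_fun do rewrite big_ord_recr/=.
rewrite big_ord_recr/= -e1; split; first exact: (integrableD measurableT i1 (h k (ltnSn k))).
by rewrite RintegralD//; exact: h.
Qed.

Let iW : I W.
Proof.
rewrite WE; apply: (I_sum (f := fun j t => lam j * B (dl j) t ^+ 2) _).1 => j _.
exact: (integrableZl measurableT (lam j) (iB2 _)).
Qed.

Let EW : E W = \sum_(j < m) lam j * V (dl j).
Proof.
rewrite WE (I_sum (f := fun j t => lam j * B (dl j) t ^+ 2) _).2 => [|j _]; last first.
  exact: (integrableZl measurableT (lam j) (iB2 _)).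
by apply: eq_bigr => j _; rewrite RintegralZl// EB2.
Qed.

Variables (s2 e K : R).
Hypothesis Ve : forall c, `|V c - s2 * \sum_(j < m) c j ^+ 2| <= e * \sum_(j < m) c j ^+ 2.
Hypothesis y4 : forall j, (j < m)%N -> (\int[P]_t ((y t j) ^+ 4)%:E <= K%:E)%E.

Let i4 j : (j < m)%N -> I (fun t => y t j ^+ 4).
Proof.
move=> jm; apply/integrableP; split.
  by apply/measurable_EFinP; exact: measurable_funX.
under eq_integral do rewrite /= ger0_norm ?exprn_even_ge0//.
by rewrite (le_lt_trans (y4 jm))// ltry.
Qed.

(** Cauchy-Schwarz over the [m] coordinates reduces the second moment of [W] to the fourth moments
    in [y4]. *)
Let W2_le t : W t ^+ 2 <= m%:R * \sum_(j < m) lam j ^+ 2 * y t j ^+ 4.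
Proof.
have := @cauchy_schwarz_sum m (fun=> 1) (fun=> 1) (fun j => lam j * y t j ^+ 2) (fun=> ler01).
rewrite [X in X ^+ 2 <= _ -> _](_ : _ = W t); last by apply: eq_bigr => i _; rewrite !mul1r.
move=> /le_trans; apply; apply: ler_pM.
- by apply: sumr_ge0 => i _; rewrite mulr_ge0 ?sqr_ge0.
- by apply: sumr_ge0 => i _; rewrite mulr_ge0 ?sqr_ge0.
- by rewrite (eq_bigr (fun=> 1)) ?sumr_const ?card_ord// => i _; rewrite expr1n mulr1.
- by apply: ler_sum => i _; rewrite mul1r exprMn -exprM.
Qed.

Let mW : measurable_fun setT W.
Proof. by apply: measurable_sum => i; apply: measurable_funM => //; exact: measurable_funX. Qed.

Let i4s : I (fun t => \sum_(j < m) lam j ^+ 2 * y t j ^+ 4).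
Proof.
apply: (I_sum (f := fun j t => lam j ^+ 2 * y t j ^+ 4) _).1 => j jm.
exact: (integrableZl measurableT (lam j ^+ 2) (i4 jm)).
Qed.

Let iW2 : I (fun t => W t ^+ 2).
Proof.
apply: (le_integrable measurableT _ _ (integrableZl measurableT m%:R i4s)).
  by apply/measurable_EFinP; exact: measurable_funX.
move=> t _ /=; rewrite lee_fin ger0_norm ?sqr_ge0// ger0_norm; last first.
  by rewrite mulr_ge0// sumr_ge0// => i _; rewrite mulr_ge0 ?sqr_ge0 ?exprn_even_ge0.
exact: W2_le.
Qed.

Let EW2 : E (fun t => W t ^+ 2) <= m%:R * (\sum_(j < m) lam j ^+ 2) * K.
Proof.
apply: (@le_trans _ _ (E (fun t => m%:R * \sum_(j < m) lam j ^+ 2 * y t j ^+ 4))).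
  apply: le_Rintegral; [exact: measurableT|exact: iW2|exact: (integrableZl measurableT m%:R i4s)|].
  by move=> t _; exact: W2_le.
rewrite RintegralZl// -mulrA ler_wpM2l//.
rewrite (I_sum (f := fun j t => lam j ^+ 2 * y t j ^+ 4) _).2 => [|j jm]; last first.
  exact: (integrableZl measurableT (lam j ^+ 2) (i4 jm)).
rewrite mulr_suml; apply: ler_sum => j _.
rewrite RintegralZl//; last exact: i4.
rewrite ler_wpM2l ?sqr_ge0// -lee_fin /Rintegral fineK; first exact: y4.
exact: (integrable_fin_num measurableT (i4 (ltn_ord j))).
Qed.

(** Half the Laplacian of [chi s tau (Qm m z)] in the first [m] coordinates. *)
Definition lindeberg_gen (s tau : R) (z : Z) : R :=
  chi1 s tau (Qm m z) * \sum_(j < m) lam j + 2 * chi2 s tau (Qm m z) * \sum_(j < m) lam j ^+ 2 * z j ^+ 2.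

Lemma Qm_ge0 (z : Z) : 0 <= Qm m z.
Proof. by apply: sumr_ge0 => i _; rewrite mulr_ge0 ?sqr_ge0// ltW// lam_gt0. Qed.

(** The expansion is the same for every centred step with covariance close to [s2] times the
    identity. It is used once for an observation and once for a Gaussian step, and the generator
    terms cancel in the difference. *)
Lemma lindeberg_step (s tau Tm C ka : R) (z : Z) : 0 < s -> 1 <= Tm -> tau <= Tm -> 0 <= e -> 0 <= s2 ->
  0 < ka <= 1 ->
  (forall (p r b : R), 0 <= p -> 0 <= r -> `|b| <= p * r ->
  `|chi s tau (p ^+ 2 + (2 * b + r ^+ 2)) - chi s tau (p ^+ 2) - 2 * chi1 s tau (p ^+ 2) * b
    - chi1 s tau (p ^+ 2) * r ^+ 2 - 2 * chi2 s tau (p ^+ 2) * b ^+ 2| <=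
  C * (ka * r ^+ 2 + r ^+ 4 / ka)) -> 0 <= C ->
  let L := \sum_(j < m) lam j in let L2 := \sum_(j < m) lam j ^+ 2 in
  exists2 r : R, stepop P y (fun z => (chi s tau (Qm m z))%:E) z = r%:E &
  `|r - (chi s tau (Qm m z) + s2 * lindeberg_gen s tau z)| <=
   C * (ka * ((s2 + e) * L) + m%:R * L2 * K / ka) + e * (12 * s * L + 24 * s ^+ 2 * (lam 0 * Tm)).
Proof.
move=> s0 T1 tT e0 s20 /andP[ka0 ka1] HC C0 L L2.
set q := Qm m z; have q0 : 0 <= q := Qm_ge0 z.
pose c (j : nat) : R := lam j * z j.
have QE t : Qm m (zadd z (y t)) = q + (2 * B c t + W t).
  rewrite /q /W /Qm /B mulr_sumr -!big_split/=; apply: eq_bigr => i _.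
  rewrite /zadd /c; ring.
have W0 t : 0 <= W t by exact: Qm_ge0.
have CS t : `|B c t| <= Num.sqrt q * Num.sqrt (W t).
  rewrite -sqrtrM// -sqrtr_sqr ler_wsqrtr//.
  exact: (@cauchy_schwarz_sum m lam z (y t) (fun i => ltW (lam_gt0 i))).
pose X t := chi s tau (Qm m (zadd z (y t))).
pose M t := chi s tau q + (2 * chi1 s tau q * B c t + (chi1 s tau q * W t + 2 * chi2 s tau q * B c t ^+ 2)).
pose Rm t := C * (ka * W t + ka^-1 * W t ^+ 2).
have XM t : `|X t - M t| <= Rm t.
  have := HC _ _ _ (sqrtr_ge0 q) (sqrtr_ge0 (W t)) (CS t).
  rewrite (_ : Num.sqrt (W t) ^+ 4 = W t ^+ 2); last by rewrite -[4%N]/(2 * 2)%N exprM sqr_sqrtr.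
  rewrite !sqr_sqrtr// -QE -/(X t) /Rm (mulrC (ka^-1)) /M.
  by rewrite (_ : _ - _ - _ - _ - _ = X t - (chi s tau q + (2 * chi1 s tau q * B c t +
     (chi1 s tau q * W t + 2 * chi2 s tau q * B c t ^+ 2)))); last by ring.
have mX : measurable_fun setT X.
  apply: (measurableT_comp measurable_spl).
  apply: measurable_funM => //; apply: measurable_funB => //.
  apply: measurable_sum => i; apply: measurable_funM => //; apply: measurable_funX.
  exact: measurable_funD.
have iX : I X.
  apply: (@prob_bounded_integrable _ _ _ P X 1 mX) => t.
  by have [/andP[? ?] _ _] := chi_bounds tau (Qm m (zadd z (y t))) s0; rewrite ger0_norm.
have iM1 : I (fun t => 2 * chi1 s tau q * B c t) by exact: (integrableZl measurableT _ (iB c)).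
have iM2 : I (fun t => chi1 s tau q * W t) by exact: (integrableZl measurableT _ iW).
have iM3 : I (fun t => 2 * chi2 s tau q * B c t ^+ 2) by exact: (integrableZl measurableT _ (iB2 c)).
have iM0 : I (fun=> chi s tau q).
  by apply: (@prob_bounded_integrable _ _ _ P _ `|chi s tau q|) => //; exact: measurable_cst.
have iM23 := integrableD measurableT iM2 iM3.
have iM123 := integrableD measurableT iM1 iM23.
have iM : I M by exact: (integrableD measurableT iM0 iM123).
have EM : E M = chi s tau q + (chi1 s tau q * (\sum_(j < m) lam j * V (dl j)) + 2 * chi2 s tau q * V c).
  have E1 : E (fun t => 2 * chi1 s tau q * B c t) = 0.
    by transitivity (2 * chi1 s tau q * E (B c)); [exact: RintegralZl|rewrite EB mulr0].
  have E2 : E (fun t => chi1 s tau q * W t) = chi1 s tau q * E W by exact: RintegralZl.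
  have E3 : E (fun t => 2 * chi2 s tau q * B c t ^+ 2) = 2 * chi2 s tau q * E (fun t => B c t ^+ 2).
    exact: RintegralZl.
  rewrite -EW -EB2 -E2 -E3.
  rewrite (_ : chi s tau q = E (fun=> chi s tau q)); last by rewrite /Rintegral integral_prob_cst.
  rewrite -RintegralD; [|exact: measurableT|exact: iM2|exact: iM3].
  rewrite -[X in _ = _ + X]add0r -E1 -RintegralD; [|exact: measurableT|exact: iM1|exact: iM23].
  by rewrite -RintegralD; [|exact: measurableT|exact: iM0|exact: iM123].
have iR1 : I (fun t => ka * W t) by exact: (integrableZl measurableT _ iW).
have iR2 : I (fun t => ka^-1 * W t ^+ 2) by exact: (integrableZl measurableT _ iW2).
have iR12 := integrableD measurableT iR1 iR2.
have iR : I Rm by exact: (integrableZl measurableT _ iR12).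
have ER : E Rm = C * (ka * E W + ka^-1 * E (fun t => W t ^+ 2)).
  have E1 : E (fun t => ka * W t) = ka * E W by exact: RintegralZl.
  have E2 : E (fun t => ka^-1 * W t ^+ 2) = ka^-1 * E (fun t => W t ^+ 2) by exact: RintegralZl.
  rewrite -E1 -E2 -RintegralD; [|exact: measurableT|exact: iR1|exact: iR2].
  exact: RintegralZl.
exists (E X).
  rewrite /stepop /Rintegral fineK//; exact: (integrable_fin_num measurableT iX).
have dX : `|E X - E M| <= E Rm.
  rewrite -RintegralB//; apply: (le_trans (le_normr_Rintegral _ _)) => //.
    exact: (integrableB measurableT iX iM).
  apply: le_Rintegral.
  - exact: measurableT.
  - by have := integrable_norm (integrableB measurableT iX iM).
  - exact: iR.
  - by move=> t _; exact: XM.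
have sdl j : (j < m)%N -> \sum_(i < m) dl j i ^+ 2 = 1.
  move=> jm; rewrite (bigD1 (Ordinal jm))//= /dl eqxx expr1n big1 ?addr0// => i ij.
  by rewrite (_ : (i == j :> nat) = false) ?expr0n//; apply/negbTE; apply: contra ij => /eqP ee; apply/eqP/val_inj.
have Vdl j : (j < m)%N -> `|V (dl j) - s2| <= e by move=> jm; have := Ve (dl j); rewrite sdl// !mulr1.
have dEW : `|\sum_(j < m) lam j * V (dl j) - s2 * L| <= e * L.
  rewrite /L !mulr_sumr -sumrB (le_trans (ler_norm_sum _ _ _))//; apply: ler_sum => j _.
  rewrite (mulrC s2) -mulrBr normrM gtr0_norm ?lam_gt0// mulrC ler_wpM2r ?(ltW (lam_gt0 _))//.
  exact: Vdl.
have EWb : E W <= (s2 + e) * L by rewrite EW; move: dEW; rewrite ler_norml => /andP[_ h]; lra.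
have ERb : E Rm <= C * (ka * ((s2 + e) * L) + m%:R * L2 * K / ka).
  rewrite ER; apply: ler_wpM2l => //; apply: lerD; first by rewrite ler_wpM2l// ltW.
  by rewrite mulrC ler_wpM2r ?invr_ge0 ?(ltW ka0).
have [_ c1 c2] := chi_bounds tau q s0.
have t1 : `|chi1 s tau q * (\sum_(j < m) lam j * V (dl j) - s2 * L)| <= e * (12 * s * L).
  rewrite normrM; have := ler_pM (normr_ge0 _) (normr_ge0 _) c1 dEW; lra.
have t2 : `|2 * chi2 s tau q * (V c - s2 * \sum_(j < m) c j ^+ 2)| <= e * (24 * s ^+ 2 * (lam 0 * Tm)).
  have c20 : 0 <= e * (24 * s ^+ 2 * (lam 0 * Tm)).
    by rewrite mulr_ge0// mulr_ge0 ?mulr_ge0 ?sqr_ge0// ?(ltW (lam_gt0 0))//; lra.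
  (* Uniformity in [z]: past [Tm] the factor [chi2] vanishes, and below it the quadratic form of
     [lam * z] is at most [lam 0 * Tm]. *)
  have [Tq|qT] := leP Tm q.
    by have [_ _ ->] := chi_far s0 (le_trans tT Tq); rewrite mulr0 mul0r normr0.
  have cq : \sum_(j < m) c j ^+ 2 <= lam 0 * Tm.
    apply: (@le_trans _ _ (lam 0 * q)); last by rewrite ler_wpM2l ?(ltW qT)// ltW// lam_gt0.
    rewrite /q /Qm mulr_sumr; apply: ler_sum => j _.
    rewrite /c exprMn expr2 -mulrA ler_wpM2r ?lam_le0// mulr_ge0 ?sqr_ge0// ltW// lam_gt0//.
  have h : `|V c - s2 * \sum_(j < m) c j ^+ 2| <= e * (lam 0 * Tm).
    by apply: (le_trans (Ve c)); rewrite ler_wpM2l.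
  rewrite -mulrA normrM (@ger0_norm _ 2)// normrM.
  have := ler_pM (normr_ge0 _) (normr_ge0 _) c2 h; lra.
have gE : s2 * lindeberg_gen s tau z = chi1 s tau q * (s2 * L) + 2 * chi2 s tau q * (s2 * \sum_(j < m) c j ^+ 2).
  rewrite /lindeberg_gen -/q -/L (eq_bigr (fun j : 'I_m => c j ^+ 2)); first by ring.
  by move=> j _; rewrite /c exprMn.
rewrite gE; move: dX t1 t2; rewrite EM !ler_norml => /andP[? ?] /andP[? ?] /andP[? ?].
by apply/andP; split; lra.
Qed.

End lindeberg_step.

(** * Exchange of n observations for n Gaussian steps *)

Section clt.
Context {R : realType}.
Local Notation Z := (nat -> R).

Lemma chiQm_good m (s tau : R) : 0 < s -> good (fun z : Z => (chi s tau (Qm m z))%:E).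
Proof.
move=> s0; apply: good_EFin => [z|d T zt mzt].
  by have [/andP[]] := chi_bounds tau (Qm m z) s0.
apply: (measurableT_comp measurable_spl).
apply: measurable_funM => //; apply: measurable_funB => //.
apply: measurable_sum => i; apply: measurable_funM => //; exact: measurable_funX.
Qed.

Lemma eq_iter_good n (A B : (Z -> \bar R) -> Z -> \bar R) g : op_ok B ->
  (forall h, good h -> A h = B h) -> good g -> iter n A g = iter n B g.
Proof.
move=> okB AB gg; elim: n => //= n ->; apply: AB.
by have [+ _ _ _ _] := op_ok_iter n okB; exact.
Qed.

(** Three errors are each kept below [eps / 3], in this order of choice: [ka] for the second-moment
    part of the remainder, [e0] for the mismatch of covariances, [n0] for the fourth moments, whose
    total is of order [1 / n]. *)
Lemma lindeberg_exchange m (s T eps : R) : 0 < s -> 1 <= T -> 0 < eps ->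
  exists2 e0 : R, 0 < e0 & exists n0 : nat, forall n, (n0 <= n)%N ->
  forall d (X : measurableType d) (P : probability X R) (y : X -> Z) (V : (nat -> R) -> R),
  (forall j, measurable_fun setT (fun t => y t j)) ->
  (forall a (c : nat -> R), (\int[P]_t ((a + \sum_(j < m) c j * y t j) ^+ 2)%:E = (a ^+ 2 + V c)%:E)%E) ->
  (forall c : nat -> R, `|V c - n%:R^-1 * \sum_(j < m) c j ^+ 2| <= (e0 / n%:R) * \sum_(j < m) c j ^+ 2) ->
  (forall j, (j < m)%N -> (\int[P]_t ((y t j) ^+ 4)%:E <= (64 / n%:R ^+ 2)%:E)%E) ->
  forall tau z, tau <= T ->
  (iter n (stepop P y) (fun z => (chi s tau (Qm m z))%:E) z <=
     gauss_op 1 m (fun z => (chi s tau (Qm m z))%:E) z + eps%:E)%E /\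
  (gauss_op 1 m (fun z => (chi s tau (Qm m z))%:E) z <=
     iter n (stepop P y) (fun z => (chi s tau (Qm m z))%:E) z + eps%:E)%E.
Proof.
move=> s0 T1 eps0.
have [C C0 HC] := chi_quad_taylor s0 T1.
pose L : R := \sum_(j < m) lam j; pose L2 : R := \sum_(j < m) lam j ^+ 2.
have L0 : 0 <= L by apply: sumr_ge0 => i _; rewrite ltW// lam_gt0.
have L20 : 0 <= L2 by apply: sumr_ge0 => i _; rewrite sqr_ge0.
pose D : R := 12 * s * L + 24 * s ^+ 2 * (lam 0 * T).
have D0 : 0 <= D.
  have l00 := ltW (@lam_gt0 R 0); have s20 := sqr_ge0 s; have T0 : 0 <= T := le_trans ler01 T1.
  have h1 := mulr_ge0 (ltW s0) L0; have h2 := mulr_ge0 s20 (mulr_ge0 l00 T0).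
  by rewrite /D; lra.
have CL0 : 0 <= C * L by rewrite mulr_ge0// ltW.
(* The factor 3 in [kaE] is a variance factor at most 2 for an observation ([1 + e0]) plus 1 for a
   Gaussian step. *)
pose ka : R := Num.min 1 (eps / (9 * (C * L) + 1)).
have den0 : 0 < 9 * (C * L) + 1 by lra.
have ka01 : 0 < ka <= 1 by rewrite lt_min ltr01 divr_gt0//= ge_min lexx.
have kaE : 3 * (C * L) * ka <= eps / 3.
  apply: (@le_trans _ _ (3 * (C * L) * (eps / (9 * (C * L) + 1)))).
    apply: ler_wpM2l; first by lra.
    by rewrite ge_min lexx orbT.
  rewrite mulrA ler_pdivrMr//; nra.
pose e0 : R := Num.min 1 (eps / (3 * D + 1)).
have den1 : 0 < 3 * D + 1 by lra.
have e00 : 0 < e0 by rewrite lt_min ltr01 divr_gt0.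
have e01 : e0 <= 1 by rewrite ge_min lexx.
have e0E : e0 * D <= eps / 3.
  apply: (@le_trans _ _ (eps / (3 * D + 1) * D)).
    by apply: ler_wpM2r => //; rewrite ge_min lexx orbT.
  rewrite mulrAC ler_pdivrMr//.
  have := mulr_ge0 (ltW eps0) D0; lra.
exists e0 => //.
(* 67 adds the fourth-moment constants 64 of an observation and 3 of a Gaussian. *)
pose Q : R := 67 * (C * (m%:R * L2)).
have Q0 : 0 <= Q by rewrite /Q !mulr_ge0// ltW.
have /andP[ka0 ka1] := ka01.
exists (Num.truncn (3 * Q / (ka * eps))).+1 => n n0n.
have npos : 0 < n%:R :> R by rewrite ltr0n (leq_trans _ n0n).
have nQ : Q / (n%:R * ka) <= eps / 3.
  have h : 3 * Q / (ka * eps) <= n%:R.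
    apply: (@le_trans _ _ (Num.truncn (3 * Q / (ka * eps))).+1%:R); last by rewrite ler_nat.
    by rewrite ltW// truncnS_gt.
  move: h; rewrite ler_pdivrMr ?mulr_gt0// => h.
  rewrite ler_pdivrMr ?mulr_gt0//; lra.
move=> d X P y V my y2 Ve y4 tau z tT.
have n0 : n%:R != 0 :> R by rewrite gt_eqF.
have [n' nE] : exists n', n = n'.+1 by exists n.-1; rewrite prednK// -(ltr0n R).
have sn0 : 0 < (Num.sqrt n%:R)^-1 :> R by rewrite invr_gt0 sqrtr_gt0.
have sn2 : (Num.sqrt n%:R)^-1 ^+ 2 = n%:R^-1 :> R by rewrite exprVn sqr_sqrtr// ltW.
have [d' [X' [P' [y' [my' y'E _ y'2 y'4]]]]] := @gauss_op_step R _ m sn0.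
set g := fun z => (chi s tau (Qm m z))%:E.
have gg : good g by exact: chiQm_good.
pose V' (c : nat -> R) : R := n%:R^-1 * \sum_(j < m) c j ^+ 2.
have HC' p r b := HC tau p r b ka tT.
have y'2' a (c : nat -> R) : (\int[P']_t ((a + \sum_(j < m) c j * y' t j) ^+ 2)%:E = (a ^+ 2 + V' c)%:E)%E.
  by rewrite y'2 sn2.
have V'e (c : nat -> R) : `|V' c - n%:R^-1 * \sum_(j < m) c j ^+ 2| <= 0 * \sum_(j < m) c j ^+ 2.
  by rewrite subrr normr0 mul0r.
have y'4' j : (j < m)%N -> (\int[P']_t ((y' t j) ^+ 4)%:E <= (3 / n%:R ^+ 2)%:E)%E.
  move=> jm; apply: (le_trans (y'4 _ jm)).
  by rewrite -[4%N]/(2 * 2)%N exprM sn2 exprVn lee_fin.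
have in0 : 0 <= n%:R^-1 :> R by rewrite invr_ge0 ltW.
have e0n : 0 <= e0 / n%:R by rewrite mulr_ge0// ltW.
have okA : op_ok (stepop P y) by exact: stepop_ok.
have okB : op_ok (stepop P' y') by exact: stepop_ok.
have AB : op_comm (stepop P y) (stepop P' y') by exact: stepop_comm.
have nE' : n%:R * (eps / n%:R) = eps by rewrite mulrCA mulfV// mulr1.
(* The standard Gaussian average is now [n] steps of variance [1 / n], ready for [iter_swap_le]. *)
have iB : gauss_op 1 m g = iter n (stepop P' y') g.
  by rewrite nE -(gauss_op_iter m n' gg) -nE; apply: eq_iter_good => // h gh; rewrite y'E.
have cmp u : exists r r' : R, [/\ stepop P y g u = r%:E, stepop P' y' g u = r'%:E & `|r - r'| <= eps / n%:R].
  have [r rE rb] := @lindeberg_step R _ X P y m my V y2 n%:R^-1 (e0 / n%:R) (64 / n%:R ^+ 2) Ve y4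
    s tau T C ka u s0 T1 tT e0n in0 ka01 (fun p r b p0 r0 h => HC' p r b p0 r0 h ka01) (ltW C0).
  have [r' rE' rb'] := @lindeberg_step R _ X' P' y' m my' V' y'2' n%:R^-1 0 (3 / n%:R ^+ 2) V'e y'4'
    s tau T C ka u s0 T1 tT (lexx 0) in0 ka01 (fun p r b p0 r0 h => HC' p r b p0 r0 h ka01) (ltW C0).
  exists r, r'; split => //.
  apply: (@le_trans _ _ (n%:R^-1 * (3 * (C * L) * ka + Q / (n%:R * ka) + e0 * D))); last first.
    rewrite mulrC; apply: ler_wpM2r => //; lra.
  apply: le_trans (ler_distD (chi s tau (Qm m u) + n%:R^-1 * lindeberg_gen m s tau u) r r') _.
  rewrite (distrC _ r').
  have h1 : C * (ka * ((n%:R^-1 + e0 / n%:R) * L)) <= n%:R^-1 * (2 * (C * L) * ka).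
    have -> : C * (ka * ((n%:R^-1 + e0 / n%:R) * L)) = n%:R^-1 * ((1 + e0) * ((C * L) * ka)) by ring.
    apply: ler_wpM2l => //; rewrite -[leRHS]mulrA; apply: ler_wpM2r; last by lra.
    by rewrite mulr_ge0// ltW.
  have hq : n%:R^-1 * (Q / (n%:R * ka)) = C * (m%:R * L2 * (64 / n%:R ^+ 2) / ka) + C * (m%:R * L2 * (3 / n%:R ^+ 2) / ka).
    rewrite /Q; field; by rewrite n0 gt_eqF.
  apply: (le_trans (lerD rb rb')); rewrite -/L -/L2 -/D mul0r !addr0 2!(mulrDr C) 2!(mulrDr n%:R^-1) hq.
  have -> : C * (ka * (n%:R^-1 * L)) = n%:R^-1 * (C * L * ka) by ring.
  have -> : e0 / n%:R * D = n%:R^-1 * (e0 * D) by ring.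
  lra.
have en0 : 0 <= eps / n%:R by rewrite mulr_ge0// ltW.
split.
  rewrite iB -nE'; apply: iter_swap_le => // u.
  by have [r [r' [-> -> ]]] := cmp u; rewrite ler_norml -EFinD lee_fin => /andP[? ?]; lra.
rewrite iB -nE'; apply: iter_swap_le => //; first exact: op_comm_sym.
by move=> u; have [r [r' [-> -> ]]] := cmp u; rewrite ler_norml -EFinD lee_fin => /andP[? ?]; lra.
Qed.

End clt.

(** * The Bernoulli polynomial identity *)

Section bernoulli.
Context {R : realType}.
Implicit Types (t x : R) (m k : nat).

Lemma lamE j : lam j = (pi * j.+1%:R : R) ^- 2.
Proof. by []. Qed.

Lemma lam_le_telescope j : lam j.+1 <= j.+1%:R^-1 - j.+2%:R^-1 :> R.
Proof.
have j1 : 0 < j.+1%:R :> R by rewrite ltr0n.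
have j2 : 0 < j.+2%:R :> R by rewrite ltr0n.
have -> : j.+1%:R^-1 - j.+2%:R^-1 = (j.+1%:R * j.+2%:R : R)^-1.
  rewrite -(natr1 j.+1); move: (j.+1%:R) j1 => a a0; field; apply/andP; split; rewrite gt_eqF//; lra.
rewrite /lam lef_pV2 ?posrE ?exprn_gt0 ?mulr_gt0 ?pi_gt0//.
rewrite exprMn; have h := @pi_ge2 R.
apply: (@le_trans _ _ (j.+2%:R ^+ 2)).
  by rewrite expr2 ler_wpM2r ?ler_nat// ltW.
rewrite ler_peMl ?sqr_ge0// expr_ge1//; lra.
Qed.

Lemma sum_lam_tail_le m k : (0 < m)%N -> (m <= k)%N ->
  \sum_(m <= j < k) lam j <= (m%:R : R)^-1.
Proof.
move=> m0 mk; apply: (@le_trans _ _ (m%:R^-1 - k%:R^-1)); last by rewrite gerBl invr_ge0.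
elim: k mk => [|k IH]; first by rewrite leqn0 => /eqP mE; rewrite mE in m0.
rewrite leq_eqVlt => /orP[/eqP ->|]; first by rewrite big_geq// subrr.
rewrite ltnS => mk; rewrite big_nat_recr//=.
have k0 := leq_trans m0 mk.
have := lerD (IH mk) (lam_le_telescope k.-1); rewrite prednK// => /le_trans; apply.
by rewrite addrA subrK.
Qed.

Lemma sum_lam_le k : \sum_(0 <= j < k) lam j <= lam 0 + 1 :> R.
Proof.
case: k => [|k]; first by rewrite big_geq// addr_ge0// ltW// lam_gt0.
by rewrite big_nat_recl// lerD2l -(big_add1 _ _ 0 k.+1 predT) (le_trans (@sum_lam_tail_le 1 k.+1 _ _))// invr1.
Qed.

Lemma is_cvg_lam : cvgn (series (@lam R)).
Proof.
apply: nondecreasing_is_cvgn.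
  apply/nondecreasing_seqP => n; rewrite /series/= big_nat_recr//= lerDl ltW// lam_gt0//.
by exists (lam 0 + 1) => _ [n _ <-]; exact: sum_lam_le.
Qed.

Definition lcos t j : R := lam j * cos (pi * j.+1%:R * t).

Lemma is_cvg_lcos t : cvgn (series (lcos t)).
Proof.
apply: normed_cvg; apply: (series_le_cvg _ _ _ is_cvg_lam) => n /=.
- by rewrite normr_ge0.
- by rewrite ltW// lam_gt0.
- by rewrite /lcos normrM gtr0_norm ?lam_gt0// ler_piMr ?(ltW (lam_gt0 _))// cos_max.
Qed.

Lemma cosDpin x k : cos (x + pi * k%:R) = (-1) ^+ k * cos x :> R.
Proof. by rewrite mulr_natr (alternatingn (@cosDpi R)). Qed.

Lemma sinDpin x k : sin (x + pi * k%:R) = (-1) ^+ k * sin x :> R.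
Proof. by rewrite mulr_natr (alternatingn (@sinDpi R)). Qed.

Lemma lcos_sym t j : lcos (2 - t) j = lcos t j.
Proof.
rewrite /lcos; congr (_ * _).
rewrite (_ : _ * (2 - t) = - (pi * j.+1%:R * t) + pi * (2 * j.+1)%N%:R); last by rewrite natrM; ring.
by rewrite cosDpin exprM sqrrN !expr1n mul1r cosN.
Qed.

(** Passing from [t / 2] to [t / 2 + 1] changes the sign of the odd frequencies: these cancel, and
    the even ones rebuild the series at [t]. This relation fixes the additive constant in the closed
    form. *)
Lemma lcos_dup t m : series (lcos (t / 2)) (2 * m)%N + series (lcos (t / 2 + 1)) (2 * m)%N =
  2^-1 * series (lcos t) m.
Proof.
rewrite /series/=; elim: m => [|m IH]; first by rewrite muln0 !big_geq// addr0 mulr0.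
rewrite mulnS !big_nat_recr//= mulrDr -IH.
have E k : cos (pi * k.+1%:R * (t / 2 + 1)) = (-1) ^+ k.+1 * cos (pi * k.+1%:R * (t / 2)).
  by rewrite mulrDr mulr1 cosDpin.
rewrite /lcos !E; have E2 : (2 * m).+2 = (2 * m.+1)%N by rewrite mulnS.
have -> : (-1) ^+ (2 * m).+1 = -1 :> R by rewrite exprS exprM sqrrN !expr1n mulr1.
have -> : (-1) ^+ (2 * m).+2 = 1 :> R by rewrite exprSr exprS exprM sqrrN !expr1n !mulr1 mulrNN mulr1.
have -> : pi * (2 * m).+2%:R * (t / 2) = pi * m.+1%:R * t.
  by rewrite E2 natrM; field.
have -> : lam (2 * m).+1 = 4^-1 * lam m :> R.
  rewrite /lam E2 natrM; move: (m.+1%:R : R) (@ltr0Sn R m) (@pi R) (@pi_gt0 R) => a a0 p p0; field.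
  by rewrite !gt_eqF.
by field.
Qed.

Lemma is_derive_psum (F dF : nat -> R -> R) m x :
  (forall j, is_derive x 1 (F j) (dF j x)) ->
  is_derive x 1 (fun t => \sum_(0 <= j < m) F j t) (\sum_(0 <= j < m) dF j x).
Proof.
move=> h; elim: m => [|m IH].
  rewrite big_geq// (_ : (fun t => _) = cst 0); first exact: is_derive_cst.
  by apply/funext => t; rewrite big_geq.
rewrite big_nat_recr//= (_ : (fun t => _) = (fun t => \sum_(0 <= j < m) F j t) + F m).
  exact: is_deriveD.
by apply/funext => t; rewrite big_nat_recr.
Qed.

(** The error [e m] of the closed form has derivative [r m], whose own derivative is a Dirichlet
    kernel. A bound on [r m] makes the limit [D] of the errors constant on (0,1], and duplication
    with symmetry forces the constant to be 0, so the sum of the inverse squares comes out of the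
    argument instead of entering it. *)
Let bern t : R := 6^-1 - t / 2 + t ^+ 2 / 4.
Let e m t : R := bern t - series (lcos t) m.
Let r m t : R := t / 2 - 2^-1 + \sum_(0 <= j < m) sin (pi * j.+1%:R * t) / (pi * j.+1%:R).
Let w t : R := (2 * sin (pi * t / 2))^-1.
Let om m : R := pi * (m%:R + 2^-1).

Let pik0 k : pi * k.+1%:R != 0 :> R.
Proof. by rewrite mulf_neq0 ?gt_eqF ?pi_gt0. Qed.

Let der_e m t : is_derive t 1 (e m) (r m t).
Proof.
have h : is_derive t 1 (fun u : R => \sum_(0 <= j < m) lcos u j)
    (\sum_(0 <= j < m) - (sin (pi * j.+1%:R * t) / (pi * j.+1%:R))).
  apply: (is_derive_psum (F := fun j u => lcos u j)
    (dF := fun j u => - (sin (pi * j.+1%:R * u) / (pi * j.+1%:R)))) => j.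
  rewrite /lcos /lam; move: (pi * j.+1%:R) (pik0 j) => a a0.
  by apply: is_derive_eq; rewrite /GRing.scale/=; field.
by rewrite /e /bern; apply: is_derive_eq; rewrite /GRing.scale/= /r sumrN; field.
Qed.

Let dirichlet m t : (2^-1 + \sum_(0 <= j < m) cos (pi * j.+1%:R * t)) * (2 * sin (pi * t / 2)) = sin (om m * t).
Proof.
elim: m => [|m IH].
  by rewrite big_geq// addr0 mulKf// /om add0r; congr sin; ring.
rewrite big_nat_recr//= addrA mulrDl IH /om.
have -> : pi * (m%:R + 2^-1) * t = pi * m.+1%:R * t - pi * t / 2 by rewrite -natr1; field.
have -> : pi * (m.+1%:R + 2^-1) * t = pi * m.+1%:R * t + pi * t / 2 by ring.
rewrite sinB sinD; ring.
Qed.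

Let der_r m t : is_derive t 1 (r m) (2^-1 + \sum_(0 <= j < m) cos (pi * j.+1%:R * t)).
Proof.
have h : is_derive t 1 (fun u : R => \sum_(0 <= j < m) sin (pi * j.+1%:R * u) / (pi * j.+1%:R))
    (\sum_(0 <= j < m) cos (pi * j.+1%:R * t)).
  apply: (is_derive_psum (F := fun j u => sin (pi * j.+1%:R * u) / (pi * j.+1%:R))
    (dF := fun j u => cos (pi * j.+1%:R * u))) => j.
  move: (pi * j.+1%:R) (pik0 j) => a a0.
  by apply: is_derive_eq; rewrite /GRing.scale/=; field.
by rewrite /r; apply: is_derive_eq; rewrite /GRing.scale/=; field.
Qed.

Let sin_half t : 0 < t <= 1 -> 0 < sin (pi * t / 2).
Proof.
move=> /andP[t0 t1]; apply: sin_gt0_pi; rewrite divr_gt0 ?mulr_gt0 ?pi_gt0//=.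
rewrite ltr_pdivrMr// ltr_pM2l ?pi_gt0//; lra.
Qed.

Let dw t : R := - (pi / 4) * cos (pi * t / 2) / sin (pi * t / 2) ^+ 2.

Let der_w t : 0 < t <= 1 -> is_derive t 1 w (dw t).
Proof.
move=> /sin_half s0; have s1 : 2 * sin (pi * t / 2) != 0 by rewrite mulf_neq0// gt_eqF.
rewrite /w; apply: is_derive_eq; rewrite /GRing.scale/= /dw; field.
by rewrite gt_eqF.
Qed.

Let dw_le0 t : 0 < t <= 1 -> dw t <= 0.
Proof.
move=> t01; rewrite /dw mulNr mulNr oppr_le0 divr_ge0 ?sqr_ge0// mulr_ge0 ?divr_ge0 ?pi_ge0//.
apply: cos_ge0_pihalf; have := @pi_gt0 R; case/andP: t01 => ? ? ?.
by apply/andP; split; nra.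
Qed.

Let om_gt0 m : 0 < om m. Proof. by rewrite mulr_gt0 ?pi_gt0// ltr_wpDl. Qed.

(** Integration by parts without an integral. The derivative of [r m] is [sin (om m * t) * w t],
    which the added term cancels, leaving [(cos (om m * t) + s) * dw t / om m]. For [s = 1] and
    [s = -1] this has a constant sign, and monotonicity brackets [r m] between two multiples of
    [w t / om m]. *)
Let q (s : R) m t : R := r m t + (cos (om m * t) + s) * w t / om m.

Let der_q s m t : 0 < t <= 1 -> is_derive t 1 (q s m) ((cos (om m * t) + s) * dw t / om m).
Proof.
move=> t01; have h1 := der_r m t; have h2 := der_w t01; rewrite /q.
apply: is_derive_eq; rewrite /GRing.scale/=.
have -> : 2^-1 + \sum_(0 <= j < m) cos (pi * j.+1%:R * t) = sin (om m * t) * w t.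
  by rewrite -dirichlet /w mulfK// mulf_neq0// gt_eqF// sin_half.
by field; rewrite gt_eqF ?om_gt0.
Qed.

Let q1 s m : q s m 1 = s / 2 / om m.
Proof.
rewrite /q /r /w !mulr1 sin_pihalf mulr1 [X in X + _](_ : _ = 0); last first.
  rewrite [X in _ + X]big1 ?addr0 => [|j _]; first by field.
  by rewrite mulr1 -[X in sin X]add0r sinDpin sin0 mulr0 mul0r.
rewrite add0r (_ : cos (om m) = 0) ?add0r//.
by rewrite /om mulrDr addrC cosDpin cos_pihalf mulr0.
Qed.

Let r_bound m t : 0 < t <= 1 -> `|r m t| <= 2 * w t / om m.
Proof.
move=> t01; have o0 := om_gt0 m; have w0 : 0 < w t by rewrite invr_gt0 mulr_gt0// sin_half.
have sub u : u \in `[t, 1] -> 0 < u <= 1.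
  by rewrite in_itv/= => /andP[tu ->]; rewrite andbT (lt_le_trans _ tu)//; case/andP: t01.
have subo u : u \in `]t, 1[ -> 0 < u <= 1.
  by rewrite in_itv/= => /andP[tu u1]; rewrite (ltW u1) andbT (lt_trans _ tu)//; case/andP: t01.
have cq s : {within `[t, 1], continuous (q s m)}.
  apply: derivable_within_continuous => u /sub u01.
  by have [] := der_q s m u01.
have dq s u : u \in `]t, 1[ -> derivable (q s m) u 1.
  by move=> /subo u01; have [] := der_q s m u01.
have dqE s u : u \in `]t, 1[ -> derive1 (q s m) u = (cos (om m * u) + s) * dw u / om m.
  by move=> /subo u01; have h := der_q s m u01; rewrite derive1E; exact: (@derive_val _ _ _ _ _ _ _ h).
have tt : t \in `[t, 1] by rewrite in_itv/= lexx; case/andP: t01.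
have t1 : 1 \in `[t, 1] by rewrite in_itv/= lexx andbT; case/andP: t01.
have tle : t <= 1 by case/andP: t01.
have h1 : q 1 m 1 <= q 1 m t.
  apply: (@ler0_derive1_le _ (q 1 m) t 1 (dq 1) _ true false (cq 1) 1 t) => // u ut.
  rewrite dqE// ler_pdivrMr// mul0r; apply: mulr_ge0_le0; last exact/dw_le0/subo.
  by have := cos_geN1 (om m * u); lra.
have h2 : q (-1) m t <= q (-1) m 1.
  apply: (@ger0_derive1_le _ (q (-1) m) t 1 (dq (-1)) _ true false (cq (-1)) t 1) => // u ut.
  rewrite dqE// divr_ge0 ?(ltW o0)//; apply: mulr_le0; last exact/dw_le0/subo.
  by have := cos_le1 (om m * u); lra.
move: h1 h2; rewrite !q1 /q.
have c1 := cos_geN1 (om m * t); have c2 := cos_le1 (om m * t).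
have io : 0 < (om m)^-1 by rewrite invr_gt0.
move: (om m)^-1 (cos _) (r m t) (w t) io w0 c1 c2 => i c a b i0 b0 c1 c2 h1 h2.
have bi := mulr_ge0 (ltW b0) (ltW i0).
rewrite ler_norml; apply/andP; split; nra.
Qed.

Let e_diff m t : 0 < t <= 1 -> `|e m 1 - e m t| <= 2 * w t / om m.
Proof.
move=> t01; have /andP[t0 t1] := t01; have o0 := om_gt0 m.
have w0 : 0 < w t by rewrite invr_gt0 mulr_gt0// sin_half.
have b0 : 0 <= 2 * w t / om m by rewrite divr_ge0 ?(ltW o0)// mulr_ge0// ltW.
move: t1; rewrite le_eqVlt => /orP[/eqP t1E|t1]; first by rewrite {1}t1E subrr normr0.
have [|c cI ->] := MVT t1 (fun x _ => der_e m x).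
  by apply: derivable_within_continuous => u _; have [] := der_e m u.
have c01 : 0 < c <= 1.
  by move: cI; rewrite in_itv/= => /andP[? ?]; apply/andP; split; lra.
rewrite normrM (@ger0_norm _ (1 - t)); last by lra.
apply: (@le_trans _ _ `|r m c|); first by rewrite ler_piMr//; lra.
apply: (le_trans (r_bound m c01)); rewrite ler_pM2r ?invr_gt0// ler_pM2l//.
rewrite /w lef_pV2 ?posrE ?mulr_gt0 ?sin_half// ler_pM2l//.
move: cI; rewrite in_itv/= => /andP[tc c1].
have p0 := @pi_gt0 R.
by rewrite ltW// ltr_sin ?in_itv/=; [nra|apply/andP; split; nra|apply/andP; split; nra].
Qed.

Let D t : R := bern t - limn (series (lcos t)).

Let cvg_e t : e m t @[m --> \oo] --> D t.
Proof. by apply: cvgB; [exact: cvg_cst|exact: is_cvg_lcos]. Qed.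

Let cvg_iom : (om m)^-1 @[m --> \oo] --> (0 : R).
Proof.
have h := @cvg_harmonic R.
apply: (@squeeze_cvgr _ _ _ _ (cst 0) (@harmonic R)) => //; last exact: cvg_cst.
near=> m; rewrite /= invr_ge0 (ltW (om_gt0 m))/= /harmonic lef_pV2 ?posrE//.
have p2 : 0 <= pi - 2 :> R by rewrite subr_ge0 pi_ge2.
have m0 : 0 <= m%:R :> R by [].
have m2 : 0 <= m%:R + 2^-1 :> R by lra.
by have := mulr_ge0 p2 m2; rewrite /om -(natr1 m); lra.
Unshelve. all: by end_near. Qed.

Let D_const t : 0 < t <= 1 -> D 1 = D t.
Proof.
move=> t01; apply/eqP; rewrite -subr_eq0 -normr_le0.
have c1 : `|e m 1 - e m t| @[m --> \oo] --> `|D 1 - D t|.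
  by apply: cvg_norm; apply: cvgB; exact: cvg_e.
have c2 : 2 * w t / om m @[m --> \oo] --> 2 * w t * 0 by apply: cvgM; [exact: cvg_cst|exact: cvg_iom].
rewrite mulr0 in c2.
rewrite -(cvg_lim _ c1)// -[leRHS](cvg_lim _ c2)//; apply: ler_lim.
- by apply/cvg_ex; eexists; exact: c1.
- by apply/cvg_ex; eexists; exact: c2.
- by apply: nearW => m; exact: e_diff.
Qed.

Let D_dup t : D t = 2 * (D (t / 2) + D (t / 2 + 1)).
Proof.
have c1 : series (lcos t) m @[m --> \oo] --> limn (series (lcos t)) by exact: is_cvg_lcos.
have c2 u : series (lcos u) (2 * m)%N @[m --> \oo] --> limn (series (lcos u)).
  have h : (2 * m)%N @[m --> \oo] --> \oo.
    by apply/cvgnyPge => A; near=> m; rewrite (@leq_trans m)// ?leq_pmull//; near: m; exact: nbhs_infty_ge.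
  exact: (cvg_comp _ _ h (@is_cvg_lcos u)).
have c3 : series (lcos (t / 2)) (2 * m)%N + series (lcos (t / 2 + 1)) (2 * m)%N @[m --> \oo] -->
   limn (series (lcos (t / 2))) + limn (series (lcos (t / 2 + 1))) by exact: cvgD.
have c4 : 2^-1 * series (lcos t) m @[m --> \oo] --> 2^-1 * limn (series (lcos t)).
  by apply: cvgM => //; exact: cvg_cst.
have : limn (series (lcos (t / 2))) + limn (series (lcos (t / 2 + 1))) = 2^-1 * limn (series (lcos t)).
  have c5 : 2^-1 * series (lcos t) m @[m --> \oo] -->
     limn (series (lcos (t / 2))) + limn (series (lcos (t / 2 + 1))).
    by have := c3; under eq_fun do rewrite lcos_dup.
  by rewrite -(cvg_lim _ c5)// -(cvg_lim _ c4).
rewrite /D /bern => h; lra.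
Unshelve. all: by end_near. Qed.

Let D_sym t : D (2 - t) = D t.
Proof.
rewrite /D (_ : lcos (2 - t) = lcos t); last by apply/funext => j; exact: lcos_sym.
by congr (_ - _); rewrite /bern; field.
Qed.

Let D0 t : 0 <= t <= 2 -> D t = 0.
Proof.
have k0 : D 1 = 0.
  (* Constancy and symmetry turn duplication at 1 into [D 1 = 4 * D 1]; duplication at 0 then gives
     [D 0 = 2 * D 0]. *)
  have h := D_dup 1; have h1 : D 1 = D (1 / 2) by apply: D_const; lra.
  have h2 : D (1 / 2 + 1) = D (1 / 2) by rewrite -(D_sym (1 / 2)); congr D; field.
  by move: h; rewrite h2 -h1; lra.
have z0 : D 0 = 0.
  by have := D_dup 0; rewrite mul0r add0r k0; lra.
have h01 u : 0 <= u <= 1 -> D u = 0.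
  move=> /andP[]; rewrite le_eqVlt => /orP[/eqP <-//|u0 u1].
  by rewrite -(@D_const u) ?u0.
move=> /andP[t0 t2]; have [t1|t1] := leP t 1; first by rewrite h01// t0.
by rewrite -D_sym h01//; lra.
Qed.

Lemma cvg_lcos t : 0 <= t <= 2 -> series (lcos t) @ \oo --> 6^-1 - t / 2 + t ^+ 2 / 4.
Proof.
move=> t02; have := D0 t02; rewrite /D /bern => /eqP; rewrite subr_eq0 => /eqP ->.
exact: is_cvg_lcos.
Qed.

End bernoulli.

(** * The cosine system *)

Section cosine_system.
Context {R : realType}.
Local Notation mu := (@lebesgue_measure R).
Local Notation U := (@unit_oi R).
Local Notation E := (Rintegral (@leb R) U).
Local Notation I f := (mu.-integrable U (EFin \o f)).
Implicit Types (f g : R -> R) (c : nat -> R) (a b t x : R) (m j k : nat).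

Lemma unit_integrableD f g : I f -> I g -> I (fun x => f x + g x).
Proof. by move=> h1 h2; exact: (integrableD measurable_unit_oi h1 h2). Qed.

Lemma unit_integrableZ a f : I f -> I (fun x => a * f x).
Proof. by move=> h1; exact: (integrableZl measurable_unit_oi a h1). Qed.

Lemma unit_integrable_sum m (F : nat -> R -> R) : (forall j, I (F j)) -> I (fun x => \sum_(j < m) F j x).
Proof.
move=> h; elim: m => [|m IH].
  under eq_fun do rewrite big_ord0; exact: (integrable0 mu).
by under eq_fun do rewrite big_ord_recr/=; exact: unit_integrableD.
Qed.

Lemma unit_RintegralD f g : I f -> I g -> E (fun x => f x + g x) = E f + E g.
Proof. by move=> h1 h2; rewrite RintegralD//; exact: measurable_unit_oi. Qed.

Lemma unit_RintegralZ a f : I f -> E (fun x => a * f x) = a * E f.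
Proof. by move=> h1; rewrite RintegralZl//; exact: measurable_unit_oi. Qed.

Lemma unit_Rintegral_sum m (F : nat -> R -> R) : (forall j, I (F j)) ->
  E (fun x => \sum_(j < m) F j x) = \sum_(j < m) E (F j).
Proof.
move=> h; elim: m => [|m IH].
  under eq_fun do rewrite big_ord0; rewrite big_ord0.
  by rewrite /Rintegral integral0.
under eq_fun do rewrite big_ord_recr/=.
by rewrite big_ord_recr/= -IH unit_RintegralD//; exact: unit_integrable_sum.
Qed.

Lemma ftc_seg a f F : a < 1 -> (forall x, is_derive x 1 F (f x)) -> continuous f ->
  fine (\int[mu]_(x in `]a, 1%R[) (f x)%:E)%E = F 1 - F a.
Proof.
move=> a1 dF cf.
rewrite -(@integral_itv_bndoo _ a 1 _ true false); last first.
  by apply/measurable_EFinP; apply: measurable_funTS; exact: continuous_measurable_fun.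
rewrite (@continuous_FTC2 _ f F a 1)//.
- by apply: continuous_subspaceT.
- split => [x _| |].
  + by have [] := dF x.
  + by apply: cvg_at_right_filter; apply: differentiable_continuous; apply/derivable1_diffP; have [] := dF a.
  + by apply: cvg_at_left_filter; apply: differentiable_continuous; apply/derivable1_diffP; have [] := dF 1.
- by move=> x _; have h := dF x; rewrite derive1E; exact: (@derive_val _ _ _ _ _ _ _ h).
Qed.

Lemma ftc_unit f F : (forall x, is_derive x 1 F (f x)) -> continuous f -> E f = F 1 - F 0.
Proof. by move=> dF cf; exact: ftc_seg. Qed.

Definition ge_ind a x : R := (a <= x)%R%:R.

Lemma measurable_ge_ind a : measurable_fun setT (ge_ind a).
Proof.
rewrite (_ : ge_ind a = \1_`[a, +oo[); first exact: measurable_indic.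
by apply/funext => x; rewrite indicE mem_setE in_itv/= andbT.
Qed.

Lemma ftc_unit_ge a f F : 0 < a < 1 -> (forall x, is_derive x 1 F (f x)) -> continuous f ->
  E (fun x => ge_ind a x * f x) = F 1 - F a.
Proof.
move=> /andP[a0 a1] dF cf; rewrite -(ftc_seg a1 dF cf) /Rintegral; congr fine.
rewrite -(@integral_itv_bndoo _ a 1 _ true true); last first.
  by apply/measurable_EFinP; apply: measurable_funTS; exact: continuous_measurable_fun.
rewrite /leb /unit_oi [LHS]integral_mkcond [RHS]integral_mkcond; apply: eq_integral => x _.
rewrite !patchE !mem_setE !in_itv/= /ge_ind.
have [ax|xa] := leP a x; last by rewrite mul0r if_same.
by rewrite (lt_le_trans a0 ax)/= mul1r.
Qed.

Lemma continuous_cosM a : continuous (fun x : R => cos (a * x)).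
Proof.
by move=> x; apply: continuous_comp; [apply: cvgM; [exact: cvg_cst|exact: cvg_id]|exact: continuous_cos].
Qed.

Lemma phi_continuous j : continuous (@phi R j).
Proof. by move=> x; apply: cvgM; [exact: cvg_cst|exact: continuous_cosM]. Qed.

Lemma measurable_phi j : measurable_fun setT (@phi R j).
Proof. by apply: continuous_measurable_fun; exact: phi_continuous. Qed.

Lemma phi_sqr_le j x : phi j x ^+ 2 <= 2.
Proof.
by rewrite exprMn sqr_sqrtr// ger_pMr// -(@real_normK _ (cos _)) ?num_real.
Qed.

Lemma phi_le j x : `|phi j x| <= 2.
Proof.
rewrite -(@ler_pXn2r _ 2)// ?nnegrE// real_normK ?num_real//.
by apply: (le_trans (phi_sqr_le j x)); lra.
Qed.

Lemma phi_integrable j : I (phi j).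
Proof. by apply: (@bounded_integrable_unit _ _ 2) => [|x _]; [by apply: measurable_funTS; exact: measurable_phi|exact: phi_le]. Qed.

Lemma Rintegral_cos k : (0 < k)%N -> E (fun x => cos (pi * k%:R * x)) = 0.
Proof.
case: k => // k _; have a0 : pi * k.+1%:R != 0 :> R by rewrite mulf_neq0// gt_eqF// pi_gt0.
have dF x : is_derive x 1 (fun x => sin (pi * k.+1%:R * x) / (pi * k.+1%:R)) (cos (pi * k.+1%:R * x)).
  move: (pi * k.+1%:R) a0 => a a0.
  by apply: is_derive_eq; rewrite /GRing.scale/=; field.
rewrite (ftc_unit dF (@continuous_cosM _)) mulr1 mulr0 sin0.
by rewrite -[X in sin X]add0r sinDpin sin0 mulr0 !mul0r subrr.
Qed.

Lemma cos_integrable a : I (fun x => cos (a * x)).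
Proof.
apply: (@bounded_integrable_unit _ _ 1) => [|x _]; last exact: cos_max.
by apply: measurable_funTS; apply: continuous_measurable_fun; exact: continuous_cosM.
Qed.

Lemma phiM j k x : (k <= j)%N -> phi j x * phi k x = cos (pi * (j - k)%N%:R * x) + cos (pi * (j + k)%N%:R * x).
Proof.
move=> kj; rewrite /phi natrB// natrD.
have -> : pi * (j%:R - k%:R) * x = pi * j%:R * x - pi * k%:R * x :> R by ring.
have -> : pi * (j%:R + k%:R) * x = pi * j%:R * x + pi * k%:R * x :> R by ring.
move: (pi * j%:R * x) (pi * k%:R * x) => a b.
rewrite cosB cosD mulrACA -expr2 sqr_sqrtr//; ring.
Qed.

Lemma Rintegral_cst a : E (fun=> a) = a.
Proof.
have dF x : is_derive x 1 (fun x : R => a * x) a.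
  by apply: is_derive_eq; rewrite /GRing.scale/=; ring.
by rewrite (ftc_unit dF) ?mulr1 ?mulr0 ?subr0// => x; exact: cvg_cst.
Qed.

Lemma phi_orthonormal j k : (0 < j)%N -> (0 < k)%N -> E (fun x => phi j x * phi k x) = (j == k)%:R.
Proof.
wlog kj : j k / (k <= j)%N.
  move=> h j0 k0; have [kj|jk] := leqP k j; first exact: h.
  rewrite eq_sym -(h k j (ltnW jk) k0 j0); congr (Rintegral _ _ _).
  by apply/funext => x; rewrite mulrC.
move=> j0 k0; under eq_fun do rewrite phiM//.
rewrite unit_RintegralD; [|exact: cos_integrable|exact: cos_integrable].
rewrite (Rintegral_cos (ltn_addl _ k0)) addr0.
have [->|jk] := eqVneq j k.
  by rewrite subnn mulr0; under eq_fun do rewrite mul0r cos0; rewrite Rintegral_cst.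
by rewrite Rintegral_cos// subn_gt0 ltn_neqAle eq_sym jk.
Qed.

Lemma Rintegral_phi j : (0 < j)%N -> E (phi j) = 0.
Proof.
by move=> j0; rewrite /phi unit_RintegralZ ?Rintegral_cos ?mulr0//; exact: cos_integrable.
Qed.

(** Free of the mean-zero condition of [L2_0], since indicators and the identity function also enter
    inner products. *)
Definition L2 f := measurable_fun U f /\ I (fun x => f x ^+ 2).

Lemma L2_0_L2 f : L2_0 f -> L2 f.
Proof. by case=> mf f2 _; split => //; exact: sqr_integrable. Qed.

Lemma L2_bounded f a : measurable_fun U f -> (forall x, U x -> `|f x| <= a) -> L2 f.
Proof.
move=> mf fa; split => //; apply: (@bounded_integrable_unit _ _ (a ^+ 2)) => [|x Ux].
  exact: measurable_funX.
by rewrite normrX lerXn2r ?nnegrE ?fa// (le_trans _ (fa _ Ux)).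
Qed.

Lemma L2_phi j : L2 (phi j).
Proof. by apply: (@L2_bounded _ 2) => [|x _]; [by apply: measurable_funTS; exact: measurable_phi|exact: phi_le]. Qed.

Lemma L2_mul f g : L2 f -> L2 g -> I (fun x => f x * g x).
Proof. by move=> [mf f2] [mg g2]; exact: L2M_integrable. Qed.

Lemma integrable_L2 f : L2 f -> I f.
Proof.
move=> [mf f2]; apply: L2_integrable => //.
have /integrableP[_] := f2; by under eq_integral do rewrite /= ger0_norm ?sqr_ge0//.
Qed.

Lemma L2_comb a b f g : L2 f -> L2 g -> L2 (fun x => a * f x + b * g x).
Proof.
move=> hf hg; have [mf f2] := hf; have [mg g2] := hg; split.
  by apply: measurable_funD; apply: measurable_funM.
rewrite (_ : (fun x => _) = fun x => a ^+ 2 * f x ^+ 2 + (2 * a * b * (f x * g x) + b ^+ 2 * g x ^+ 2)); last first.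
  by apply/funext => x; ring.
by apply: unit_integrableD; [|apply: unit_integrableD]; apply: unit_integrableZ => //; exact: L2_mul.
Qed.

Lemma Rintegral_comb_sqr a b f g : L2 f -> L2 g ->
  E (fun x => (a * f x + b * g x) ^+ 2) =
  a ^+ 2 * E (fun x => f x ^+ 2) + 2 * a * b * E (fun x => f x * g x) + b ^+ 2 * E (fun x => g x ^+ 2).
Proof.
move=> hf hg; have [mf f2] := hf; have [mg g2] := hg; have fg := L2_mul hf hg.
rewrite (_ : (fun x => _) = fun x => a ^+ 2 * f x ^+ 2 + (2 * a * b * (f x * g x) + b ^+ 2 * g x ^+ 2)); last first.
  by apply/funext => x; ring.
rewrite unit_RintegralD; [|exact: unit_integrableZ|apply: unit_integrableD; exact: unit_integrableZ].
rewrite unit_RintegralD; [|exact: unit_integrableZ|exact: unit_integrableZ].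
by rewrite !unit_RintegralZ// addrA.
Qed.

Lemma Rintegral_sqr_ge0 f : 0 <= E (fun x => f x ^+ 2).
Proof. by apply: Rintegral_ge0 => x _; exact: sqr_ge0. Qed.

Lemma cauchy_schwarz f g : L2 f -> L2 g ->
  E (fun x => f x * g x) ^+ 2 <= E (fun x => f x ^+ 2) * E (fun x => g x ^+ 2).
Proof.
move=> hf hg; have A0 := Rintegral_sqr_ge0 f; have B0 := Rintegral_sqr_ge0 g.
have h a b : 0 <= a ^+ 2 * E (fun x => f x ^+ 2) + 2 * a * b * E (fun x => f x * g x) + b ^+ 2 * E (fun x => g x ^+ 2).
  by rewrite -Rintegral_comb_sqr//; exact: Rintegral_sqr_ge0.
move: (E _) (E _) (E _) A0 B0 h => C A B B0 A0 h.
have [B00|Bn] := eqVneq B 0.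
  rewrite B00 mul0r; have [->|C0] := eqVneq C 0; first by rewrite expr0n.
  have := h (- (A + 1) / C) 1; rewrite B00 mulr0 add0r expr1n mul1r mulr1.
  by rewrite (_ : 2 * (- (A + 1) / C) * C = - 2 * (A + 1)); [lra|field].
have Bp : 0 < B by rewrite lt_neqAle eq_sym Bn.
have := h (- C) B; rewrite sqrrN => h1.
have : 0 <= B * (B * A - C ^+ 2) by rewrite (le_trans h1)// le_eqVlt; apply/orP; left; apply/eqP; ring.
by rewrite pmulr_rge0// subr_ge0.
Qed.

Lemma L2norm_sqr f : L2norm f ^+ 2 = E (fun x => f x ^+ 2).
Proof. by rewrite /L2norm sqr_sqrtr//; exact: Rintegral_sqr_ge0. Qed.

Definition tpoly c m x : R := \sum_(j < m) c j * phi j.+1 x.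

Lemma tpolyS c m : tpoly c m.+1 = (fun x => 1 * tpoly c m x + c m * phi m.+1 x).
Proof. by apply/funext => x; rewrite /tpoly big_ord_recr/= mul1r. Qed.

Lemma measurable_tpoly c m : measurable_fun setT (tpoly c m).
Proof. by apply: measurable_sum => j; apply: measurable_funM => //; exact: measurable_phi. Qed.

Lemma L2_tpoly c m : L2 (tpoly c m).
Proof.
elim: m => [|m IH]; last by rewrite tpolyS; apply: L2_comb => //; exact: L2_phi.
apply: (@L2_bounded _ 0) => [|x _]; first by apply: measurable_funTS; exact: measurable_tpoly.
by rewrite /tpoly big_ord0 normr0.
Qed.

Lemma Rintegral_M_tpoly f c m : L2 f ->
  E (fun x => f x * tpoly c m x) = \sum_(j < m) c j * coef f j.+1.
Proof.
move=> hf; under eq_fun do rewrite /tpoly mulr_sumr.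
have h j : I (fun x => f x * (c j * phi j.+1 x)).
  under eq_fun do rewrite mulrCA; apply: unit_integrableZ; apply: L2_mul => //; exact: L2_phi.
rewrite (unit_Rintegral_sum _ h); apply: eq_bigr => j _.
under eq_fun do rewrite mulrCA.
rewrite unit_RintegralZ//; apply: L2_mul => //; exact: L2_phi.
Qed.

Lemma coef_phi j k : coef (@phi R j.+1) k.+1 = (j == k)%:R.
Proof. by rewrite /coef phi_orthonormal// eqSS. Qed.

Lemma coef_comb a b f g j : L2 f -> L2 g ->
  coef (fun x => a * f x + b * g x) j = a * coef f j + b * coef g j.
Proof.
move=> hf hg; have hp := L2_phi j; rewrite /coef.
under eq_fun do rewrite mulrDl -!mulrA.
by rewrite unit_RintegralD ?unit_RintegralZ//; try apply: unit_integrableZ; exact: L2_mul.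
Qed.

Lemma coef_tpoly c m k : coef (tpoly c m) k.+1 = if (k < m)%N then c k else 0.
Proof.
elim: m => [|m IH].
  rewrite /coef; under eq_fun do rewrite /tpoly big_ord0 mul0r.
  by rewrite Rintegral_cst.
rewrite tpolyS coef_comb ?IH ?coef_phi; [|exact: L2_tpoly|exact: L2_phi].
rewrite ltnS mul1r; case: ltngtP => // [km|mk|->]; rewrite ?mulr0 ?mulr1 ?addr0 ?add0r//.
Qed.

Lemma Rintegral_tpoly c m : E (tpoly c m) = 0.
Proof.
elim: m => [|m IH]; first by rewrite -[RHS](Rintegral_cst 0); congr (Rintegral _ _ _); apply/funext => x; rewrite /tpoly big_ord0.
have h1 := phi_integrable m.+1; have h2 := integrable_L2 (L2_tpoly c m).
rewrite tpolyS unit_RintegralD; [|exact: unit_integrableZ|exact: unit_integrableZ].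
by rewrite (unit_RintegralZ _ h1) (unit_RintegralZ _ h2) IH Rintegral_phi// !mulr0 addr0.
Qed.

Lemma L2_0_comb a b f g : L2_0 f -> L2_0 g -> L2_0 (fun x => a * f x + b * g x).
Proof.
move=> hf hg; have f2 := L2_0_L2 hf; have g2 := L2_0_L2 hg.
have [mh h2] := L2_comb a b f2 g2; split => //.
  have /integrableP[_] := h2; by under eq_integral do rewrite /= ger0_norm ?sqr_ge0//.
have [_ _ f0] := hf; have [_ _ g0] := hg.
by rewrite unit_RintegralD ?unit_RintegralZ ?f0 ?g0 ?mulr0 ?addr0//; try apply: unit_integrableZ; exact: integrable_L2.
Qed.

Lemma L2_0_tpoly c m : L2_0 (tpoly c m).
Proof.
have [mh h2] := L2_tpoly c m; split => //; last exact: Rintegral_tpoly.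
have /integrableP[_] := h2; by under eq_integral do rewrite /= ger0_norm ?sqr_ge0//.
Qed.

Lemma Rintegral_tpoly_sqr c m : E (fun x => tpoly c m x ^+ 2) = \sum_(j < m) c j ^+ 2.
Proof.
under eq_fun do rewrite expr2.
rewrite Rintegral_M_tpoly; last exact: L2_tpoly.
by apply: eq_bigr => j _; rewrite coef_tpoly ltn_ord expr2.
Qed.

Lemma residual_sqr f m : L2 f ->
  E (fun x => (f x - tpoly (fun j => coef f j.+1) m x) ^+ 2) =
  E (fun x => f x ^+ 2) - \sum_(j < m) coef f j.+1 ^+ 2.
Proof.
move=> hf; have := Rintegral_comb_sqr 1 (-1) hf (L2_tpoly (fun j => coef f j.+1) m).
rewrite Rintegral_tpoly_sqr Rintegral_M_tpoly//.
under eq_fun do rewrite mul1r mulN1r; move=> ->.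
rewrite (eq_bigr (fun j : 'I_m => coef f j.+1 ^+ 2)); first by ring.
by move=> j _; rewrite expr2.
Qed.

Lemma bessel f m : L2 f -> \sum_(j < m) coef f j.+1 ^+ 2 <= E (fun x => f x ^+ 2).
Proof. by move=> hf; rewrite -subr_ge0 -residual_sqr// Rintegral_sqr_ge0. Qed.

End cosine_system.

(** * The statistic as a weighted sum of squared coefficients *)

Section cvm_identity.
Context {R : realType}.
Local Notation mu := (@lebesgue_measure R).
Local Notation U := (@unit_oi R).
Local Notation E := (Rintegral (@leb R) U).
Local Notation I f := (mu.-integrable U (EFin \o f)).
Implicit Types (f g : R -> R) (c : nat -> R) (a b t x : R) (m j k : nat).

Lemma phi2E j a b : phi j a * phi j b = cos (pi * j%:R * (a + b)) + cos (pi * j%:R * `|a - b|).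
Proof.
have -> : cos (pi * j%:R * `|a - b|) = cos (pi * j%:R * (a - b)).
  by rewrite -[RHS]cos_norm -[LHS]cos_norm !normrM normr_id.
rewrite /phi mulrBr mulrDr; move: (pi * j%:R * a) (pi * j%:R * b) => p q.
rewrite cosB cosD mulrACA -expr2 sqr_sqrtr//; ring.
Qed.

(** The inner product on (0,1) of the centred steps [cvm_dev a] and [cvm_dev b], as
    [Rintegral_cvm_dev] shows. The statistic is a double sum of this kernel over the sample. *)
Definition cvm_kernel a b : R := 3^-1 + (a ^+ 2 + b ^+ 2) / 2 - Num.max a b.

(** The Mercer expansion of the kernel: a product of cosines splits into cosines at [a + b] and at
    the distance of [a] and [b], both in the range [0,2] of the closed form. *)
Lemma cvg_cvm_kernel a b : 0 <= a <= 1 -> 0 <= b <= 1 ->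
  series (fun j => lam j * (phi j.+1 a * phi j.+1 b)) @ \oo --> cvm_kernel a b.
Proof.
move=> /andP[a0 a1] /andP[b0 b1].
have ab0 : 0 <= `|a - b| <= 2 by rewrite normr_ge0/= ler_norml; apply/andP; split; lra.
have h1 := @cvg_lcos R (a + b) _; have h2 := @cvg_lcos R `|a - b| ab0.
have -> : series (fun j => lam j * (phi j.+1 a * phi j.+1 b)) =
  (fun m => series (lcos (a + b)) m + series (lcos `|a - b|) m).
  apply/funext => m; rewrite /series/= -big_split/=; apply: eq_bigr => j _.
  by rewrite phi2E mulrDr.
have -> : cvm_kernel a b = (6^-1 - (a + b) / 2 + (a + b) ^+ 2 / 4) + (6^-1 - `|a - b| / 2 + `|a - b| ^+ 2 / 4).
  rewrite /cvm_kernel real_normK ?num_real//.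
  by have [ab|ab] := leP a b; [rewrite ler0_norm|rewrite gtr0_norm]; try lra; field.
by apply: cvgD => //; apply: h1; lra.
Qed.

Lemma Rintegral_ge_ind a b f F : U a -> U b -> (forall x, is_derive x 1 F (f x)) -> continuous f ->
  E (fun x => ge_ind a x * ge_ind b x * f x) = F 1 - F (Num.max a b).
Proof.
move=> Ua Ub dF cf; rewrite -(@ftc_unit_ge _ (Num.max a b) f F)//.
  congr (Rintegral _ _ _); apply/funext => x; congr (_ * _).
  by rewrite /ge_ind ge_max; case: (a <= x); rewrite ?mul0r ?mul1r.
by rewrite /Num.max; case: ifP => _; [move: Ub|move: Ua]; rewrite /unit_oi/= in_itv.
Qed.

Definition cvm_dev a x : R := ge_ind a x - x.

Lemma measurable_cvm_dev a : measurable_fun setT (cvm_dev a).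
Proof. by apply: measurable_funB => //; exact: measurable_ge_ind. Qed.

Lemma L2_cvm_dev a : L2 (cvm_dev a).
Proof.
apply: (@L2_bounded _ _ 1) => [|x]; first by apply: measurable_funTS; exact: measurable_cvm_dev.
rewrite /unit_oi/= in_itv/= /cvm_dev /ge_ind => /andP[x0 x1].
by rewrite ler_norml; case: (a <= x); rewrite ?mulr1n ?mulr0n; apply/andP; split; lra.
Qed.

Lemma L2_ge_ind a : L2 (ge_ind a).
Proof.
apply: (@L2_bounded _ _ 1) => [|x _]; first by apply: measurable_funTS; exact: measurable_ge_ind.
by rewrite /ge_ind; case: (a <= x); rewrite ?normr1 ?normr0.
Qed.

Lemma L2_id : L2 (@id R).
Proof.
apply: (@L2_bounded _ _ 1) => [|x]; first by apply: measurable_funTS.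
by rewrite /unit_oi/= in_itv/= => /andP[x0 x1]; rewrite ler_norml; apply/andP; split; lra.
Qed.

Lemma Rintegral_cvm_dev a b : U a -> U b ->
  E (fun x => cvm_dev a x * cvm_dev b x) = cvm_kernel a b.
Proof.
move=> Ua Ub; have [ga gb] := (L2_ge_ind a, L2_ge_ind b); have gi := L2_id.
rewrite (_ : (fun x => _) = (fun x => (ge_ind a x * ge_ind b x + (-1) * (ge_ind a x * x)) +
   ((-1) * (ge_ind b x * x) + x * x))); last by apply/funext => x; rewrite /cvm_dev; ring.
have i1 := L2_mul ga gb; have i2 := L2_mul ga gi; have i3 := L2_mul gb gi; have i4 := L2_mul gi gi.
have i2' := unit_integrableZ (-1) i2; have i3' := unit_integrableZ (-1) i3.
rewrite (unit_RintegralD (unit_integrableD i1 i2') (unit_integrableD i3' i4)).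
rewrite (unit_RintegralD i1 i2') (unit_RintegralD i3' i4).
rewrite (unit_RintegralZ (-1) i2) (unit_RintegralZ (-1) i3).
have d1 x : is_derive x 1 (@id R) (1 : R) by exact: is_derive_id.
have d2 x : is_derive x 1 (fun x : R => x ^+ 2 / 2) x.
  by apply: is_derive_eq; rewrite /GRing.scale/=; field.
have d3 x : is_derive x 1 (fun x : R => x ^+ 3 / 3) (x * x).
  by apply: is_derive_eq; rewrite /GRing.scale/=; field.
have c1 : continuous (fun _ : R => 1 : R) by move=> x; exact: cvg_cst.
have c2 : continuous (fun x : R => x) by move=> x; exact: cvg_id.
have c3 : continuous (fun x : R => x * x) by move=> x; apply: cvgM; exact: cvg_id.
have ab a' : U a' -> 0 < a' < 1 by rewrite /unit_oi/= in_itv.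
rewrite (ftc_unit_ge (ab _ Ua) d2 c2) (ftc_unit_ge (ab _ Ub) d2 c2) (ftc_unit d3 c3).
have := Rintegral_ge_ind Ua Ub d1 c1; under eq_fun do rewrite mulr1.
by move=> ->; rewrite /cvm_kernel; field.
Qed.

Lemma unit_Rintegral_seq (xs : seq R) (F : R -> R -> R) : (forall y, I (F y)) ->
  I (fun x => \sum_(y <- xs) F y x) /\ E (fun x => \sum_(y <- xs) F y x) = \sum_(y <- xs) E (F y).
Proof.
move=> h; elim: xs => [|y xs [IH1 IH2]].
  under eq_fun do rewrite big_nil; rewrite big_nil; split; first exact: (integrable0 mu).
  by rewrite Rintegral_cst.
under eq_fun do rewrite big_cons; rewrite big_cons -IH2; split; first exact: unit_integrableD.
by rewrite unit_RintegralD.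
Qed.

Lemma cvm_stat_kernel (xs : seq R) : (forall x, x \in xs -> U x) ->
  cvm_stat xs = (size xs)%:R^-1 * \sum_(x <- xs) \sum_(y <- xs) cvm_kernel x y.
Proof.
move=> xsU; case: xs xsU => [|x0 xs0]; first by rewrite /cvm_stat/= !mul0r big_nil mulr0.
set xs := x0 :: xs0 => xsU; set n : R := (size xs)%:R.
have n0 : n != 0 by rewrite /n pnatr_eq0.
have FE x : Fhat xs x - x = n^-1 * \sum_(y <- xs) cvm_dev y x.
  rewrite /Fhat -/n -sum1_count natr_sum /cvm_dev sumrB mulrBr; congr (_ - _).
    rewrite mulrC; congr (_ * _); rewrite big_mkcond/=; apply: eq_bigr => y _.
    by rewrite /ge_ind; case: ifP.
  by rewrite big_const_seq count_predT iter_addr_0 -[x *+ _]mulr_natl mulrA mulVf// mul1r.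
rewrite /cvm_stat -/n.
have h y z : I (fun x => cvm_dev y x * cvm_dev z x) by apply: L2_mul; exact: L2_cvm_dev.
rewrite (_ : (fun x => _) = (fun x => n^-1 ^+ 2 * \sum_(y <- xs) \sum_(z <- xs) cvm_dev y x * cvm_dev z x)); last first.
  apply/funext => x; rewrite FE exprMn; congr (_ * _).
  by rewrite expr2 mulr_suml; apply: eq_bigr => y _; rewrite mulr_sumr.
have h1 y : I (fun x => \sum_(z <- xs) cvm_dev y x * cvm_dev z x).
  exact: (unit_Rintegral_seq _ (h y)).1.
have [h2 e2] := unit_Rintegral_seq xs h1.
rewrite (unit_RintegralZ _ h2) e2 mulrA expr2 mulrA mulfV// mul1r; congr (_ * _).
rewrite [LHS]big_seq [RHS]big_seq; apply: eq_bigr => y yxs.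
rewrite (unit_Rintegral_seq xs (h y)).2 [LHS]big_seq [RHS]big_seq; apply: eq_bigr => z zxs.
by rewrite Rintegral_cvm_dev//; exact: xsU.
Qed.

Lemma cvg_seq_sum (T : eqType) (xs : seq T) (u : T -> nat -> R) (l : T -> R) :
  (forall y, y \in xs -> u y @ \oo --> l y) ->
  (fun m => \sum_(y <- xs) u y m) @ \oo --> \sum_(y <- xs) l y.
Proof.
elim: xs => [|y xs IH] h.
  by rewrite big_nil; under eq_fun do rewrite big_nil; exact: cvg_cst.
rewrite big_cons; under eq_fun do rewrite big_cons.
apply: cvgD; first by apply: h; rewrite mem_head.
by apply: IH => z zxs; apply: h; rewrite in_cons zxs orbT.
Qed.

Lemma cvg_nneseries (u : nat -> R) (l : R) : series u @ \oo --> l ->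
  (\sum_(j <oo) (u j)%:E = l%:E)%E.
Proof.
move=> h; apply/cvg_lim => //.
have : EFin \o series u @ \oo --> l%:E by apply: cvg_EFin => //; exact: nearW.
by apply: cvg_trans; apply: near_eq_cvg; apply: nearW => m /=; rewrite /series/= sumEFin.
Qed.

Lemma cvm_stat_series (xs : seq R) : (forall x, x \in xs -> U x) ->
  ((cvm_stat xs)%:E = \sum_(j <oo)
    (lam j * ((Num.sqrt (size xs)%:R)^-1 * \sum_(x <- xs) phi j.+1 x) ^+ 2)%:E)%E.
Proof.
move=> xsU; apply/esym/cvg_nneseries; rewrite cvm_stat_kernel//.
rewrite (_ : series _ = (fun m => (size xs)%:R^-1 * \sum_(x <- xs) \sum_(y <- xs)
   series (fun j => lam j * (phi j.+1 x * phi j.+1 y)) m)); last first.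
  apply/funext => m; rewrite /series/=.
  under [X in _ = _ * X]eq_bigr do rewrite exchange_big/=.
  rewrite exchange_big/= mulr_sumr; apply: eq_bigr => j _.
  rewrite exprMn exprVn sqr_sqrtr// mulrCA; congr (_ * _).
  by rewrite expr2 mulr_suml mulr_sumr; apply: eq_bigr => x _; rewrite !mulr_sumr.
have Ule x : U x -> 0 <= x <= 1 by rewrite /unit_oi/= in_itv/= => /andP[? ?]; apply/andP; split; exact: ltW.
apply: cvgM; first exact: cvg_cst.
apply: cvg_seq_sum => x xxs; apply: cvg_seq_sum => y yxs.
by apply: cvg_cvm_kernel; apply/Ule/xsU.
Qed.

End cvm_identity.

(** * Limits inferior and superior *)

Section limits.
Context {R : realType}.

Lemma limn_esup_le (u : nat -> \bar R) (x : \bar R) : (\forall n \near \oo, (u n <= x)%E) -> (limn_esup u <= x)%E.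
Proof.
move=> [N _ h]; rewrite limn_esup_lim; apply: lime_le; first exact: is_cvg_esups.
exists N => // n Nn; apply: ge_ereal_sup => _ [k /= nk <-]; apply: h => /=.
exact: leq_trans nk.
Qed.

Lemma limn_einf_ge (u : nat -> \bar R) (x : \bar R) : (\forall n \near \oo, (x <= u n)%E) -> (x <= limn_einf u)%E.
Proof.
move=> [N _ h]; rewrite limn_einf_lim; apply: lime_ge; first exact: is_cvg_einfs.
exists N => // n Nn; apply: le_ereal_inf_tmp => _ [k /= nk <-]; apply: h => /=.
exact: leq_trans nk.
Qed.

Lemma measurable_fun_limn_einf d (T : measurableType d) (D : set T) (f : nat -> T -> \bar R) :
  (forall n, measurable_fun D (f n)) -> measurable_fun D (fun x => limn_einf (f^~ x)).
Proof.
move=> mf; rewrite (_ : (fun x => _) = (fun x => - limn_esup ((fun n x => - f n x) ^~ x))%E).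
  apply: measurableT_comp => //; apply: measurable_fun_limn_esup => n.
  by apply: measurableT_comp => //; exact: mf.
apply/funext => x; rewrite -limn_einfN; congr limn_einf; apply/funext => n /=.
by rewrite oppeK.
Qed.

Lemma fatou_le d (T : measurableType d) (mu : measure T R) (D : set T) (f : nat -> T -> \bar R) (M : \bar R) :
  measurable D -> (forall n, measurable_fun D (f n)) -> (forall n x, D x -> (0 <= f n x)%E) ->
  (forall n, (\int[mu]_(x in D) f n x <= M)%E) -> (\int[mu]_(x in D) limn_einf (f^~ x) <= M)%E.
Proof.
move=> mD mf f0 fM; apply: (le_trans (fatou mu mD mf f0)).
by apply: (le_trans (limn_einf_sup _)); apply: limn_esup_le; exact: nearW.
Qed.

Lemma dist_cvg (u v : nat -> R) (l : R) : (forall m, `|u m - l| <= v m) -> v @ \oo --> (0 : R) ->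
  u @ \oo --> l.
Proof.
move=> uv v0; apply: (@squeeze_cvgr _ _ _ _ (fun m => l - v m) (fun m => l + v m)).
- by apply: nearW => m; have := uv m; rewrite ler_norml => /andP[? ?]; apply/andP; split; lra.
- by rewrite -[X in _ --> X]subr0; apply: cvgB => //; exact: cvg_cst.
- by rewrite -[X in _ --> X]addr0; apply: cvgD => //; exact: cvg_cst.
Qed.

End limits.

(** * Completeness of the cosine system *)

Section parseval.
Context {R : realType}.
Local Notation mu := (@lebesgue_measure R).
Local Notation U := (@unit_oi R).
Local Notation E := (Rintegral (@leb R) U).
Local Notation I f := (mu.-integrable U (EFin \o f)).
Implicit Types (f g : R -> R) (c : nat -> R) (a b t x : R) (m j k : nat).

Let pik k : R := pi * k.+1%:R.
Let pik0 k : 0 < pik k. Proof. by rewrite mulr_gt0 ?pi_gt0. Qed.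

Definition ge_coef a j : R := - (Num.sqrt 2 * sin (pik j * a) / pik j).

Lemma coef_ge_ind a j : U a -> coef (ge_ind a) j.+1 = ge_coef a j.
Proof.
move=> Ua; rewrite /coef.
have dF x : is_derive x 1 (fun x => Num.sqrt 2 * sin (pik j * x) / pik j) (phi j.+1 x).
  rewrite /phi -/(pik j); move: (pik j) (pik0 j) (Num.sqrt 2) => p p0 q.
  by apply: is_derive_eq; rewrite /GRing.scale/=; field; rewrite gt_eqF.
rewrite (ftc_unit_ge _ dF (@phi_continuous _ _)); last by move: Ua; rewrite /unit_oi/= in_itv.
by rewrite mulr1 /pik -[X in sin X]add0r sinDpin sin0 !mulr0 mul0r sub0r.
Qed.

(** The limit is the squared norm of the centred indicator, so this is equality in Bessel's
    inequality. It comes from the closed form at 0 and at [2 * a] through [2 sin^2 = 1 - cos]. *)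
Lemma cvg_ge_coef a : U a -> (fun m => \sum_(j < m) ge_coef a j ^+ 2) @ \oo --> a - a ^+ 2.
Proof.
rewrite /unit_oi/= in_itv/= => /andP[a0 a1].
have h1 := @cvg_lcos R 0 _; have h2 := @cvg_lcos R (2 * a) _.
rewrite (_ : (fun m => _) = (fun m => series (lcos 0) m - series (lcos (2 * a)) m)); last first.
  apply/funext => m; rewrite /series/= -sumrB big_mkord; apply: eq_bigr => j _.
  rewrite /ge_coef sqrrN /lcos mulr0 cos0 mulr1 !exprMn sqr_sqrtr// exprVn lamE -/(pik j).
  have -> : pik j * (2 * a) = (pik j * a) *+ 2 by rewrite -mulr_natr; ring.
  by rewrite cos_mulr2n cos2sin2 -mulr_natr; ring.
have -> : a - a ^+ 2 = (6^-1 - 0 / 2 + 0 ^+ 2 / 4) - (6^-1 - (2 * a) / 2 + (2 * a) ^+ 2 / 4) by field.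
by apply: cvgB; [apply: h1|apply: h2]; lra.
Qed.

(** By the previous equality the expansion of the centred indicator converges to it in norm;
    Cauchy-Schwarz carries this to inner products with [f]. *)
Lemma cvg_ge_ind_pairing f a : L2_0 f -> U a ->
  (fun m => \sum_(j < m) coef f j.+1 * ge_coef a j) @ \oo --> E (fun x => ge_ind a x * f x).
Proof.
move=> f0 Ua; have hf := L2_0_L2 f0; have [_ _ Ef] := f0.
have a01 : 0 < a < 1 by move: Ua; rewrite /unit_oi/= in_itv.
have gi := L2_ge_ind a.
have L1 : L2 (fun _ : R => 1 : R).
  by apply: (@L2_bounded _ _ 1) => [|x _]; [exact: measurable_cst|rewrite normr1].
(* The indicator minus its mean [1 - a]; neither the pairing with [f] nor the cosine coefficients
   see the constant. *)
pose u x := 1 * ge_ind a x + (- (1 - a)) * 1.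
have hu : L2 u by exact: L2_comb.
have d1 x : is_derive x 1 (@id R) (1 : R) by exact: is_derive_id.
have c1 : continuous (fun _ : R => 1 : R) by move=> x; exact: cvg_cst.
have Eg : E (fun x => ge_ind a x * 1) = 1 - a by rewrite (ftc_unit_ge a01 d1 c1).
have Eu2 : E (fun x => u x ^+ 2) = a - a ^+ 2.
  rewrite Rintegral_comb_sqr// Eg (Rintegral_cst (1 ^+ 2)).
  rewrite (_ : (fun x => ge_ind a x ^+ 2) = (fun x => ge_ind a x * 1)) ?Eg; first by ring.
  by apply/funext => x; rewrite /ge_ind; case: (a <= x); rewrite ?expr1n ?expr0n ?mulr1.
have cu j : coef u j.+1 = ge_coef a j.
  rewrite coef_comb// coef_ge_ind// mul1r [X in _ + _ * X](_ : _ = 0) ?mulr0 ?addr0//.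
  rewrite /coef (_ : (fun t => _) = phi j.+1); first by rewrite Rintegral_phi.
  by apply/funext => x; rewrite mul1r.
have Euf : E (fun x => u x * f x) = E (fun x => ge_ind a x * f x).
  rewrite (_ : (fun x => _) = (fun x => ge_ind a x * f x + (- (1 - a)) * f x)); last first.
    by apply/funext => x; rewrite /u; ring.
  rewrite unit_RintegralD; [|exact: L2_mul|apply: unit_integrableZ; exact: integrable_L2].
  by rewrite unit_RintegralZ ?Ef ?mulr0 ?addr0//; exact: integrable_L2.
pose r m x := 1 * u x + (-1) * tpoly (fun j => coef u j.+1) m x.
have hr m : L2 (r m) by apply: L2_comb => //; exact: L2_tpoly.
have Er m : E (fun x => r m x ^+ 2) = (a - a ^+ 2) - \sum_(j < m) ge_coef a j ^+ 2.
  rewrite -Eu2 (eq_bigr (fun j : 'I_m => coef u j.+1 ^+ 2)) => [|j _]; last by rewrite cu.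
  rewrite -residual_sqr//; congr (Rintegral _ _ _); apply/funext => x.
  by rewrite /r mul1r mulN1r.
have Erf m : E (fun x => r m x * f x) = E (fun x => ge_ind a x * f x) - \sum_(j < m) coef f j.+1 * ge_coef a j.
  rewrite -Euf (eq_bigr (fun j : 'I_m => coef u j.+1 * coef f j.+1)) => [|j _]; last by rewrite cu mulrC.
  rewrite -(Rintegral_M_tpoly (fun j => coef u j.+1) m hf).
  rewrite (_ : (fun x => _) = (fun x => u x * f x + (-1) * (f x * tpoly (fun j => coef u j.+1) m x))); last first.
    by apply/funext => x; rewrite /r; ring.
  have h2 := L2_mul hf (L2_tpoly (fun j => coef u j.+1) m).
  rewrite unit_RintegralD; [|exact: L2_mul|exact: unit_integrableZ].
  by rewrite unit_RintegralZ// mulN1r.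
pose M := E (fun x => f x ^+ 2).
have M0 : 0 <= M by exact: Rintegral_sqr_ge0.
pose w m : R := ((a - a ^+ 2) - \sum_(j < m) ge_coef a j ^+ 2) * M.
have cw : w @ \oo --> (0 : R).
  rewrite -[0 in X in _ --> X](mul0r M) -[X in X * M](subrr (a - a ^+ 2)); apply: cvgM; last exact: cvg_cst.
  by apply: cvgB; [exact: cvg_cst|exact: cvg_ge_coef].
have c0 : (fun m => Num.sqrt (w m)) @ \oo --> (0 : R).
  by rewrite -[X in _ --> X](@sqrtr0 R); exact: (cvg_comp _ _ cw (@sqrt_continuous _ _)).
apply: (dist_cvg _ c0) => m; rewrite distrC -Erf -sqrtr_sqr ler_wsqrtr// /w -Er.
exact: cauchy_schwarz.
Qed.

Lemma sin_abs_le x : 0 < x -> `|sin x| <= x.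
Proof.
move=> x0.
have [|c _] := MVT x0 (fun y _ => is_derive_sin y).
  by apply: continuous_subspaceT; exact: continuous_sin.
rewrite sin0 !subr0 => ->; rewrite normrM (gtr0_norm x0) ler_piMl ?(ltW x0)//.
exact: cos_max.
Qed.

Section parseval_le.
Variables (f : R -> R) (M : R).
Hypotheses (f0 : L2_0 f) (fM : forall m, \sum_(j < m) coef f j.+1 ^+ 2 <= M).

Let F x := Rintegral mu `]-oo, x] (f \_ U).

Let fi : mu.-integrable setT (EFin \o (f \_ U)).
Proof.
have /(integrable_mkcond _ measurable_unit_oi) := L2_0_integrable f0.
by rewrite restrict_EFin.
Qed.

Let FE x : U x -> F x = - E (fun t => ge_ind x t * f t).
Proof.
move=> Ux; rewrite /F -Rintegral_itv_bndo_bndc; last by apply: (integrableS measurableT _ _ fi).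
have hf := L2_0_L2 f0; have [_ _ Ef] := f0.
have hg := L2_mul (L2_ge_ind x) hf.
transitivity (E (fun t => f t + (-1) * (ge_ind x t * f t))); last first.
  by rewrite unit_RintegralD ?unit_RintegralZ ?Ef ?add0r ?mulN1r//; [exact: integrable_L2|exact: unit_integrableZ].
rewrite [LHS]Rintegral_mkcond [RHS]Rintegral_mkcond; congr (Rintegral _ _ _).
apply/funext => t; rewrite !patchE !mem_setE in_itv/= /ge_ind.
by have [xt|tx] := leP x t; case: ifP => _ //=; rewrite ?mulr1n ?mulr0n ?mul1r ?mul0r ?mulN1r ?subrr ?oppr0 ?addr0.
Qed.

Let h k : R := k.+1%:R^-1.
Let h0 k : 0 < h k. Proof. by rewrite invr_gt0. Qed.
(** Averaging [f] over a window of half-width [h k] multiplies the coefficient of frequency [j + 1]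
    by this factor, of modulus at most 1. [S k] gives the partial sums of the average, and [A k] is
    the average itself, written with a primitive of [f]. *)
Let sg k j : R := sin (pik j * h k) / (pik j * h k).
Let S k := tpoly (fun j => coef f j.+1 * sg k j).
Let A k x := (F (x + h k) - F (x - h k)) / (2 * h k).

Let cvg_S k x : U (x - h k) -> U (x + h k) -> (fun m => S k m x) @ \oo --> A k x.
Proof.
move=> U1 U2; rewrite /A !FE// opprK.
have c1 := cvg_ge_ind_pairing f0 U1; have c2 := cvg_ge_ind_pairing f0 U2.
rewrite (_ : (fun m => _) = (fun m => (- (\sum_(j < m) coef f j.+1 * ge_coef (x + h k) j) +
  \sum_(j < m) coef f j.+1 * ge_coef (x - h k) j) / (2 * h k))).
  by apply: cvgM; [apply: cvgD => //; exact: cvgN|exact: cvg_cst].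
apply/funext => m; rewrite /S /tpoly -sumrN -big_split/= mulr_suml; apply: eq_bigr => j _.
rewrite /ge_coef /sg /phi -/(pik j) mulrDr mulrBr sinD sinB.
move: (pik j) (pik0 j) (h k) (h0 k) => p p0 e e0.
by field; rewrite !gt_eqF.
Qed.

Let cvg_A x : derivable F x 1 -> derive1 F x = f x -> (fun k => A k x) @ \oo --> f x.
Proof.
move=> dF FE'; pose q (e : R) : R := e^-1 * (F (e + x) - F x).
have cq : q e @[e --> 0^'] --> f x.
  have -> : q = (fun e : R => e^-1 *: ((F \o shift x) (e *: (1 : R)) - F x)).
    by apply/funext => e; rewrite /q /GRing.scale/= mulr1.
  by rewrite -FE' derive1E; exact: dF.
have hc : h @ \oo --> (0 : R) by exact: cvg_harmonic.
have /cvgr_dnbhsP cq' := cq.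
have q1 : (fun k => q (h k)) @ \oo --> f x.
  by apply: cq'; split => // k; rewrite gt_eqF.
have q2 : (fun k => q (- h k)) @ \oo --> f x.
  apply: cq'; split => [k|]; first by rewrite oppr_eq0 gt_eqF.
  by rewrite -oppr0; exact: cvgN.
rewrite (_ : (fun k => _) = (fun k => 2^-1 * (q (h k) + q (- h k)))).
  rewrite (_ : f x = 2^-1 * (f x + f x)); last by field.
  by apply: cvgM; [exact: cvg_cst|exact: cvgD].
apply/funext => k; rewrite /A /q (addrC x) (addrC x).
by move: (h k) (h0 k) => e e0; field; rewrite gt_eqF.
Qed.

Let g k x : \bar R := limn_einf (fun m => (S k m x ^+ 2)%:E).

Let mS k m : measurable_fun U (fun x => (S k m x ^+ 2)%:E).
Proof.
apply/measurable_EFinP; apply: measurable_funX; apply: measurable_funTS; exact: measurable_tpoly.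
Qed.

Let mg k : measurable_fun U (g k).
Proof. by apply: measurable_fun_limn_einf => m; exact: mS. Qed.

Let g0 k x : (0 <= g k x)%E.
Proof. by apply: limn_einf_ge; apply: nearW => m; rewrite lee_fin sqr_ge0. Qed.

Let g_le k : (\int[mu]_(x in U) g k x <= M%:E)%E.
Proof.
apply: fatou_le => [|m|m x _|m]; [exact: measurable_unit_oi|exact: mS|by rewrite lee_fin sqr_ge0|].
have [_ i2] := L2_tpoly (fun j => coef f j.+1 * sg k j) m.
rewrite -(EFin_Rintegral_unit i2) Rintegral_tpoly_sqr lee_fin (le_trans _ (fM m))//.
apply: ler_sum => j _; rewrite exprMn ler_piMr ?sqr_ge0// -(@real_normK _ (sg k j)) ?num_real//.
have p0 : 0 < pik j * h k by rewrite mulr_gt0// pik0.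
rewrite expr_le1// /sg normrM normfV (gtr0_norm p0) ler_pdivrMr// mul1r.
exact: sin_abs_le.
Qed.

(** The partial sums [S k m] have energy at most [M], since the factors [sg] only damp. Fatou in [m]
    gives this for the window averages, which converge to [f] almost everywhere by Lebesgue
    differentiation, and Fatou in [k] concludes. *)
Lemma parseval_le : E (fun x => f x ^+ 2) <= M.
Proof.
have [mf f2] := L2_0_L2 f0.
rewrite -lee_fin (EFin_Rintegral_unit f2).
apply: (@le_trans _ _ (\int[mu]_(x in U) limn_einf (g^~ x))%E); last first.
  by apply: fatou_le => [|m|m x _|m]; [exact: measurable_unit_oi|exact: mg|exact: g0|exact: g_le].
apply: ae_ge0_le_integral => //.
- exact: measurable_unit_oi.
- by move=> x _; rewrite lee_fin sqr_ge0.
- by apply/measurable_EFinP; exact: measurable_funX.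
- by move=> x _; apply: limn_einf_ge; apply: nearW => k; exact: g0.
- exact: measurable_fun_limn_einf.
have := @FTC1Ny R (f \_ U) _ _.
have i1 y : mu.-integrable `]-oo, y] (EFin \o (f \_ U)) by exact: (integrableS measurableT _ _ fi).
have i2 : locally_integrable [set: R] (f \_ U).
  by apply: integrable_locally; [exact: measurable_unit_oi|exact: L2_0_integrable].
move=> /(_ i1 i2); apply: (@filterS _ _ (ae_filter_ringOfSetsType mu)) => x [dF FE'] Ux.
have fx : derive1 F x = f x by rewrite FE' patchE mem_set.
have cA := cvg_A dF fx.
suff cg : g^~ x @ \oo --> (f x ^+ 2)%:E by rewrite (cvg_limn_einf_sup cg).1.
have cA2 : (fun k => (A k x ^+ 2)%:E) @ \oo --> (f x ^+ 2)%:E.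
  by apply: cvg_EFin; [exact: nearW|under eq_fun do rewrite expr2; rewrite expr2; exact: cvgM].
(* As soon as the window around [x] fits inside (0,1), the partial sums converge there and [g k x]
   equals the square of [A k x]. *)
apply: cvg_trans cA2; apply: near_eq_cvg.
have hc : h @ \oo --> (0 : R) by exact: cvg_harmonic.
have [x0 x1] : 0 < x /\ x < 1 by move: Ux; rewrite /unit_oi/= in_itv/= => /andP[].
have e0 : 0 < Num.min x (1 - x) by rewrite lt_min x0 subr_gt0.
near=> k.
have hk : h k < Num.min x (1 - x) by near: k; exact: (cvgr_lt _ hc).
move: hk; rewrite lt_min => /andP[hx h1x]; have hk0 := h0 k.
have U1 : U (x - h k) by rewrite /unit_oi/= in_itv/=; apply/andP; split; lra.
have U2 : U (x + h k) by rewrite /unit_oi/= in_itv/=; apply/andP; split; lra.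
have cS := cvg_S U1 U2.
have cS2 : (fun m => (S k m x ^+ 2)%:E) @ \oo --> (A k x ^+ 2)%:E.
  by apply: cvg_EFin; [exact: nearW|under eq_fun do rewrite expr2; rewrite expr2; exact: cvgM].
by rewrite /g (cvg_limn_einf_sup cS2).1.
Unshelve. all: by end_near. Qed.

End parseval_le.
End parseval.

(** * Acceptance probabilities *)

Section obs_step.
Context {R : realType}.
Local Notation mu := (@lebesgue_measure R).
Local Notation U := (@unit_oi R).
Local Notation E := (Rintegral (@leb R) U).
Local Notation I f := (mu.-integrable U (EFin \o f)).
Local Notation Z := (nat -> R).
Implicit Types (f : R -> R) (c : nat -> R).

Definition obs_dev f (n : nat) (x : R) : Z := fun j => (Num.sqrt n%:R)^-1 * (phi j.+1 x - coef f j.+1).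

Definition obs_op f (fd : dens_alt f) n := stepop (dens (alt_pdf fd)) (obs_dev f n).

Lemma measurable_obs_dev f n j : measurable_fun setT (fun x => obs_dev f n x j).
Proof. by apply: measurable_funM => //; apply: measurable_funB => //; exact: measurable_phi. Qed.

Lemma obs_op_ok f (fd : dens_alt f) n : op_ok (obs_op fd n).
Proof. by apply: stepop_ok => j; exact: measurable_obs_dev. Qed.

Lemma tpoly_sqr_le c m x : tpoly c m x ^+ 2 <= 2 * m%:R * \sum_(j < m) c j ^+ 2.
Proof.
have := @cauchy_schwarz_sum R m (fun=> 1) c (fun j => phi j.+1 x) (fun=> ler01).
rewrite [X in X ^+ 2 <= _ -> _](_ : _ = tpoly c m x); last by apply: eq_bigr => i _; rewrite mul1r.
move=> /le_trans; apply; rewrite mulrC; apply: ler_pM.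
- by apply: sumr_ge0 => i _; rewrite mul1r sqr_ge0.
- by apply: sumr_ge0 => i _; rewrite mul1r sqr_ge0.
- apply: (@le_trans _ _ (\sum_(i < m) 2)); last by rewrite sumr_const card_ord mulr_natr.
  by apply: ler_sum => i _; rewrite mul1r phi_sqr_le.
- by apply: ler_sum => i _; rewrite mul1r.
Qed.

Lemma tpoly_le c m x : `|tpoly c m x| <= 1 + 2 * m%:R * \sum_(j < m) c j ^+ 2.
Proof.
have h := tpoly_sqr_le c m x; have : 0 <= (`|tpoly c m x| - 1) ^+ 2 by exact: sqr_ge0.
rewrite sqrrB1 real_normK ?num_real// -mulr_natl; have := normr_ge0 (tpoly c m x); lra.
Qed.

Section fixed.
Variables (f : R -> R) (fd : dens_alt f) (n : nat).
Hypothesis n0 : (0 < n)%N.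
Let P := dens (alt_pdf fd).
Let f2 : L2_0 f. Proof. by case: fd. Qed.
Let hf : L2 f. Proof. exact: L2_0_L2. Qed.
Let nR : 0 < n%:R :> R. Proof. by rewrite ltr0n. Qed.
Let sn : 0 < Num.sqrt n%:R :> R. Proof. by rewrite sqrtr_gt0. Qed.

Lemma coef_sqr_le j : coef f j.+1 ^+ 2 <= L2norm f ^+ 2.
Proof.
rewrite L2norm_sqr; apply: le_trans (bessel j.+1 hf).
by rewrite big_ord_recr/= lerDr sumr_ge0// => i _; exact: sqr_ge0.
Qed.

(** The variance of [tpoly c m] under the density [1 + f], divided by [n]; at [f = 0] the sum of
    squares alone remains. *)
Definition obs_var m c : R :=
  n%:R^-1 * (\sum_(j < m) c j ^+ 2 + E (fun x => f x * tpoly c m x ^+ 2) - (\sum_(j < m) c j * coef f j.+1) ^+ 2).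

Lemma obs_dev_sum m c x : \sum_(j < m) c j * obs_dev f n x j =
  (Num.sqrt n%:R)^-1 * (tpoly c m x - \sum_(j < m) c j * coef f j.+1).
Proof.
by rewrite /tpoly -sumrB mulr_sumr; apply: eq_bigr => j _; rewrite /obs_dev; ring.
Qed.

Lemma obs_second_moment m a c :
  (\int[P]_x ((a + \sum_(j < m) c j * obs_dev f n x j) ^+ 2)%:E = (a ^+ 2 + obs_var m c)%:E)%E.
Proof.
set ka := \sum_(j < m) c j * coef f j.+1; pose q : R := (Num.sqrt n%:R)^-1.
have q2 : q ^+ 2 = n%:R^-1 by rewrite exprVn sqr_sqrtr// ltW.
have ht := L2_tpoly c m; have it := integrable_L2 ht; have [_ it2] := ht.
under eq_integral do rewrite obs_dev_sum -/ka -/q.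
pose B : R := 1 + 2 * m%:R * \sum_(j < m) c j ^+ 2.
have B1 : 1 <= B by rewrite lerDl !mulr_ge0// sumr_ge0// => i _; exact: sqr_ge0.
have mF : measurable_fun setT (fun x => (a + q * (tpoly c m x - ka)) ^+ 2).
  apply: measurable_funX; apply: measurable_funD => //; apply: measurable_funM => //.
  by apply: measurable_funB => //; exact: measurable_tpoly.
have FB x : `|(a + q * (tpoly c m x - ka)) ^+ 2| <= (`|a| + `|q| * (B + `|ka|)) ^+ 2.
  have B0 := le_trans ler01 B1.
  rewrite normrX lerXn2r ?nnegrE//; first by rewrite addr_ge0// mulr_ge0// (addr_ge0 B0).
  rewrite (le_trans (ler_normD _ _))// lerD2l normrM ler_wpM2l//.
  by rewrite (le_trans (ler_normB _ _))// lerD2r tpoly_le.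
rewrite (integral_alt fd mF FB); congr EFin.
have Ew (w : R -> R) : I w -> I (fun x => w x * tpoly c m x) -> I (fun x => w x * tpoly c m x ^+ 2) ->
   E (fun x => w x * (a + q * (tpoly c m x - ka)) ^+ 2) =
   (a - q * ka) ^+ 2 * E w + 2 * (a - q * ka) * q * E (fun x => w x * tpoly c m x) +
     q ^+ 2 * E (fun x => w x * tpoly c m x ^+ 2).
  move=> i1 i2 i3.
  rewrite (_ : (fun x => _) = (fun x => (a - q * ka) ^+ 2 * w x + (2 * (a - q * ka) * q * (w x * tpoly c m x) +
     q ^+ 2 * (w x * tpoly c m x ^+ 2)))); last by apply/funext => x; ring.
  have j1 := unit_integrableZ ((a - q * ka) ^+ 2) i1; have j2 := unit_integrableZ (2 * (a - q * ka) * q) i2.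
  have j3 := unit_integrableZ (q ^+ 2) i3.
  by rewrite (unit_RintegralD j1 (unit_integrableD j2 j3)) (unit_RintegralD j2 j3) !unit_RintegralZ// addrA.
have one (g : R -> R) : (fun x => 1 * g x) = g by apply/funext => x; rewrite mul1r.
have i1 : I (fun _ : R => 1 : R) by apply: (@bounded_integrable_unit _ _ 1) => [|x _]; [exact: measurable_cst|rewrite normr1].
have e1 : E (fun x => (a + q * (tpoly c m x - ka)) ^+ 2) = (a - q * ka) ^+ 2 + q ^+ 2 * \sum_(j < m) c j ^+ 2.
  have := Ew (fun=> 1) i1; rewrite (one (tpoly c m)) (one (fun x => tpoly c m x ^+ 2)).
  rewrite (one (fun x => (a + q * (tpoly c m x - ka)) ^+ 2)) => ->//.
  by rewrite Rintegral_cst Rintegral_tpoly Rintegral_tpoly_sqr mulr0 addr0 mulr1.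
have mt : measurable_fun U (fun x => tpoly c m x ^+ 2).
  by apply: measurable_funX; apply: measurable_funTS; exact: measurable_tpoly.
have i3 : I (fun x => f x * tpoly c m x ^+ 2).
  apply: (@bounded_M_integrable _ _ _ (B ^+ 2) (integrable_L2 hf) mt) => x _.
  by rewrite normrX lerXn2r ?nnegrE ?tpoly_le// (le_trans _ B1).
have [_ _ Ef] := f2.
rewrite e1 (Ew f (integrable_L2 hf) (L2_mul hf ht) i3) Ef mulr0 add0r Rintegral_M_tpoly// -/ka.
by rewrite /obs_var -q2 -/ka; ring.
Qed.

(** A small [f] barely changes the covariance. Cauchy-Schwarz with the uniform bound on the squared
    polynomial gives the part [2 * m]; the squared mean is at most the sum of squares times the
    squared norm of [f], which gives the 1. *)
Lemma obs_var_le m c : L2norm f <= 1 ->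
  `|obs_var m c - n%:R^-1 * \sum_(j < m) c j ^+ 2| <=
  ((2 * m%:R + 1) * L2norm f / n%:R) * \sum_(j < m) c j ^+ 2.
Proof.
move=> f1; set S := \sum_(j < m) c j ^+ 2.
have S0 : 0 <= S by apply: sumr_ge0 => i _; exact: sqr_ge0.
have N0 : 0 <= L2norm f by exact: sqrtr_ge0.
set W := E (fun x => f x * tpoly c m x ^+ 2); set ka := \sum_(j < m) c j * coef f j.+1.
have ka2 : ka ^+ 2 <= S * L2norm f.
  have := @cauchy_schwarz_sum R m (fun=> 1) c (fun j => coef f j.+1) (fun=> ler01).
  rewrite [X in X ^+ 2 <= _ -> _](_ : _ = ka); last by apply: eq_bigr => i _; rewrite mul1r.
  move=> /le_trans; apply; apply: ler_pM.
  - by apply: sumr_ge0 => i _; rewrite mul1r sqr_ge0.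
  - by apply: sumr_ge0 => i _; rewrite mul1r sqr_ge0.
  - by apply: ler_sum => i _; rewrite mul1r.
  - rewrite (eq_bigr (fun i : 'I_m => coef f i.+1 ^+ 2)) => [|i _]; last by rewrite mul1r.
    apply: (le_trans (bessel m hf)); rewrite -L2norm_sqr expr2.
    by rewrite ler_piMl.
have mt : measurable_fun U (fun x => tpoly c m x ^+ 2).
  by apply: measurable_funX; apply: measurable_funTS; exact: measurable_tpoly.
have tB x : `|tpoly c m x ^+ 2| <= 2 * m%:R * S by rewrite ger0_norm ?sqr_ge0// tpoly_sqr_le.
have ht2 : L2 (fun x => tpoly c m x ^+ 2) by apply: (@L2_bounded _ _ (2 * m%:R * S)).
have b0 : 0 <= 2 * m%:R * S by rewrite !mulr_ge0.
have W2 : `|W| <= 2 * m%:R * S * L2norm f.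
  rewrite -sqrtr_sqr -[leRHS]ger0_norm ?mulr_ge0// -sqrtr_sqr ler_wsqrtr//.
  rewrite exprMn L2norm_sqr mulrC; apply: (le_trans (cauchy_schwarz hf ht2)).
  apply: ler_wpM2l; first exact: Rintegral_sqr_ge0.
  rewrite -[leRHS](@Rintegral_cst R); apply: le_Rintegral => //.
  - exact: measurable_unit_oi.
  - by have [] := ht2.
  - by apply: (@bounded_integrable_unit _ _ `|(2 * m%:R * S) ^+ 2|) => //; exact: measurable_cst.
  - by move=> x _; rewrite lerXn2r ?nnegrE ?sqr_ge0// tpoly_sqr_le.
rewrite (_ : _ - _ = n%:R^-1 * (W - ka ^+ 2)); last by rewrite /obs_var -/S -/W -/ka; ring.
rewrite normrM ger0_norm ?invr_ge0 ?(ltW nR)//.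
rewrite (_ : _ * S = n%:R^-1 * (2 * m%:R * S * L2norm f + S * L2norm f)); last by ring.
rewrite ler_wpM2l ?invr_ge0 ?(ltW nR)//.
apply: (le_trans (ler_normB _ _)); rewrite lerD// ger0_norm ?sqr_ge0//.
Qed.

Lemma obs_dev_fourth j : L2norm f <= 1 ->
  (\int[P]_x (obs_dev f n x j ^+ 4)%:E <= (64 / n%:R ^+ 2)%:E)%E.
Proof.
move=> f1; rewrite -[leRHS](integral_prob_cst P); apply: ge0_le_integral => //.
- by move=> x _; rewrite lee_fin exprn_even_ge0.
- by apply/measurable_EFinP; apply: measurable_funX; exact: measurable_obs_dev.
move=> x _; rewrite lee_fin /obs_dev exprMn exprVn -[4%N]/(2 * 2)%N !exprM sqr_sqrtr ?(ltW nR)//.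
rewrite mulrC ler_wpM2r ?invr_ge0 ?sqr_ge0//.
have N0 : 0 <= L2norm f by exact: sqrtr_ge0.
have h1 := phi_sqr_le j.+1 x; have h2 := coef_sqr_le j.
have h3 : L2norm f ^+ 2 <= 1 by rewrite expr_le1.
(* The squared deviation is at most [2 * (2 + 1)], rounded up to 8. *)
have -> : 64 = 8 ^+ 2 :> R by rewrite expr2 -natrM.
rewrite lerXn2r ?nnegrE ?sqr_ge0//.
have : 0 <= (phi j.+1 x + coef f j.+1) ^+ 2 by exact: sqr_ge0.
rewrite sqrrD sqrrB; lra.
Qed.

(** Here [f] may be large: the square of [phi] is at most 2, so its mean under any density is too.
    Uniformity in [j] is what controls the infinitely many remaining coordinates. *)
Lemma obs_dev_second j a :
  (\int[P]_x ((a + obs_dev f n x j) ^+ 2)%:E <= (a ^+ 2 + 2 / n%:R)%:E)%E.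
Proof.
pose c (i : nat) : R := (i == j)%:R.
have sumc (u : nat -> R) : \sum_(i < j.+1) c i * u i = u j.
  rewrite big_ord_recr/= /c eqxx mul1r big1 ?add0r// => i _.
  by rewrite (ltn_eqF (ltn_ord i)) mul0r.
have := obs_second_moment j.+1 a c; under eq_integral do rewrite sumc.
move=> ->; rewrite lee_fin lerD2l /obs_var sumc {1}/c eqxx.
have tE x : tpoly c j.+1 x = phi j.+1 x by exact: (sumc (fun i => phi i.+1 x)).
rewrite mulrC ler_wpM2r ?invr_ge0 ?(ltW nR)//.
apply: (@le_trans _ _ (1 + E (fun x => f x * tpoly c j.+1 x ^+ 2))).
  by rewrite gerBl sqr_ge0.
have mp : measurable_fun setT (fun x => phi j.+1 x ^+ 2 : R) by apply: measurable_funX; exact: measurable_phi.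
have pB (x : R) : `|phi j.+1 x ^+ 2| <= 2 by rewrite ger0_norm ?sqr_ge0// phi_sqr_le.
have := integral_alt fd mp pB.
rewrite (_ : E (fun x => phi j.+1 x ^+ 2) = 1); last first.
  by under eq_fun do rewrite expr2; rewrite phi_orthonormal// eqxx.
have -> : (fun x => f x * tpoly c j.+1 x ^+ 2) = (fun x => f x * phi j.+1 x ^+ 2).
  by apply/funext => x; rewrite tE.
move=> e; rewrite -lee_fin -e -[leRHS](integral_prob_cst P); apply: ge0_le_integral => //.
- by move=> x _; rewrite lee_fin sqr_ge0.
- exact/measurable_EFinP.
- by move=> x _; rewrite lee_fin phi_sqr_le.
Qed.

End fixed.

Lemma obs_clt m (s T eps : R) : 0 < s -> 1 <= T -> 0 < eps ->
  exists2 e1 : R, 0 < e1 & exists n0 : nat, forall n, (n0 <= n)%N ->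
  forall f (fd : dens_alt f), L2norm f <= e1 -> forall tau z, tau <= T ->
  (iter n (obs_op fd n) (fun z => (chi s tau (Qm m z))%:E) z <=
     KX predT m z (fun z => (chi s tau (z 0%N))%:E) (fun=> 0%R) + eps%:E)%E /\
  (KX predT m z (fun z => (chi s tau (z 0%N))%:E) (fun=> 0%R) <=
     iter n (obs_op fd n) (fun z => (chi s tau (Qm m z))%:E) z + eps%:E)%E.
Proof.
move=> s0 T1 eps0; have [e0 e00 [n0 H]] := lindeberg_exchange m s0 T1 eps0.
have d0 : 0 < 2 * m%:R + 1 :> R by rewrite ltr_wpDl// mulr_ge0.
(* The second bound brings the covariance error of [obs_var_le] below [e0]; the cap 1 is what the
   moment bounds ask for. *)
exists (Num.min 1 (e0 / (2 * m%:R + 1))); first by rewrite lt_min ltr01 divr_gt0.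
exists n0.+1 => n nn f fd; rewrite le_min => /andP[f1 fe] tau z tT.
have n1 : (0 < n)%N by exact: leq_ltn_trans nn.
have KE : KX predT m z (fun z => (chi s tau (z 0%N))%:E) (fun=> 0%R) =
    gauss_op 1 m (fun z => (chi s tau (Qm m z))%:E) z.
  rewrite -(@gauss_op_KX R m (fun u => (chi s tau u)%:E) 0 z).
  - by congr (gauss_op 1 m _ z); apply/funext => u; rewrite add0r.
  - apply/measurable_EFinP; apply: (measurableT_comp measurable_spl).
    by apply: measurable_funM => //; exact: measurable_funB.
  - by move=> u; rewrite lee_fin; have [/andP[]] := chi_bounds tau u s0.
rewrite KE; apply: (H n (ltnW nn) _ _ (dens (alt_pdf fd)) (obs_dev f n) (obs_var f n m)) => //.
- by move=> j; exact: measurable_obs_dev.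
- by move=> a c; exact: obs_second_moment.
- move=> c; apply: (le_trans (obs_var_le fd n1 m c f1)).
  apply: ler_wpM2r; first by apply: sumr_ge0 => i _; exact: sqr_ge0.
  by rewrite ler_wpM2r ?invr_ge0// mulrC -ler_pdivlMr.
- by move=> j _; exact: obs_dev_fourth.
Qed.

End obs_step.

(** * Error probabilities as iterated averages *)

Section error_prob.
Context {R : realType}.
Local Notation U := (@unit_oi R).
Local Notation Z := (nat -> R).
Implicit Types (f : R -> R) (b z : Z).

(** Extended values are needed because states range over all sequences. The centre [b] is 0 to
    measure a signal and the drift to measure the noise around it. *)
Definition tail_form m b z : \bar R := (\sum_(j <oo) ((m <= j)%N%:R * (lam j * (z j - b j) ^+ 2))%:E)%E.

Let coord_good m b j : good (fun z : Z => ((m <= j)%N%:R * (lam j * (z j - b j) ^+ 2))%:E).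
Proof.
apply: good_EFin => [z|d T zt mzt].
  by rewrite mulr_ge0// mulr_ge0 ?sqr_ge0// ltW// lam_gt0.
apply: measurable_funM => //; apply: measurable_funM => //; apply: measurable_funX.
exact: measurable_funB.
Qed.

Lemma tail_form_good m b : good (tail_form m b).
Proof. by apply: good_series => j; exact: coord_good. Qed.

Definition total_form z : \bar R := tail_form 0 (fun=> 0) z.

Lemma total_formE z : total_form z = (\sum_(j <oo) (lam j * z j ^+ 2)%:E)%E.
Proof.
apply: eq_eseriesr => j _; by rewrite mul1r subr0.
Qed.

Definition accept (t : R) z : \bar R := ((total_form z <= t%:E)%E%:R)%:E.

Lemma accept_good t : good (accept t).
Proof. by apply: good_indic_le; apply: good_mZ; exact: tail_form_good. Qed.

Definition drift f (n : nat) : Z := fun j => Num.sqrt n%:R * coef f j.+1.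

(** The increments are centred, so the signal sits entirely in the starting state, and the law of
    the increments differs little from the null one when [f] is small. *)
Definition acc_prob f (fd : dens_alt f) n t : \bar R := iter n (obs_op fd n) (accept t) (drift f n).

Lemma iter_le1 n A g : @op_ok R A -> good g -> (forall z, g z <= 1)%E -> forall z, (iter n A g z <= 1)%E.
Proof.
move=> okA gg g1 z; have [_ le _ _ c] := op_ok_iter n okA.
by rewrite -[leRHS](c 1%E z); apply: le => //; exact: (@good_cst _ 1).
Qed.

Lemma acc_prob_bounds f (fd : dens_alt f) n t : (0 <= acc_prob fd n t <= 1)%E.
Proof.
apply/andP; split.
  have [+ _ _ _ _] := op_ok_iter n (obs_op_ok fd n).
  by move=> /(_ _ (accept_good t)) /good_ge0; exact.
apply: iter_le1; [exact: obs_op_ok|exact: accept_good|move=> z].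
by rewrite lee_fin; case: (_ <= _)%E.
Qed.

Lemma acc_prob_fin f (fd : dens_alt f) n t : acc_prob fd n t \is a fin_num.
Proof.
have /andP[h0 h1] := acc_prob_bounds fd n t.
by rewrite ge0_fin_numE// (le_lt_trans h1)// ltry.
Qed.

Lemma cvm_stat_form f n (xs : seq R) : (0 < n)%N -> size xs = n -> (forall x, x \in xs -> U x) ->
  (cvm_stat xs)%:E = total_form (zadd (drift f n) (fun j => \sum_(x <- xs) obs_dev f n x j)).
Proof.
move=> n0 sn xsU; rewrite total_formE cvm_stat_series// sn; apply: eq_eseriesr => j _.
have s0 : Num.sqrt n%:R != 0 :> R by rewrite sqrtr_eq0 -ltNge ltr0n.
rewrite /zadd; have -> : \sum_(x <- xs) obs_dev f n x j =
    (Num.sqrt n%:R)^-1 * \sum_(x <- xs) phi j.+1 x - (Num.sqrt n%:R)^-1 * (n%:R * coef f j.+1).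
  have -> : n%:R * coef f j.+1 = \sum_(x <- xs) coef f j.+1.
    by rewrite big_const_seq count_predT iter_addr_0 sn mulr_natl.
  by rewrite -mulrBr -sumrB mulr_sumr.
have nE : n%:R = Num.sqrt n%:R ^+ 2 :> R by rewrite sqr_sqrtr.
congr (_ * _ ^+ 2)%:E; rewrite /drift; move: nE s0; move: (Num.sqrt n%:R) => q -> q0.
by field.
Qed.

Lemma beta_errE f (fd : dens_alt f) n t : (0 < n)%N -> beta_err n t f = fine (acc_prob fd n t).
Proof.
move=> n0; rewrite /beta_err /Pn /acc_prob; congr fine.
apply: iterint_stepop; [by move=> j; exact: measurable_obs_dev|exact: accept_good|].
move=> xs sx xsU; rewrite /accept -(cvm_stat_form f n0 sx xsU) lee_fin indicE.
by rewrite in_setC /reject mem_setE/= -leNgt.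
Qed.

Lemma dens_alt0 : dens_alt (fun _ : R => 0 : R).
Proof.
split; last by apply: aeW => x _; rewrite addr0.
split; first exact: measurable_cst.
  by under eq_integral do rewrite expr0n/=; rewrite integral0 ltry.
by rewrite Rintegral_cst.
Qed.

(** The rejection and acceptance indicators add up to 1, and the iterated average is additive and
    fixes constants. *)
Lemma alpha_errE n t : (0 < n)%N -> alpha_err n t = 1 - fine (acc_prob dens_alt0 n t).
Proof.
move=> n0; rewrite /alpha_err /Pn.
pose rej (z : Z) : \bar R := ((t%:E < total_form z)%E%:R)%:E.
have gN : good rej.
  have mS := good_mZ (tail_form_good 0 (fun=> 0)).
  split=> [d T zt mzt|z]; last by rewrite lee_fin.
  rewrite (_ : (fun u => _) = EFin \o \1_[set u | (t%:E < total_form (zt u))%E]).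
    apply/measurable_EFinP/measurable_indic; rewrite -[X in measurable X]setTI.
    by apply: emeasurable_fun_o_infty => //; exact: mS.
  by apply/funext => u /=; rewrite indicE mem_setE.
pose A := obs_op dens_alt0 n.
have -> : iterint n (fun x => 1 + (fun=> 0) x) (fun xs => (\1_(reject t) xs)%:E) =
    iter n A rej (drift (fun=> 0) n).
  apply: (@iterint_stepop _ _ _ dens_alt0 (obs_dev (fun=> 0) n)) => // [j|xs sx xsU].
    exact: measurable_obs_dev.
  by rewrite /rej -(cvm_stat_form (fun=> 0) n0 sx xsU) lte_fin indicE /reject mem_setE.
have [_ _ AD _ Ac] := op_ok_iter n (obs_op_ok dens_alt0 n).
have := AD _ _ gN (accept_good t) (drift (fun=> 0) n).
have -> : (fun z => rej z + accept t z)%E = (fun=> 1%E).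
  by apply/funext => z; rewrite /rej /accept ltNge; case: (_ <= _)%E; rewrite ?add0e ?adde0.
rewrite Ac -/A -/(acc_prob dens_alt0 n t) => e.
have hf := acc_prob_fin dens_alt0 n t.
by rewrite -[X in fine X](addeK _ hf) -e -[acc_prob _ _ _]fineK// -EFinN -EFinD.
Qed.

Lemma sum_lam_tail_bound m k : (0 < m)%N -> \sum_(0 <= j < k) (m <= j)%N%:R * lam j <= m%:R^-1 :> R.
Proof.
move=> m0; rewrite (eq_bigr (fun j => if (m <= j)%N then lam j else 0)) => [|j _]; last first.
  by case: (m <= j)%N; rewrite ?mul1r ?mul0r.
rewrite -big_mkcond/=; have [mk|km] := leqP m k.
  rewrite (big_cat_nat (n := m))//= big_nat_cond big1 ?add0r => [|j /andP[/andP[_ jm] mj]]; last first.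
    by move: jm; rewrite ltnNge mj.
  rewrite big_nat_cond (eq_bigl (fun j => (m <= j < k)%N)) => [|j]; last by case: (m <= j)%N; rewrite ?andbT ?andbF.
  by rewrite -big_nat sum_lam_tail_le.
rewrite big_nat_cond big1 ?invr_ge0// => j /andP[/andP[_ jk] mj].
by move: km; rewrite ltnNge (leq_trans mj (ltnW jk)).
Qed.

(** By [obs_dev_second] one observation raises the mean of the form by at most [2 * L / n]. Centred
    at the starting state, the form begins at 0, and the mean tail noise after [n] steps is at most
    [2 * L]. *)
Lemma tail_drift f (fd : dens_alt f) n m b z (L : R) : (0 < n)%N ->
  (forall k, \sum_(0 <= j < k) (m <= j)%N%:R * lam j <= L) ->
  (iter n (obs_op fd n) (tail_form m b) z <= tail_form m b z + (2 * L)%:E)%E.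
Proof.
move=> n0 hL; have nR : 0 < n%:R :> R by rewrite ltr0n.
have L0 : 0 <= L by have := hL 0%N; rewrite big_geq.
have -> : 2 * L = n%:R * (2 * L / n%:R) by field; rewrite gt_eqF.
apply: iter_drift; [exact: obs_op_ok|exact: tail_form_good|by rewrite divr_ge0 ?mulr_ge0// ltW|].
move=> {}z; rewrite /obs_op /tail_form stepop_series; last by move=> j; exact: coord_good.
apply: (@le_trans _ _ (\sum_(j <oo) (((m <= j)%N%:R * (lam j * (z j - b j) ^+ 2))%:E +
   ((m <= j)%N%:R * lam j * (2 / n%:R))%:E))%E).
  apply: lee_nneseries => [j _ _|j _].
    apply: integral_ge0 => x _; exact: (good_ge0 _ (coord_good m b j)).
  have k0 : 0 <= (m <= j)%N%:R * lam j :> R by rewrite mulr_ge0// ltW// lam_gt0.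
  rewrite /stepop; under eq_integral do rewrite mulrA EFinM.
  rewrite ge0_integralZl_EFin//; last 2 first.
  - by move=> x _; rewrite lee_fin sqr_ge0.
  - apply/measurable_EFinP; apply: measurable_funX; apply: measurable_funB => //.
    by apply: measurable_funD => //; exact: measurable_obs_dev.
  have h := obs_dev_second fd n0 j (z j - b j).
  rewrite -EFinD (_ : _ + _ = (m <= j)%N%:R * lam j * ((z j - b j) ^+ 2 + 2 / n%:R)); last by ring.
  rewrite [X in (_ <= X)%E]EFinM; apply: lee_wpmul2l; first by rewrite lee_fin.
  apply: le_trans h; under eq_integral do rewrite /zadd addrAC.
  by [].
have p i : 0 <= (m <= i)%N%:R * lam i * (2 / n%:R) :> R.
  by apply: mulr_ge0; [apply: mulr_ge0 => //; rewrite ltW// lam_gt0|rewrite divr_ge0// ltW].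
rewrite nneseriesD; last 2 first.
- by move=> j _ _; rewrite lee_fin mulr_ge0// mulr_ge0 ?sqr_ge0// ltW// lam_gt0.
- by move=> j _ _; rewrite lee_fin.
rewrite leeD2l//; apply: lime_le.
  by apply: is_cvg_nneseries => j _ _; rewrite lee_fin.
apply: nearW => k; rewrite sumEFin lee_fin -mulr_suml.
rewrite [leRHS](_ : _ = L * (2 / n%:R)); last by ring.
by rewrite ler_wpM2r ?divr_ge0// ltW.
by move=> j; exact: measurable_obs_dev.
Qed.

End error_prob.

(** * Smooth bounds for the acceptance indicator *)

Section acceptance_bounds.
Context {R : realType}.
Local Notation Z := (nat -> R).
Implicit Types (f : R -> R) (b z h : Z).

Definition zsub z b : Z := fun j => z j - b j.

Let term_ge0 m b z j : (0 <= ((m <= j)%N%:R * (lam j * (z j - b j) ^+ 2))%:E :> \bar R)%E.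
Proof. by rewrite lee_fin mulr_ge0// mulr_ge0 ?sqr_ge0// ltW// lam_gt0. Qed.

Lemma tail_form_ge0 m b z : (0 <= tail_form m b z)%E.
Proof. by apply: nneseries_ge0 => j _ _; exact: term_ge0. Qed.

Lemma form_split m b z : total_form (zsub z b) = ((Qm m (zsub z b))%:E + tail_form m b z)%E.
Proof.
rewrite total_formE.
have p0 j : (0 <= (lam j * zsub z b j ^+ 2)%:E :> \bar R)%E by rewrite lee_fin mulr_ge0 ?sqr_ge0// ltW// lam_gt0.
rewrite (@nneseries_split _ (fun j => (lam j * zsub z b j ^+ 2)%:E) 0 m)//.
rewrite /tail_form (@nneseries_split _ (fun j => ((m <= j)%N%:R * (lam j * (z j - b j) ^+ 2))%:E) 0 m)//.
have -> : (\sum_(0 <= j < 0 + m) ((m <= j)%N%:R * (lam j * (z j - b j) ^+ 2))%:E = 0)%E.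
  by rewrite big_nat big1// => j /andP[_ jm]; rewrite leqNgt jm mul0r.
rewrite add0e add0n.
congr (_ + _)%E; first by rewrite sumEFin big_mkord.
apply: congr_lim; apply/funext => k /=; apply: eq_big_nat => j /andP[mj _].
by rewrite mj mul1r.
Qed.

Lemma zsub0 z : zsub z (fun=> 0) = z.
Proof. by apply/funext => j; rewrite /zsub subr0. Qed.

Lemma form_split0 m z : total_form z = ((Qm m z)%:E + tail_form m (fun=> 0%R) z)%E.
Proof. by rewrite -{1 2}(zsub0 z) (form_split m). Qed.

Lemma Qm_le_form m z : ((Qm m z)%:E <= total_form z)%E.
Proof. by rewrite (form_split0 m) leeDl// tail_form_ge0. Qed.

Lemma tail_form_le m (a1 a2 : R) b b1 b2 z z1 z2 : 0 <= a1 -> 0 <= a2 ->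
  (forall j, (z j - b j) ^+ 2 <= a1 * (z1 j - b1 j) ^+ 2 + a2 * (z2 j - b2 j) ^+ 2) ->
  (tail_form m b z <= a1%:E * tail_form m b1 z1 + a2%:E * tail_form m b2 z2)%E.
Proof.
move=> a10 a20 H; rewrite /tail_form -!nneseriesZl//.
rewrite -nneseriesD; last 2 first.
- by move=> j _ _; apply: mule_ge0; [rewrite lee_fin|exact: term_ge0].
- by move=> j _ _; apply: mule_ge0; [rewrite lee_fin|exact: term_ge0].
apply: lee_nneseries => [j _ _|j _]; first exact: term_ge0.
rewrite -!EFinM -EFinD lee_fin.
have -> : a1 * ((m <= j)%N%:R * (lam j * (z1 j - b1 j) ^+ 2)) + a2 * ((m <= j)%N%:R * (lam j * (z2 j - b2 j) ^+ 2)) =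
   (m <= j)%N%:R * (lam j * (a1 * (z1 j - b1 j) ^+ 2 + a2 * (z2 j - b2 j) ^+ 2)) by ring.
by rewrite ler_wpM2l// ler_wpM2l ?H// ltW// lam_gt0.
Qed.

Lemma acceptP t z : accept t z = if (total_form z <= t%:E)%E then 1%E else 0%E.
Proof. by rewrite /accept; case: ifP. Qed.

Lemma accept_le_chi m (s t : R) z : 0 < s -> (accept t z <= (chi s (t + 3 / s) (Qm m z))%:E)%E.
Proof.
move=> s0; have [/andP[c0 _] _ _] := chi_bounds (t + 3 / s) (Qm m z) s0.
rewrite acceptP; case: ifPn => [h|_]; last by rewrite lee_fin.
have := le_trans (Qm_le_form m z) h; rewrite lee_fin => h'.
by rewrite chi_near//; lra.
Qed.

(** The tail of [h] is at most twice the tail of [z] plus twice the noise. If the noise is below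
    [c / 4], the tail of [z] is thus at least [c / 4], and acceptance leaves at most [t - c / 4] for
    the head; otherwise the last term is at least 1, as in Markov's inequality. *)
Lemma accept_le_tail m (s t c : R) h z : 0 < s -> 0 < c -> (c%:E <= tail_form m (fun=> 0%R) h)%E ->
  (accept t z <= (chi s (t - c / 4 + 3 / s) (Qm m z))%:E + (4 / c)%:E * tail_form m h z)%E.
Proof.
move=> s0 c0 hc; have [/andP[chi0 _] _ _] := chi_bounds (t - c / 4 + 3 / s) (Qm m z) s0.
have W0 := tail_form_ge0 m h z.
have k0 : 0 < 4 / c by rewrite divr_gt0.
rewrite acceptP; case: ifPn => [St|_]; last first.
  by rewrite adde_ge0 ?lee_fin// mule_ge0// lee_fin ltW.
have [cW|Wc] := leP (c / 4)%:E (tail_form m h z).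
  apply: (@le_trans _ _ ((4 / c)%:E * (c / 4)%:E)%E).
    by rewrite -EFinM lee_fin (_ : _ * _ = 1)//; field; rewrite gt_eqF.
  apply: (@le_trans _ _ ((4 / c)%:E * tail_form m h z)%E); first by rewrite lee_pmul2l// lte_fin.
  by rewrite leeDr// lee_fin.
have := @tail_form_le m 2 2 (fun=> 0) (fun=> 0) h h z z (ler0n R 2) (ler0n R 2).
have H j : (h j - 0) ^+ 2 <= 2 * (z j - 0) ^+ 2 + 2 * (z j - h j) ^+ 2.
  rewrite !subr0; have : 0 <= (2 * z j - h j) ^+ 2 by exact: sqr_ge0.
  by rewrite !sqrrB; lra.
move=> /(_ H) /(le_trans hc).
move: St; rewrite (form_split0 m).
have T0 := tail_form_ge0 m (fun=> 0) z.
move: (tail_form m (fun=> 0) z) (tail_form m h z) T0 W0 Wc => [T'| |]// [W'| |]// T0 W0.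
rewrite lte_fin => Wc; rewrite -!EFinM -!EFinD !lee_fin => h1 h2.
rewrite chi_near; last by lra.
  by rewrite lerDl mulr_ge0// ltW.
by [].
Qed.

(** With [(x + y)^2 <= (1 + eta) x^2 + (1 + 1 / eta) y^2], a head below [t - 2 * e] and a tail noise
    below [e] give a total below [t - e + e / 2 + e / 2]: one half pays for [eta], the other for the
    signal. A larger noise is charged to the last term. *)
Lemma chi_le_accept m (s t e T eta c : R) h z : 0 < s -> 0 < e -> 0 < eta -> t <= T -> eta * T <= e / 2 ->
  (total_form h <= c%:E)%E -> (1 + eta^-1) * c <= e / 2 ->
  ((chi s (t - 2 * e) (Qm m (zsub z h)))%:E <= accept t z + (e^-1)%:E * tail_form m h z)%E.
Proof.
move=> s0 e0 eta0 tT eT hc cE; have [/andP[chi0 chi1] _ _] := chi_bounds (t - 2 * e) (Qm m (zsub z h)) s0.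
have W0 := tail_form_ge0 m h z.
have eW : (0 <= (e^-1)%:E * tail_form m h z)%E by rewrite mule_ge0// lee_fin invr_ge0 ltW.
rewrite acceptP; case: ifPn => [St|]; first by rewrite (@le_trans _ _ 1%E) ?lee_fin// leeDl.
rewrite -ltNge add0e => tS.
have [cW|Wc] := leP e%:E (tail_form m h z).
  apply: (@le_trans _ _ ((e^-1)%:E * e%:E)%E).
    by rewrite -EFinM lee_fin mulVf ?gt_eqF.
  by rewrite lee_pmul2l// lte_fin invr_gt0.
have [far|near] := leP (t - 2 * e) (Qm m (zsub z h)).
  by have [-> _ _] := chi_far s0 far.
exfalso.
have := @tail_form_le 0 (1 + eta) (1 + eta^-1) (fun=> 0) (fun=> 0) (fun=> 0) z (zsub z h) h.
have e1 : 0 <= 1 + eta by rewrite addr_ge0// ltW.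
have e2 : 0 <= 1 + eta^-1 by rewrite addr_ge0// invr_ge0 ltW.
have H j : (z j - 0) ^+ 2 <= (1 + eta) * (zsub z h j - 0) ^+ 2 + (1 + eta^-1) * (h j - 0) ^+ 2.
  rewrite !subr0 /zsub; pose x := z j - h j; pose y := h j.
  have -> : z j = x + y by rewrite /x /y subrK.
  rewrite -/y addrK; move: x y => x y.
  have -> : (1 + eta) * x ^+ 2 + (1 + eta^-1) * y ^+ 2 = (x + y) ^+ 2 + eta * (x - y / eta) ^+ 2.
    by field; rewrite gt_eqF.
  by rewrite lerDl mulr_ge0 ?sqr_ge0// ltW.
move=> /(_ e1 e2 H); rewrite -/(total_form z) -/(total_form _) -/(total_form h) (form_split m).
apply/negP; rewrite -ltNge; apply: le_lt_trans tS.
have Sh0 := tail_form_ge0 0 (fun=> 0) h; rewrite -/(total_form h) in Sh0.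
have Q0 := Qm_ge0 m (zsub z h).
move: (total_form h) (tail_form m h z) Sh0 hc W0 Wc => [S'| |]// [W'| |]//.
move=> S0 Sc W0 We; rewrite lee_fin in S0; rewrite lee_fin in Sc; rewrite lee_fin in W0; rewrite lte_fin in We.
suff : (1 + eta) * (Qm m (zsub z h) + W') + (1 + eta^-1) * S' <= t by rewrite -lee_fin.
have k1 : (1 + eta^-1) * S' <= (1 + eta^-1) * c by rewrite ler_wpM2l.
have k2 : eta * (Qm m (zsub z h) + W') <= eta * T by rewrite ler_wpM2l ?(ltW eta0)//; lra.
lra.
Qed.

Lemma iter_obs_shift f (fd : dens_alt f) n k g b z :
  iter k (obs_op fd n) (fun z => g (zsub z b)) z = iter k (obs_op fd n) g (zsub z b).
Proof.
elim: k z => // k IH z /=; rewrite /obs_op /stepop; apply: eq_integral => x _.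
rewrite -/(obs_op fd n) IH; congr (iter _ _ _ _); apply/funext => j.
by rewrite /zsub /zadd addrAC.
Qed.

Lemma chi_le_ind (s tau : R) z : 0 < s -> ((chi s tau (z 0%N))%:E <= ind tau z)%E.
Proof.
move=> s0; rewrite /ind lee_fin; have [/andP[c0 c1] _ _] := chi_bounds tau (z 0%N) s0.
have [zt|tz] := leP (z 0%N) tau; first by [].
by have [-> _ _] := chi_far s0 (ltW tz).
Qed.

Lemma ind_le_chi (s tau : R) z : 0 < s -> (ind (tau - 3 / s) z <= (chi s tau (z 0%N))%:E)%E.
Proof.
move=> s0; rewrite /ind lee_fin; have [/andP[c0 c1] _ _] := chi_bounds tau (z 0%N) s0.
by have [zt|tz] := leP (z 0%N) (tau - 3 / s); [rewrite chi_near|].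
Qed.

Lemma chi0_good (s tau : R) : 0 < s -> good (fun z : Z => (chi s tau (z 0%N))%:E).
Proof.
move=> s0; apply: good_EFin => [z|d T zt mzt].
  by have [/andP[]] := chi_bounds tau (z 0%N) s0.
apply: (measurableT_comp measurable_spl).
by apply: measurable_funM => //; exact: measurable_funB.
Qed.

End acceptance_bounds.

(** * Power bounds uniform in the threshold *)

Section power.
Context {R : realType}.
Local Notation Z := (nat -> R).
Implicit Types (f : R -> R) (b z h : Z).

(** Distribution function of the first [m] terms of the limiting null law; it stands in for the full
    limit throughout. *)
Definition null_cdf m (t : R) : R := fine (KX predT m (fun=> 0%R) (ind t) (fun=> 0%R)).

Lemma null_cdfE m t : KX predT m (fun=> 0%R) (ind t) (fun=> 0%R) = (null_cdf m t)%:E.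
Proof.
rewrite /null_cdf fineK// ge0_fin_numE; last by apply: good_ge0; apply: KX_good; exact: ind_good.
by rewrite (le_lt_trans (KX_le1 _ _ _ (ind_good t) (ind_le1 t) _))// ltry.
Qed.

Lemma null_cdf_mono m (t t' : R) : t <= t' -> null_cdf m t <= null_cdf m t'.
Proof.
move=> tt'; rewrite -lee_fin -!null_cdfE; apply: le_KX => [||z]; [exact: ind_good|exact: ind_good|].
by rewrite lee_fin ler_nat; case: (leP (z 0%N) t) => // h; rewrite (le_trans h tt').
Qed.

Lemma null_cdf_band m (t d : R) : (0 < m)%N -> 0 <= d -> null_cdf m (t + d) <= null_cdf m t + 2 * Num.sqrt (d / lam 0).
Proof.
by move=> m0 d0; rewrite -lee_fin EFinD -!null_cdfE; exact: KX_band.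
Qed.

Lemma iter_mono f (fd : dens_alt f) n g1 g2 z : good g1 -> good g2 -> (forall z, g1 z <= g2 z)%E ->
  (iter n (obs_op fd n) g1 z <= iter n (obs_op fd n) g2 z)%E.
Proof. by move=> h1 h2 h; have [_ le _ _ _] := op_ok_iter n (obs_op_ok fd n); exact: le. Qed.

Lemma iter_add_scale f (fd : dens_alt f) n g1 g2 (c : R) z : good g1 -> good g2 -> 0 <= c ->
  iter n (obs_op fd n) (fun z => g1 z + c%:E * g2 z)%E z =
  (iter n (obs_op fd n) g1 z + c%:E * iter n (obs_op fd n) g2 z)%E.
Proof.
move=> h1 h2 c0; have [_ _ AD AZ _] := op_ok_iter n (obs_op_ok fd n).
rewrite AD ?AZ//; apply: goodM => //; exact: good_cst.
Qed.

Lemma good_add_scale (g1 g2 : Z -> \bar R) (c : R) : good g1 -> good g2 -> 0 <= c -> good (fun z => g1 z + c%:E * g2 z)%E.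
Proof. by move=> h1 h2 c0; apply: goodD => //; apply: goodM => //; exact: good_cst. Qed.

Lemma acc_upper m (d T eps : R) : 0 < d -> 1 <= T -> 0 < eps ->
  exists2 e1 : R, 0 < e1 & exists n0 : nat, forall n, (n0 <= n)%N ->
  forall f (fd : dens_alt f), L2norm f <= e1 -> forall t, t <= T ->
  (acc_prob fd n t <= KX predT m (drift f n) (ind (t + d)%R) (fun=> 0%R) + eps%:E)%E.
Proof.
move=> d0 T1 eps0; have s0 : 0 < 3 / d by rewrite divr_gt0.
have sE : 3 / (3 / d) = d by field; rewrite gt_eqF.
have Td : 1 <= T + d by lra.
have [e1 e10 [n0 H]] := obs_clt m s0 Td eps0.
exists e1 => //; exists n0 => n nn f fd fe t tT.
have [H1 _] := H n nn f fd fe (t + d) (drift f n) (lerD tT (lexx d)).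
apply: (@le_trans _ _ (iter n (obs_op fd n) (fun z => (chi (3 / d) (t + d) (Qm m z))%:E) (drift f n))).
  apply: iter_mono; [exact: accept_good|exact: chiQm_good|move=> z].
  by rewrite -[X in (t + X)%R]sE; exact: accept_le_chi.
apply: (le_trans H1); rewrite leeD2r//; apply: le_KX => [||z]; [exact: chi0_good|exact: ind_good|].
exact: chi_le_ind.
Qed.

Lemma tail_form_self m h : tail_form m h h = 0%E.
Proof. by rewrite /tail_form eseries0// => j _ _; rewrite subrr expr0n !mulr0. Qed.

Lemma tail_drift_self f (fd : dens_alt f) n m : (0 < n)%N -> (0 < m)%N ->
  (iter n (obs_op fd n) (tail_form m (drift f n)) (drift f n) <= (2 / m%:R)%:E)%E.
Proof.
move=> n0 m0; have := tail_drift fd (drift f n) (drift f n) n0 (fun k => sum_lam_tail_bound k m0).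
by rewrite tail_form_self add0e.
Qed.

Lemma acc_tail_upper m (c T eps : R) : (0 < m)%N -> 0 < c -> 1 <= T -> 0 < eps ->
  exists2 e1 : R, 0 < e1 & exists n0 : nat, forall n, (n0 <= n)%N ->
  forall f (fd : dens_alt f), L2norm f <= e1 -> forall t, t <= T ->
  (c%:E <= tail_form m (fun=> 0%R) (drift f n))%E ->
  (acc_prob fd n t <= (null_cdf m (t - c / 8) + eps + 8 / (c * m%:R))%:E)%E.
Proof.
(* Of the lowering [c / 4] produced by the tail signal, [c / 8] is given back for smoothing:
   [3 / s = c / 8]. *)
move=> m0 c0 T1 eps0; have s0 : 0 < 24 / c by rewrite divr_gt0.
have sE : 3 / (24 / c) = c / 8 by field; rewrite gt_eqF.
have [e1 e10 [n0 H]] := obs_clt m s0 T1 eps0.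
exists e1 => //; exists n0.+1 => n nn f fd fe t tT hc.
have n1 : (0 < n)%N by exact: leq_ltn_trans nn.
have tT' : t - c / 8 <= T by lra.
have [H1 _] := H n (ltnW nn) f fd fe _ (drift f n) tT'.
have c40 : 0 <= 4 / c by rewrite divr_ge0// ltW.
have g1 := @chiQm_good R m _ (t - c / 8) s0; have g2 := tail_form_good m (drift f n).
apply: (@le_trans _ _ (iter n (obs_op fd n) (fun z => (chi (24 / c) (t - c / 8) (Qm m z))%:E +
    (4 / c)%:E * tail_form m (drift f n) z)%E (drift f n))).
  apply: iter_mono; [exact: accept_good|exact: good_add_scale|move=> z].
  have := @accept_le_tail R m _ t c (drift f n) z s0 c0 hc.
  by rewrite sE (_ : t - c / 4 + c / 8 = t - c / 8)//; field.
rewrite iter_add_scale// EFinD; apply: leeD.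
  apply: (le_trans H1); rewrite EFinD leeD2r// -null_cdfE.
  apply: (@le_trans _ _ (KX predT m (drift f n) (ind (t - c / 8)%R) (fun=> 0%R))); last first.
    by apply: KX_anderson; [exact: ind_good|exact: ind_noninc|exact: ind_le1].
  by apply: le_KX => [||z]; [exact: chi0_good|exact: ind_good|exact: chi_le_ind].
apply: (@le_trans _ _ ((4 / c)%:E * (2 / m%:R)%:E)%E).
  by apply: lee_wpmul2l; [rewrite lee_fin|exact: tail_drift_self].
rewrite -EFinM lee_fin (_ : 4 / c * (2 / m%:R) = 8 / (c * m%:R))//.
by field; rewrite (gt_eqF c0) pnatr_eq0 -lt0n m0.
Qed.

(** A signal below [c] costs little. The level loses [2 * e] in [chi_le_accept], used with
    [eta = e / (2 * T)], and [e] in smoothing; the term [2 / (e * m)] is the mean tail noise over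
    [e]. *)
Lemma acc_lower m (e c T eps : R) : (0 < m)%N -> 0 < e -> 1 <= T -> 0 < eps ->
  (1 + 2 * T / e) * c <= e / 2 ->
  exists2 e1 : R, 0 < e1 & exists n0 : nat, forall n, (n0 <= n)%N ->
  forall f (fd : dens_alt f), L2norm f <= e1 -> (total_form (drift f n) <= c%:E)%E ->
  forall t, t <= T ->
  ((null_cdf m (t - 3 * e))%:E <= acc_prob fd n t + (eps + 2 / (e * m%:R))%:E)%E.
Proof.
move=> m0 e0 T1 eps0 ce; have s0 : 0 < 3 / e by rewrite divr_gt0.
have T0 : 0 < T by lra.
have sE : 3 / (3 / e) = e by field; rewrite gt_eqF.
have [e1 e10 [n0 H]] := obs_clt m s0 T1 eps0.
exists e1 => //; exists n0.+1 => n nn f fd fe hc t tT.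
have n1 : (0 < n)%N by exact: leq_ltn_trans nn.
have tT' : t - 2 * e <= T by lra.
have [_ H2] := H n (ltnW nn) f fd fe _ (fun=> 0) tT'.
have ie0 : 0 <= e^-1 by rewrite invr_ge0 ltW.
have g1 := @chiQm_good R m _ (t - 2 * e) s0; have g2 := tail_form_good m (drift f n).
have g3 : good (fun z => (chi (3 / e) (t - 2 * e) (Qm m (zsub z (drift f n))))%:E).
  apply: good_EFin => [z|d T' zt mzt].
    by have [/andP[]] := chi_bounds (t - 2 * e) (Qm m (zsub z (drift f n))) s0.
  apply: (measurableT_comp measurable_spl); apply: measurable_funM => //; apply: measurable_funB => //.
  apply: measurable_sum => i; apply: measurable_funM => //; apply: measurable_funX; exact: measurable_funB.
rewrite -null_cdfE.
apply: (@le_trans _ _ (KX predT m (fun=> 0%R) (fun z => (chi (3 / e) (t - 2 * e) (z 0%N))%:E) (fun=> 0%R))).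
  apply: le_KX => [||z]; [exact: ind_good|exact: chi0_good|].
  by have := @ind_le_chi R _ (t - 2 * e) z s0; rewrite sE (_ : t - 2 * e - e = t - 3 * e)//; ring.
apply: (le_trans H2); rewrite (addrC eps) EFinD addeA; apply: leeD => //.
have -> : (fun=> 0) = zsub (drift f n) (drift f n) by apply/funext => j; rewrite /zsub subrr.
rewrite -(iter_obs_shift fd n n (fun z => (chi (3 / e) (t - 2 * e) (Qm m z))%:E)).
apply: (@le_trans _ _ (iter n (obs_op fd n) (fun z => accept t z + (e^-1)%:E * tail_form m (drift f n) z)%E (drift f n))).
  apply: iter_mono => [//||z]; first by apply: good_add_scale => //; exact: accept_good.
  apply: (@chi_le_accept R m _ t e T (e / (2 * T)) c) => //.
  - by rewrite divr_gt0// mulr_gt0.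
  - by rewrite le_eqVlt; apply/orP; left; apply/eqP; field; rewrite gt_eqF.
  - by rewrite invf_div.
rewrite iter_add_scale//; last exact: accept_good.
apply: leeD => //; apply: (@le_trans _ _ ((e^-1)%:E * (2 / m%:R)%:E)%E).
  by apply: lee_wpmul2l; [rewrite lee_fin|exact: tail_drift_self].
rewrite -EFinM lee_fin (_ : e^-1 * (2 / m%:R) = 2 / (e * m%:R))//.
by field; rewrite (gt_eqF e0) pnatr_eq0 -lt0n m0.
Qed.

Lemma drift0 n : drift (fun _ : R => 0 : R) n = (fun=> 0).
Proof.
apply/funext => j; rewrite /drift /coef (_ : (fun t => _) = (fun=> 0)) ?Rintegral_cst ?mulr0//.
by apply/funext => t; rewrite mul0r.
Qed.

Lemma L2norm0 : L2norm (fun _ : R => 0 : R) = 0.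
Proof. by rewrite /L2norm; under eq_integral do rewrite expr0n/=; rewrite integral0 sqrtr0. Qed.

Lemma total_form0 : total_form (fun _ : nat => 0 : R) = 0%E.
Proof. exact: tail_form_self. Qed.

Lemma small_sqrt (x : R) : 0 < x -> exists2 e : R, 0 < e <= 1 & 2 * Num.sqrt (4 * e / lam 0) <= x.
Proof.
move=> x0; have l0 := @lam_gt0 R 0.
exists (Num.min 1 (lam 0 * x ^+ 2 / 16)).
  by rewrite lt_min ltr01 ge_min lexx/= andbT divr_gt0// mulr_gt0// exprn_gt0.
rewrite -ler_pdivlMl// [leRHS]mulrC -[x / 2]ger0_norm ?divr_ge0 ?(ltW x0)// -sqrtr_sqr ler_wsqrtr//.
rewrite ler_pdivrMr// exprMn exprVn.
have : Num.min 1 (lam 0 * x ^+ 2 / 16) <= lam 0 * x ^+ 2 / 16 by rewrite ge_min lexx orbT.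
have -> : x ^+ 2 / 2 ^+ 2 * lam 0 = 4 * (lam 0 * x ^+ 2 / 16) by field.
lra.
Qed.

Lemma ex_nat_inv_le (x c : R) : 0 < x -> 0 <= c -> exists2 M : nat, (0 < M)%N & forall m, (M <= m)%N -> c / m%:R <= x.
Proof.
move=> x0 c0; exists (Num.truncn (c / x)).+1 => // m Mm.
have m0 : 0 < m%:R :> R by rewrite ltr0n; exact: leq_ltn_trans Mm.
rewrite ler_pdivrMr// mulrC -ler_pdivrMr//; apply: (@le_trans _ _ (Num.truncn (c / x)).+1%:R).
  by rewrite ltW// truncnS_gt.
by rewrite ler_nat.
Qed.

Definition accR f (fd : dens_alt f) n t : R := fine (acc_prob fd n t).

Lemma accRE f (fd : dens_alt f) n t : acc_prob fd n t = (accR fd n t)%:E.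
Proof. by rewrite /accR fineK// acc_prob_fin. Qed.

Lemma accR_bounds f (fd : dens_alt f) n t : 0 <= accR fd n t <= 1.
Proof. by have := acc_prob_bounds fd n t; rewrite accRE !lee_fin. Qed.

Lemma acc_null_upper m (d T eps : R) : 0 < d -> 1 <= T -> 0 < eps ->
  exists n0 : nat, forall n, (n0 <= n)%N -> forall t, t <= T ->
  accR dens_alt0 n t <= null_cdf m (t + d) + eps.
Proof.
move=> d0 T1 eps0; have [e1 e10 [n0 H]] := acc_upper m d0 T1 eps0; exists n0 => n nn t tT.
have := H n nn _ dens_alt0; rewrite L2norm0 => /(_ (ltW e10) t tT).
by rewrite drift0 null_cdfE accRE -EFinD lee_fin.
Qed.

(** Carries a null acceptance probability at [t] to the Gaussian level [t + e] and back. The upper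
    bound shifts the level up by [e], the lower one down by [3 * e], and anticoncentration bridges
    the [4 * e] between them. Both [e] and [M] precede [m], so that [m] can be enlarged later. *)
Lemma null_sandwich (eta b T : R) : 0 < eta -> 0 < b -> 1 <= T ->
  exists2 e : R, 0 < e <= 1 & exists2 M : nat, (0 < M)%N & forall m, (M <= m)%N -> exists n0 : nat, forall n, (n0 <= n)%N ->
  forall t, t <= T -> b <= accR dens_alt0 n t ->
  b / 2 <= null_cdf m (t + e) /\ null_cdf m (t + e) <= accR dens_alt0 n t + eta.
Proof.
move=> eta0 b0 T1; have eta3 : 0 < eta / 3 by rewrite divr_gt0.
have [e /andP[e0 e1] eS] := small_sqrt eta3.
exists e; first by rewrite e0.
have e2 : 0 <= 2 / e by rewrite divr_ge0// ltW.
have [M M0 HM] := ex_nat_inv_le eta3 e2.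
exists M => // m Mm; have m0 : (0 < m)%N by exact: leq_trans Mm.
have b2 : 0 < b / 2 by rewrite divr_gt0.
have [n1 H1] := @acc_null_upper m e T (b / 2) e0 T1 b2.
have c0 : (1 + 2 * T / e) * 0 <= e / 2 by rewrite mulr0 divr_ge0// ltW.
have [x x0 [n2 H2]] := acc_lower m0 e0 T1 eta3 c0.
exists (maxn n1 n2) => n; rewrite geq_max => /andP[nn1 nn2] t tT bt.
have h1 := H1 n nn1 t tT; split; first by lra.
have := H2 n nn2 _ dens_alt0; rewrite L2norm0 drift0 total_form0 => /(_ (ltW x0) (lexx _) t tT).
rewrite accRE -EFinD lee_fin => h2.
have e4 : 0 <= 4 * e by lra.
have := null_cdf_band (t - 3 * e) m0 e4.
rewrite (_ : t - 3 * e + 4 * e = t + e); last by ring.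
have := HM m Mm; rewrite (_ : 2 / e / m%:R = 2 / (e * m%:R)); last by rewrite invfM mulrA.
lra.
Qed.

Lemma finite_min (J : nat) (P : nat -> R -> Prop) :
  (forall j x y, P j x -> 0 < y <= x -> P j y) -> (forall j, exists2 x, 0 < x & P j x) ->
  exists2 x, 0 < x & forall j, (j < J)%N -> P j x.
Proof.
move=> Pd Pex; elim: J => [|J [x x0 xP]]; first by exists 1.
have [y y0 yP] := Pex J; exists (Num.min x y); first by rewrite lt_min x0.
have m0 : 0 < Num.min x y by rewrite lt_min x0.
move=> j; rewrite ltnS leq_eqVlt => /orP[/eqP ->|jJ].
  by apply: (Pd _ y) => //; rewrite m0 ge_min lexx orbT.
by apply: (Pd _ x) (xP _ jJ) _; rewrite m0 ge_min lexx.
Qed.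

(** The signal is split at a fixed index [J]. If half of it lies beyond [J], it acts as a lower
    level and [gap_level] applies; otherwise some coordinate below [J] carries at least
    [c0 / (2 * J)] and [gap_shift] applies. *)
Lemma power_gap (c0 b T : R) : 0 < c0 -> 0 < b -> 1 <= T ->
  exists2 ka : R, 0 < ka & exists2 e1 : R, 0 < e1 & exists n0 : nat, forall n, (n0 <= n)%N ->
  forall f (fd : dens_alt f), L2norm f <= e1 -> forall t, t <= T ->
  (c0%:E <= total_form (drift f n))%E -> b <= accR dens_alt0 n t ->
  accR fd n t + ka <= accR dens_alt0 n t.
Proof.
move=> c00 b0 T1; pose c := c0 / 2.
have cp : 0 < c by rewrite divr_gt0.
have b2 : 0 < b / 2 by rewrite divr_gt0.
have T2 : 0 <= T + 1 by lra.
have c16 : 0 < c / 16 by rewrite divr_gt0.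
have [eA eA0 gA] := gap_level c16 b2 T2.
have eA4 : 0 < eA / 4 by rewrite divr_gt0.
have [dA /andP[dA0 dA1] [MA MA0 sA]] := null_sandwich eA4 b0 T1.
have c8 : 0 <= 8 / c by rewrite divr_ge0// ltW.
have [M1 M10 HM1] := ex_nat_inv_le eA4 c8.
(* Beyond [MA] the sandwich holds, beyond [M1] the tail noise is small against [eA], and the 2
   secures the indices 0 and 1 used for anticoncentration. *)
pose J := (MA + M1 + 2)%N.
have J0 : (0 < J)%N by rewrite /J addn2.
have [nA1 sA'] : exists n0 : nat, forall n, (n0 <= n)%N ->
  forall t, t <= T -> b <= accR dens_alt0 n t ->
  b / 2 <= null_cdf J (t + dA) /\ null_cdf J (t + dA) <= accR dens_alt0 n t + eA / 4.
  by apply: sA; rewrite /J -addnA leq_addr.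
have [eA1 eA10 [nA2 uA]] := acc_tail_upper J0 cp T1 eA4.
have cB : 0 < c0 / (2 * J%:R) by rewrite divr_gt0// mulr_gt0// ltr0n.
(* The gain of [gap_shift] depends on the coordinate; one value serves the finitely many candidates
   below [J], and [m] is chosen from it afterwards. *)
have [eB eB0 gB] : exists2 eta : R, 0 < eta & forall j0, (j0 < J)%N ->
    forall (m : nat) (t : R) (h : Z), (j0 < m)%N -> (1 < m)%N -> t <= T + 1 ->
    c0 / (2 * J%:R) <= lam j0 * h j0 ^+ 2 -> ((b / 2)%:E <= KX predT m (fun=> 0%R) (ind t) (fun=> 0%R))%E ->
  (KX predT m h (ind t) (fun=> 0%R) + eta%:E <= KX predT m (fun=> 0%R) (ind t) (fun=> 0%R))%E.
  apply: (@finite_min J (fun j0 eta => forall (m : nat) (t : R) (h : Z), (j0 < m)%N -> (1 < m)%N -> t <= T + 1 ->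
    c0 / (2 * J%:R) <= lam j0 * h j0 ^+ 2 -> ((b / 2)%:E <= KX predT m (fun=> 0%R) (ind t) (fun=> 0%R))%E ->
  (KX predT m h (ind t) (fun=> 0%R) + eta%:E <= KX predT m (fun=> 0%R) (ind t) (fun=> 0%R))%E)).
    move=> j x y H /andP[y0 yx] m t h h1 h2 h3 h4 h5; apply: le_trans (H m t h h1 h2 h3 h4 h5).
    by rewrite leeD2l// lee_fin.
  by move=> j; exact: gap_shift.
have eB4 : 0 < eB / 4 by rewrite divr_gt0.
have [dB /andP[dB0 dB1] [MB MB0 sB]] := null_sandwich eB4 b0 T1.
pose m := (MB + J)%N.
have [nB1 sB'] : exists n0 : nat, forall n, (n0 <= n)%N ->
  forall t, t <= T -> b <= accR dens_alt0 n t ->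
  b / 2 <= null_cdf m (t + dB) /\ null_cdf m (t + dB) <= accR dens_alt0 n t + eB / 4.
  by apply: sB; rewrite /m leq_addr.
have [eB1 eB10 [nB2 uB]] := acc_upper m dB0 T1 eB4.
exists (Num.min (eA / 4) (eB / 4)); first by rewrite lt_min eA4 eB4.
exists (Num.min eA1 eB1); first by rewrite lt_min eA10 eB10.
exists (nA1 + nA2 + nB1 + nB2)%N => n nn f fd; rewrite le_min => /andP[fA fB] t tT hc0 bt.
have nnA1 : (nA1 <= n)%N by rewrite (leq_trans _ nn)// -!addnA leq_addr.
have nnA2 : (nA2 <= n)%N by rewrite (leq_trans _ nn)// (addnC nA1) -!addnA leq_addr.
have nnB1 : (nB1 <= n)%N by rewrite (leq_trans _ nn)// addnAC leq_addl.
have nnB2 : (nB2 <= n)%N by rewrite (leq_trans _ nn)// leq_addl.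
have [s1 s2] := sA' n nnA1 t tT bt.
have [s3 s4] := sB' n nnB1 t tT bt.
have mn1 : Num.min (eA / 4) (eB / 4) <= eA / 4 by rewrite ge_min lexx.
have mn2 : Num.min (eA / 4) (eB / 4) <= eB / 4 by rewrite ge_min lexx orbT.
have J1 : (1 < J)%N by rewrite /J addn2.
have [cT|Tc] := leP c%:E (tail_form J (fun=> 0) (drift f n)).
  have := uA n nnA2 f fd fA t tT cT; rewrite accRE lee_fin => h1.
  have tT1 : t + dA <= T + 1 by lra.
  have := gA J (t + dA) J1 tT1; rewrite !null_cdfE !lee_fin => /(_ s1) h2.
  have h3 : null_cdf J (t - c / 8) <= null_cdf J (t + dA - c / 16) by apply: null_cdf_mono; lra.
  have h4 := HM1 J; rewrite (_ : 8 / c / J%:R = 8 / (c * J%:R)) in h4; last by rewrite (invfM c) mulrA.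
  have h5 := h4 (leq_trans (leq_addl MA M1) (leq_addr 2 _)).
  lra.
have Qc : c <= Qm J (drift f n).
  move: hc0; rewrite (form_split0 J).
  move: Tc; have := tail_form_ge0 J (fun=> 0) (drift f n).
  case: (tail_form _ _ _) => [y| |]//; rewrite lte_fin lee_fin -EFinD lee_fin /c; lra.
(* Pigeonhole: the [J] terms of the head add up to at least [c0 / 2]. *)
have [j0 hj0] : exists j0 : 'I_J, c0 / (2 * J%:R) <= lam j0 * drift f n j0 ^+ 2.
  apply: contrapT => /forallNP H; move: Qc; apply/negP; rewrite -ltNge.
  have -> : c = \sum_(j < J) c0 / (2 * J%:R).
    rewrite sumr_const card_ord -mulr_natr /c; field; rewrite pnatr_eq0 -lt0n J0//.
  apply: ltr_sum => [|i _]; first by apply/hasP; exists (Ordinal J0); rewrite ?mem_index_enum.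
  by rewrite ltNge; apply/negP; exact: H.
have := uB n nnB2 f fd fB t tT; rewrite accRE => h1.
have tT1 : t + dB <= T + 1 by lra.
have j0m : (j0 < m)%N by rewrite (leq_trans (ltn_ord j0))// leq_addl.
have m1 : (1 < m)%N by rewrite (leq_trans J1)// leq_addl.
have := gB j0 (ltn_ord j0) m (t + dB) (drift f n) j0m m1 tT1 hj0.
rewrite !null_cdfE lee_fin => /(_ s3) h2.
have : ((accR fd n t)%:E + eB%:E <= (null_cdf m (t + dB))%:E + (eB / 4)%:E)%E.
  apply: (le_trans (leeD h1 (lexx eB%:E))); rewrite addeAC.
  by rewrite leeD2r.
rewrite -!EFinD lee_fin; lra.
Qed.

(** Markov's inequality for the statistic, whose mean is at most the signal plus twice the sum of
    the weights. *)
Lemma accept_markov f (fd : dens_alt f) n (t T c : R) : (0 < n)%N -> 0 < T <= t ->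
  (total_form (drift f n) <= c%:E)%E -> 1 <= accR fd n t + T^-1 * (c + 2 * (lam 0 + 1)).
Proof.
move=> n0 /andP[T0 Tt] hc.
have iT0 : 0 <= T^-1 by rewrite invr_ge0 ltW.
have gt := tail_form_good 0 (fun _ : nat => 0 : R).
have [_ _ _ _ Ac] := op_ok_iter n (obs_op_ok fd n).
have h : (1 <= acc_prob fd n t + (T^-1)%:E * iter n (obs_op fd n) total_form (drift f n))%E.
  rewrite -iter_add_scale//; last exact: accept_good.
  rewrite -{1}(Ac 1%E (drift f n)); apply: iter_mono => [||z]; first exact: (@good_cst _ 1).
    by apply: good_add_scale => //; exact: accept_good.
  have S0 := tail_form_ge0 0 (fun=> 0) z; rewrite -/(total_form z) in S0.
  rewrite acceptP; case: ifPn => [_|].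
    by rewrite leeDl// mule_ge0// lee_fin.
  rewrite -ltNge add0e => tS; apply: (@le_trans _ _ ((T^-1)%:E * T%:E)%E).
    by rewrite -EFinM lee_fin mulVf// gt_eqF.
  apply: lee_wpmul2l; first by rewrite lee_fin.
  by rewrite ltW// (le_lt_trans _ tS)// lee_fin.
have hL k : \sum_(0 <= j < k) (0 <= j)%N%:R * lam j <= lam 0 + 1 :> R.
  by under eq_bigr do rewrite mul1r; exact: sum_lam_le.
have dr := tail_drift fd (fun=> 0) (drift f n) n0 hL.
have h3 : (iter n (obs_op fd n) total_form (drift f n) <= (c + 2 * (lam 0 + 1))%:E)%E.
  by apply: (le_trans dr); rewrite EFinD leeD2r.
have h4 : ((T^-1)%:E * iter n (obs_op fd n) total_form (drift f n) <= (T^-1 * (c + 2 * (lam 0 + 1)))%:E)%E.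
  by rewrite EFinM; apply: lee_wpmul2l; rewrite ?lee_fin.
by have := le_trans h (leeD (lexx (acc_prob fd n t)) h4); rewrite accRE -EFinD lee_fin.
Qed.

(** The threshold is arbitrary. Up to [T] both laws are compared with the same Gaussian sum; beyond
    [T] the alternative is accepted with probability at least [1 - eps] by Markov, and the null
    probability is at most 1. *)
Lemma no_power (eps : R) : 0 < eps -> exists2 c : R, 0 < c & exists2 e1 : R, 0 < e1 &
  exists n0 : nat, forall n, (n0 <= n)%N -> forall f (fd : dens_alt f), L2norm f <= e1 ->
  (total_form (drift f n) <= c%:E)%E -> forall t, accR dens_alt0 n t <= accR fd n t + eps.
Proof.
move=> eps0; pose L : R := lam 0 + 1.
have L0 : 0 < L by rewrite addr_gt0// lam_gt0.
pose T : R := 1 + (1 + 2 * L) / eps.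
have T1 : 1 <= T by rewrite lerDl divr_ge0 ?(ltW eps0)//; lra.
have T0 : 0 < T by lra.
have TE : T^-1 * (1 + 2 * L) <= eps.
  rewrite mulrC ler_pdivrMr// (_ : eps * T = eps + (1 + 2 * L)); first by lra.
  by rewrite /T; field; rewrite gt_eqF.
have eps4 : 0 < eps / 4 by rewrite divr_gt0.
have [e /andP[e0 e1] eS] := small_sqrt eps4.
have d0 : 0 < 1 + 2 * T / e by rewrite addr_gt0// divr_gt0// mulr_gt0.
pose c : R := Num.min 1 (e / 2 / (1 + 2 * T / e)).
have c0 : 0 < c by rewrite lt_min ltr01 !divr_gt0.
have c1 : c <= 1 by rewrite ge_min lexx.
have ce : (1 + 2 * T / e) * c <= e / 2 by rewrite mulrC -ler_pdivlMr// ge_min lexx orbT.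
have e2 : 0 <= 2 / e by rewrite divr_ge0// ltW.
have [m m0 Hm] := ex_nat_inv_le eps4 e2.
have [n1 H1] := acc_null_upper m e0 T1 eps4.
have [x x0 [n2 H2]] := acc_lower m0 e0 T1 eps4 ce.
exists c => //; exists x => //; exists (maxn n1 n2).+1 => n nn f fd fx hc t.
have n0 : (0 < n)%N by exact: leq_ltn_trans nn.
move: (ltnW nn); rewrite geq_max => /andP[nn1 nn2].
have /andP[_ a1] := accR_bounds dens_alt0 n t.
have [tT|Tt] := leP t T.
  have h1 := H1 n nn1 t tT.
  have := H2 n nn2 f fd fx hc t tT; rewrite accRE -EFinD lee_fin => h2.
  have e4 : 0 <= 4 * e by lra.
  have := null_cdf_band (t - 3 * e) m0 e4.
  rewrite (_ : t - 3 * e + 4 * e = t + e); last by ring.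
  have := Hm m (leqnn m); rewrite (_ : 2 / e / m%:R = 2 / (e * m%:R)); last by rewrite invfM mulrA.
  lra.
have := accept_markov fd n0 (t := t) (T := T) (c := c) _ hc; rewrite T0 (ltW Tt) => /(_ isT).
have : T^-1 * (c + 2 * L) <= T^-1 * (1 + 2 * L) by rewrite ler_wpM2l ?invr_ge0 ?(ltW T0)// lerD2r.
rewrite -/L; lra.
Qed.

End power.

(** * Besov bodies *)

Section bodies.
Context {R : realType}.
Local Notation mu := (@lebesgue_measure R).
Local Notation U := (@unit_oi R).
Local Notation E := (Rintegral (@leb R) U).
Implicit Types (f g : R -> R) (s l : R).

Lemma BbarP s (P0 : R) f : Bbar s P0 f <-> L2_0 f /\
  forall l, 0 < l -> forall m : nat, l `^ (2 * s) * \sum_(0 <= j < m | l < j%:R) coef f j ^+ 2 <= P0.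
Proof.
have sq0 j : (0 <= (coef f j ^+ 2)%:E :> \bar R)%E by rewrite lee_fin sqr_ge0.
split=> -[hf H]; split => // l l0.
  move=> m; rewrite -lee_fin EFinM; apply: le_trans (H l l0).
  apply: lee_wpmul2l; first by rewrite lee_fin powR_ge0.
  rewrite -sumEFin; apply: (@nneseries_lim_ge _ (fun j => (coef f j ^+ 2)%:E) (nat_gt l) 0 m) => j _ _.
  exact: sq0.
rewrite -nneseriesZl; last by move=> j _; exact: sq0.
apply: lime_le.
  by apply: is_cvg_nneseries => j _ _; rewrite -EFinM lee_fin mulr_ge0 ?powR_ge0 ?sqr_ge0.
apply: nearW => m; under eq_bigr do rewrite -EFinM.
by rewrite sumEFin lee_fin -mulr_sumr; exact: H.
Qed.

(** A positive radius excludes the index 0, which reconciles the unshifted sums of the body with the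
    shifted ones used elsewhere. *)
Lemma sum_pos_index l (u : nat -> R) m : 0 < l ->
  \sum_(0 <= j < m.+1 | l < j%:R) u j = \sum_(j < m | l < j.+1%:R) u j.+1.
Proof.
move=> l0; rewrite big_mkcond/= big_nat_recl//= ltNge (ltW l0)/= add0r.
by rewrite -big_mkcond/= big_mkord.
Qed.

Lemma sum_pos_le l (u v : nat -> R) m : 0 < l -> (forall j, (0 < j)%N -> u j <= v j) ->
  \sum_(0 <= j < m | l < j%:R) u j <= \sum_(0 <= j < m | l < j%:R) v j.
Proof.
move=> l0 uv; apply: ler_sum => j lj; apply: uv.
by rewrite -(ltr0n R) (lt_trans l0).
Qed.

Lemma L2norm_le f (M : R) : 0 <= M -> E (fun x => f x ^+ 2) <= M ^+ 2 -> L2norm f <= M.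
Proof. by move=> M0; rewrite -L2norm_sqr ler_pXn2r ?nnegrE ?sqrtr_ge0. Qed.

Lemma Bbar_bounded s (P0 : R) : bounded_L2 (@Bbar R s P0).
Proof.
(* At radius 1/2 every frequency counts, so the condition bounds the whole energy; Parseval turns it
   into a bound on the norm. *)
have h0 : 0 < 2^-1 :> R by rewrite invr_gt0.
pose k : R := 2^-1 `^ (2 * s).
have k0 : 0 < k by exact: powR_gt0.
exists (Num.sqrt (P0 / k)) => f /BbarP[f0 H].
have part m : \sum_(j < m) coef f j.+1 ^+ 2 <= P0 / k.
  rewrite ler_pdivlMr// mulrC; have := H _ h0 m.+1; rewrite sum_pos_index//.
  rewrite (eq_bigl xpredT)// => j.
  by rewrite (@lt_le_trans _ _ 1)// ?ler1n// invf_lt1// ltr1n.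
have M0 : 0 <= P0 / k by have := part 0%N; rewrite big_ord0.
by apply: L2norm_le; rewrite ?sqrtr_ge0// sqr_sqrtr//; exact: parseval_le.
Qed.

Lemma Bbar_convex s (P0 : R) : Defs.convex_set (@Bbar R s P0).
Proof.
move=> f g Uf Ug l /andP[l0 l1].
have [f0 Hf] := proj1 (BbarP _ _ _) Uf; have [g0 Hg] := proj1 (BbarP _ _ _) Ug.
apply: (proj2 (BbarP _ _ _)); split; first exact: L2_0_comb.
move=> x x0 m.
have h : \sum_(0 <= j < m | x < j%:R) coef (fun t => l * f t + (1 - l) * g t) j ^+ 2 <=
   l * (\sum_(0 <= j < m | x < j%:R) coef f j ^+ 2) + (1 - l) * \sum_(0 <= j < m | x < j%:R) coef g j ^+ 2.
  rewrite !mulr_sumr -big_split/=; apply: ler_sum => j _.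
  rewrite coef_comb; [|exact: L2_0_L2|exact: L2_0_L2].
  move: (coef f j) (coef g j) => a b.
  have : 0 <= l * (1 - l) * (a - b) ^+ 2 by apply: mulr_ge0; [rewrite mulr_ge0// subr_ge0|exact: sqr_ge0].
  have -> : l * a ^+ 2 + (1 - l) * b ^+ 2 = (l * a + (1 - l) * b) ^+ 2 + l * (1 - l) * (a - b) ^+ 2 by ring.
  by move=> ?; rewrite lerDl.
have p0 := powR_ge0 x (2 * s).
have := ler_wpM2l p0 h; have := ler_wpM2l l0 (Hf x x0 m).
have l1' : 0 <= 1 - l by rewrite subr_ge0.
have := ler_wpM2l l1' (Hg x x0 m).
move: (x `^ _) (\sum_(0 <= j < m | _) _) (\sum_(0 <= j < m | _) _) (\sum_(0 <= j < m | _) _) => p A B D h1 h2 h3.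
by rewrite (le_trans h3)//; lra.
Qed.

Lemma Bbar_ortho_sym s (P0 : R) : ortho_sym (@Bbar R s P0).
Proof.
move=> f /BbarP[f0 H] eps g g0 gE; apply/BbarP; split => // l l0 m.
apply: le_trans (H l l0 m); apply: ler_wpM2l; first exact: powR_ge0.
apply: sum_pos_le => // j j0; rewrite gE// exprMn -exprM mulnC exprM sqrrN expr1n expr1n mul1r//.
Qed.

Lemma coef_dist_le f g j : L2 f -> L2 g -> `|coef f j.+1 - coef g j.+1| <= L2norm (fun x => f x - g x).
Proof.
move=> hf hg.
have e : coef f j.+1 - coef g j.+1 = coef (fun x => 1 * f x + (-1) * g x) j.+1.
  by rewrite coef_comb// mul1r mulN1r.
have hh := L2_comb 1 (-1) hf hg.
have -> : (fun x => f x - g x) = (fun x => 1 * f x + (-1) * g x) by apply/funext => x; rewrite mul1r mulN1r.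
rewrite e -(@ler_pXn2r _ 2)// ?nnegrE ?sqrtr_ge0// real_normK ?num_real// L2norm_sqr.
apply: le_trans (bessel j.+1 hh).
by rewrite big_ord_recr/= lerDr sumr_ge0// => i _; exact: sqr_ge0.
Qed.

(** In the form of [BbarP] each condition involves finitely many coefficients, and these are
    continuous in norm. *)
Lemma Bbar_closed s (P0 : R) : closed_L2 (@Bbar R s P0).
Proof.
move=> fk g HU g0 cv; apply/BbarP; split => // l l0 m.
have cc j : (0 < j)%N -> (fun k => coef (fk k) j) @ \oo --> coef g j.
  case: j => // j _; apply: (dist_cvg _ cv) => k.
  have /BbarP[fk0 _] := HU k; apply: coef_dist_le; exact: L2_0_L2.
pose js := [seq j <- index_iota 0 m | l < j%:R].
have cs : (fun k => l `^ (2 * s) * \sum_(j <- js) coef (fk k) j ^+ 2) @ \oo -->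
   l `^ (2 * s) * \sum_(j <- js) coef g j ^+ 2.
  apply: cvgM; first exact: cvg_cst.
  apply: (@cvg_seq_sum R nat js (fun j k => coef (fk k) j ^+ 2) (fun j => coef g j ^+ 2)) => j.
  rewrite mem_filter => /andP[lj _]; under eq_fun do rewrite expr2; rewrite expr2.
  by apply: cvgM; apply: cc; rewrite -(ltr0n R) (lt_trans l0).
rewrite -big_filter -/js -(cvg_lim _ cs)//; apply: limr_le; first by apply/cvg_ex; eexists; exact: cs.
apply: nearW => k; have /BbarP[_ H] := HU k.
by rewrite /js big_filter; exact: H.
Qed.

Lemma powR_small (r e : R) : 0 < r -> 0 < e -> exists x0 : R, forall x : R, x0 <= x -> 0 < x -> x `^ (- r) <= e.
Proof.
move=> r0 e0; exists (e^-1 `^ r^-1) => x xx x0.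
rewrite powRN -[leRHS]invrK lef_pV2 ?posrE ?powR_gt0 ?invr_gt0//.
have -> : e^-1 = (e^-1 `^ r^-1) `^ r by rewrite -powRrM mulVf ?gt_eqF// powRr1// invr_ge0 ltW.
by apply: ge0_ler_powR; rewrite ?nnegrE ?powR_ge0 ?(ltW r0) ?(ltW x0).
Qed.

Lemma Bbar_signal (r s P0 c : R) : 0 < r -> r < 1 / 2 -> s = 2 * r / (1 - 2 * r) -> 0 < P0 -> 0 < c ->
  exists2 c0 : R, 0 < c0 & forall n f, (0 < n)%N -> Bbar s P0 f -> c * n%:R `^ (- r) < L2norm f ->
  (c0%:E <= total_form (drift f n))%E.
Proof.
move=> r0 r12 sE P00 c0.
have r2 : 0 < 1 - 2 * r by lra.
have s0 : 0 < s by rewrite sE divr_gt0// mulr_gt0.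
pose K := 2 * P0 / c ^+ 2.
have c20 : 0 < c ^+ 2 by rewrite exprn_gt0.
have K0 : 0 < K by rewrite divr_gt0// mulr_gt0.
pose d : R := c ^+ 2 / (2 * pi ^+ 2) * K `^ (- s^-1).
have pi2 : 0 < pi ^+ 2 :> R by rewrite exprn_gt0// pi_gt0.
exists d; first by rewrite mulr_gt0 ?powR_gt0// divr_gt0// mulr_gt0.
move=> n f n0 Uf nf; have /BbarP[f0 H] := Uf.
have nR : 0 < n%:R :> R by rewrite ltr0n.
have hf := L2_0_L2 f0.
pose N : R := n%:R.
pose q := c ^+ 2 * N `^ (- (2 * r)).
have Nr : 0 < N `^ (- (2 * r)) by exact: powR_gt0.
have q0 : 0 < q by rewrite mulr_gt0.
have qE : q = (c * N `^ (- r)) ^+ 2.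
  rewrite exprMn; congr (_ * _); rewrite expr2 -powRD; first by congr (_ `^ _); ring.
  by apply/implyP => _; rewrite gt_eqF.
(* By Parseval a large norm shows in finitely many coefficients. *)
have [m Hm] : exists m, q < \sum_(j < m) coef f j.+1 ^+ 2.
  apply: contrapT => /forallNP Hm.
  have : E (fun x => f x ^+ 2) <= q by apply: parseval_le => // m; rewrite leNgt; apply/negP/Hm.
  rewrite -L2norm_sqr qE ler_pXn2r ?nnegrE ?sqrtr_ge0 ?mulr_ge0 ?powR_ge0 ?(ltW c0)// leNgt.
  by rewrite nf.
(* The radius beyond which the body leaves at most [q / 2]: its [2 * s]-th power is [2 * P0 / q].
   Since [2 * r / s = 1 - 2 * r], its square grows like [N] to the power [1 - 2 * r], and in
   [N * q / l ^+ 2] all powers of [N] cancel. *)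
pose l := (K * N `^ (2 * r)) `^ (2 * s)^-1.
have KN : 0 < K * N `^ (2 * r) by rewrite mulr_gt0// powR_gt0.
have l0 : 0 < l by exact: powR_gt0.
have s2 : 2 * s != 0 by rewrite gt_eqF// mulr_gt0.
have lE : l `^ (2 * s) = K * N `^ (2 * r).
  by rewrite /l -powRrM mulVf// powRr1// ltW.
have l2 : l ^+ 2 = K `^ s^-1 * N `^ (1 - 2 * r).
  rewrite -powR_mulrn ?(ltW l0)// /l -powRrM powRM ?powR_ge0 ?(ltW K0)// -powRrM.
  by congr (_ `^ _ * _ `^ _); rewrite sE; field; rewrite ?gt_eqF ?mulr_gt0.
have tailb : \sum_(j < m | l < j.+1%:R) coef f j.+1 ^+ 2 <= q / 2.
  have := H l l0 m.+1; rewrite sum_pos_index// lE => h.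
  rewrite -(ler_pM2l KN) (le_trans h)// /q /K powRN.
  rewrite le_eqVlt; apply/orP; left; apply/eqP; field.
  by rewrite !gt_eqF ?powR_gt0.
have lowb : q / 2 <= \sum_(j < m | ~~ (l < j.+1%:R)) coef f j.+1 ^+ 2.
  by move: Hm; rewrite (bigID (fun j : 'I_m => l < j.+1%:R))/=; lra.
apply: (@le_trans _ _ (Qm m (drift f n))%:E); last exact: Qm_le_form.
rewrite lee_fin.
apply: (@le_trans _ _ (\sum_(j < m | ~~ (l < j.+1%:R)) N / (pi * l) ^+ 2 * coef f j.+1 ^+ 2)).
  rewrite -mulr_sumr; apply: (@le_trans _ _ (N / (pi * l) ^+ 2 * (q / 2))); last first.
    by apply: ler_wpM2l => //; rewrite divr_ge0 ?sqr_ge0// ltW.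
  rewrite exprMn l2 /d /q powRN.
  have NE : N `^ (1 - 2 * r) * N `^ (2 * r) = N.
    by rewrite -powRD ?subrK ?powRr1 ?(ltW nR)//; apply/implyP => _; rewrite gt_eqF.
  have h1 : N `^ (1 - 2 * r) != 0 by rewrite gt_eqF// powR_gt0.
  have h2 : N `^ (2 * r) != 0 by rewrite gt_eqF// powR_gt0.
  have h3 : K `^ s^-1 != 0 by rewrite gt_eqF// powR_gt0.
  have h4 : pi != 0 :> R by rewrite gt_eqF// pi_gt0.
  rewrite (powRN K) -[X in _ <= X / _ * _]NE.
  rewrite le_eqVlt; apply/orP; left; apply/eqP; move: (@pi R) h4 => p h4; field.
  by rewrite h1 h2 h3 h4.
rewrite /Qm [leRHS](bigID (fun j : 'I_m => ~~ (l < j.+1%:R)))/= -[leLHS]addr0; apply: lerD; last first.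
  by apply: sumr_ge0 => j _; rewrite mulr_ge0 ?sqr_ge0// ltW// lam_gt0.
apply: ler_sum => j; rewrite -leNgt => jl.
have -> : drift f n j ^+ 2 = N * coef f j.+1 ^+ 2 by rewrite /drift exprMn sqr_sqrtr// ltW.
rewrite mulrA; apply: ler_wpM2r; first exact: sqr_ge0.
rewrite mulrC; apply: ler_wpM2r; first exact: ltW.
rewrite /lam lef_pV2 ?posrE ?exprn_gt0 ?mulr_gt0 ?pi_gt0//.
by rewrite lerXn2r ?nnegrE ?mulr_ge0 ?pi_ge0 ?(ltW l0)// ler_wpM2l ?pi_ge0.
Qed.

End bodies.

(** * Consistency in the body, inconsistency outside its cone *)

Section maxiset.
Context {R : realType}.
Local Notation mu := (@lebesgue_measure R).
Local Notation U := (@unit_oi R).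
Local Notation E := (Rintegral (@leb R) U).
Implicit Types (f g : R -> R).

Lemma nat_cvgy_ge (n : nat -> nat) (x : R) : (fun i => (n i)%:R : R) @ \oo --> +oo ->
  \forall i \near \oo, x <= (n i)%:R.
Proof. by move=> /cvgryPge /(_ x). Qed.

Lemma nat_cvgy_geN (n : nat -> nat) (k : nat) : (fun i => (n i)%:R : R) @ \oo --> +oo ->
  \forall i \near \oo, (k <= n i)%N.
Proof. by move=> /(nat_cvgy_ge k%:R); apply: filterS => i; rewrite ler_nat. Qed.

Lemma rate_small (r C e : R) (n : nat -> nat) : 0 < r -> 0 < C -> 0 < e ->
  (fun i => (n i)%:R : R) @ \oo --> +oo -> \forall i \near \oo, C * (n i)%:R `^ (- r) <= e.
Proof.
move=> r0 C0 e0 ny; have eC : 0 < e / C by rewrite divr_gt0.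
have [x0 H] := powR_small r0 eC.
near=> i; rewrite mulrC -ler_pdivlMr//; apply: H; first by near: i; exact: nat_cvgy_ge.
by rewrite ltr0n; near: i; exact: nat_cvgy_geN.
Unshelve. all: by end_near. Qed.

Lemma Bbar_consistent (r s P0 c C : R) (n : nat -> nat) (f : nat -> R -> R) :
  0 < r -> r < 1 / 2 -> s = 2 * r / (1 - 2 * r) -> 0 < P0 -> 0 < c -> c < C ->
  (fun i => (n i)%:R : R) @ \oo --> +oo -> (forall i, Bbar s P0 (f i) /\ dens_alt (f i)) ->
  rate_band r c C n f -> consistent n f.
Proof.
move=> r0 r12 sE P00 c0 cC ny Uf rb a /andP[a0 a1] t ta.
have [c1 c10 Hs] := Bbar_signal r0 r12 sE P00 c0.
pose L : R := lam 0 + 1.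
have L0 : 0 < L by rewrite addr_gt0// lam_gt0.
(* A threshold above [T] would have level at most [a / 2] by Markov, against levels tending to
   [a]. *)
pose T : R := 1 + 4 * L / a.
have T1 : 1 <= T by rewrite lerDl divr_ge0// ?(ltW a0)// mulr_ge0// ltW.
have T0 : 0 < T by lra.
(* Null acceptance probabilities tend to [1 - a], hence eventually exceed [b], as [power_gap]
   requires. *)
pose b := (1 - a) / 2.
have b0 : 0 < b by rewrite divr_gt0//; lra.
have [ka ka0 [e1 e10 [n0 Hp]]] := power_gap c10 b0 T1.
have bound : \forall i \near \oo, beta_err (n i) (t i) (f i) <= 1 - a - ka / 2.
  near=> i.
  have ni0 : (0 < n i)%N by near: i; exact: nat_cvgy_geN.
  have fd : dens_alt (f i) := (Uf i).2.
  have /andP[rb1 rb2] := rb i.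
  have fe : L2norm (f i) <= e1.
    apply: (le_trans (ltW rb2)); near: i; apply: rate_small => //; exact: lt_trans cC.
  (* Levels within [ka / 2] of [a] leave half of the gain [ka] to separate the type II error from
     [1 - a]. *)
  have al1 : alpha_err (n i) (t i) < a + Num.min (ka / 2) b.
    near: i; apply: (cvgr_lt _ ta); rewrite ltrDl lt_min b0 andbT divr_gt0//.
  have al2 : a - Num.min (ka / 2) (a / 2) < alpha_err (n i) (t i).
    near: i; apply: (cvgr_gt _ ta); rewrite gtrBl lt_min !divr_gt0//.
  have m1 : Num.min (ka / 2) b <= b by rewrite ge_min lexx orbT.
  have m2 : Num.min (ka / 2) (a / 2) <= ka / 2 by rewrite ge_min lexx.
  have m3 : Num.min (ka / 2) (a / 2) <= a / 2 by rewrite ge_min lexx orbT.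
  have alE : alpha_err (n i) (t i) = 1 - accR dens_alt0 (n i) (t i) by rewrite alpha_errE.
  have tT : t i <= T.
    rewrite leNgt; apply/negP => Tt.
    have := @accept_markov R _ dens_alt0 (n i) (t i) T 0 ni0.
    rewrite T0 (ltW Tt) drift0 total_form0 => /(_ isT (lexx _)).
    have : T^-1 * (0 + 2 * L) <= a / 2.
      rewrite add0r mulrC ler_pdivrMr// (_ : a / 2 * T = a / 2 + 2 * L); first by lra.
      by rewrite /T; field; rewrite gt_eqF.
    rewrite -/L; lra.
  have bt : b <= accR dens_alt0 (n i) (t i) by rewrite /b in m1 *; lra.
  have nn : (n0 <= n i)%N by near: i; exact: nat_cvgy_geN.
  have := Hp (n i) nn (f i) fd fe (t i) tT (Hs _ _ ni0 (Uf i).1 rb1) bt.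
  rewrite (beta_errE fd _ ni0) -/(accR fd (n i) (t i)); lra.
apply: (@le_lt_trans _ _ (1 - a - ka / 2)%:E); last by rewrite lte_fin; lra.
by apply: limn_esup_le; apply: filterS bound => i; rewrite lee_fin.
Unshelve. all: by end_near. Qed.

Definition tail_fun f l x : R := f x - tpoly (fun j => coef f j.+1) l x.

Lemma tail_funE f l : tail_fun f l = (fun x => 1 * f x + (-1) * tpoly (fun j => coef f j.+1) l x).
Proof. by apply/funext => x; rewrite mul1r mulN1r. Qed.

Lemma L2_0_tail_fun f l : L2_0 f -> L2_0 (tail_fun f l).
Proof. by move=> f0; rewrite tail_funE; apply: L2_0_comb => //; exact: L2_0_tpoly. Qed.

Lemma coef_tail_fun f l j : L2_0 f -> coef (tail_fun f l) j.+1 = if (l <= j)%N then coef f j.+1 else 0.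
Proof.
move=> f0; rewrite tail_funE coef_comb; [|exact: L2_0_L2|exact: L2_tpoly].
by rewrite coef_tpoly; case: ltnP => _; rewrite mul1r ?mulr0 ?addr0 ?mulN1r ?subrr.
Qed.

Lemma tail_fun_sqr f l : L2_0 f ->
  L2norm (tail_fun f l) ^+ 2 = E (fun x => f x ^+ 2) - \sum_(j < l) coef f j.+1 ^+ 2.
Proof. by move=> f0; rewrite L2norm_sqr residual_sqr//; exact: L2_0_L2. Qed.

Lemma tail_fun_small f (e : R) : L2_0 f -> 0 < e -> exists l0 : nat, forall l, (l0 <= l)%N ->
  L2norm (tail_fun f l) ^+ 2 <= e.
Proof.
move=> f0 e0.
have [l0 H] : exists m, E (fun x => f x ^+ 2) - e < \sum_(j < m) coef f j.+1 ^+ 2.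
  apply: contrapT => /forallNP H.
  have : E (fun x => f x ^+ 2) <= E (fun x => f x ^+ 2) - e.
    by apply: parseval_le => // m; rewrite leNgt; apply/negP/H.
  lra.
exists l0 => l ll; rewrite tail_fun_sqr//.
have : \sum_(j < l0) coef f j.+1 ^+ 2 <= \sum_(j < l) coef f j.+1 ^+ 2.
  rewrite -(big_mkord xpredT (fun j => coef f j.+1 ^+ 2)) -(big_mkord xpredT (fun j => coef f j.+1 ^+ 2)).
  by rewrite [leRHS](big_cat_nat (n := l0))//= lerDl sumr_ge0// => j _; exact: sqr_ge0.
lra.
Qed.

(** If the weighted tails were bounded from some index on, they would be bounded at all radii, and a
    multiple of [f] would lie in the body. *)
Lemma not_cone_tail (s P0 : R) f : 0 < s -> 0 < P0 -> L2_0 f -> ~ cone (Bbar s P0) f ->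
  forall (M : R) (l0 : nat), exists2 l : nat, (l0 < l)%N & M < l%:R `^ (2 * s) * L2norm (tail_fun f l) ^+ 2.
Proof.
move=> s0 P00 f0 nc M l0; apply: contrapT => H; apply: nc.
have Hl l : (l0 < l)%N -> l%:R `^ (2 * s) * L2norm (tail_fun f l) ^+ 2 <= M.
  by move=> ll; rewrite leNgt; apply/negP => h; apply: H; exists l.
have s2 : 0 <= 2 * s by rewrite mulr_ge0// ltW.
(* [A] covers radii below [l0 + 1] by the full energy. [B] covers larger radii, rounded down to an
   integer [l] with [x <= 2 * l], whence its factor. *)
pose A := l0.+1%:R `^ (2 * s) * E (fun x => f x ^+ 2).
pose B := 2 `^ (2 * s) * `|M|.
have A0 : 0 <= A by rewrite mulr_ge0 ?powR_ge0// Rintegral_sqr_ge0.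
have B0 : 0 <= B by rewrite mulr_ge0 ?powR_ge0.
pose W := A + B + 1.
have W0 : 0 < W by rewrite /W; lra.
pose gam := Num.sqrt (W / P0).
have WP : 0 < W / P0 by rewrite divr_gt0.
have gam0 : 0 < gam by rewrite sqrtr_gt0.
have hf := L2_0_L2 f0.
(* The summand [0 * f] puts the multiple of [f] in the shape handled by [L2_0_comb] and
   [coef_comb]. *)
exists gam; split => //; exists (fun x => gam^-1 * f x + 0 * f x); split; last first.
  by apply/funext => x; rewrite mul0r addr0 mulrA mulfV ?gt_eqF// mul1r.
apply: (proj2 (BbarP _ _ _)); split; first exact: L2_0_comb.
move=> x x0 m; under eq_bigr do rewrite (coef_comb _ _ _ hf hf) mul0r addr0 exprMn exprVn sqr_sqrtr ?(ltW WP)//.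
rewrite -mulr_sumr mulrCA invf_div mulrAC ler_pdivrMr// ler_pM2l//.
pose l := Num.truncn x.
have x0' := ltW x0.
have lx : l%:R <= x by rewrite truncn_le.
have xl : x < l.+1%:R by exact: truncnS_gt.
have tl : \sum_(0 <= j < m | x < j%:R) coef f j ^+ 2 <= L2norm (tail_fun f l) ^+ 2.
  have gt := L2_0_L2 (L2_0_tail_fun l f0).
  rewrite L2norm_sqr; apply: le_trans (bessel m gt).
  case: m => [|m]; first by rewrite big_geq// big_ord0.
  rewrite sum_pos_index// big_ord_recr/= -[leLHS]addr0; apply: lerD; last exact: sqr_ge0.
  rewrite big_mkcond/=; apply: ler_sum => j _; rewrite coef_tail_fun//.
  case: ifPn => [xj|_]; last exact: sqr_ge0.
  by rewrite -ltnS -(ltr_nat R) (le_lt_trans lx).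
have p0 := powR_ge0 x (2 * s).
apply: (le_trans (ler_wpM2l p0 tl)).
have [ll|ll] := ltnP l0 l.
  have l1 : 1 <= l%:R :> R by rewrite ler1n (leq_ltn_trans _ ll).
  have : x `^ (2 * s) <= 2 `^ (2 * s) * l%:R `^ (2 * s).
    have xx : x <= 2 * l%:R by move: xl; rewrite -(natr1 l); lra.
    by rewrite -powRM//; apply: ge0_ler_powR => //; rewrite nnegrE ?mulr_ge0.
  move=> /(ler_wpM2r (sqr_ge0 (L2norm (tail_fun f l)))) /le_trans; apply.
  rewrite -mulrA; apply: (@le_trans _ _ (2 `^ (2 * s) * `|M|)); last by rewrite -/B /W; lra.
  apply: ler_wpM2l; first exact: powR_ge0.
  exact: le_trans (Hl l ll) (ler_norm M).
apply: (@le_trans _ _ A); last by rewrite /W; lra.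
apply: ler_pM; rewrite ?sqr_ge0//.
  apply: ge0_ler_powR; rewrite ?nnegrE ?ler0n//.
  by rewrite (le_trans (ltW xl))// ler_nat.
rewrite tail_fun_sqr// gerBl sumr_ge0// => j _; exact: sqr_ge0.
Qed.

(** The surviving terms have index at least [l], hence weight at most [1 / l ^+ 2]. *)
Lemma tail_total_form f l n : (0 < l)%N -> L2_0 f ->
  (total_form (drift (tail_fun f l) n) <= (n%:R / l%:R ^+ 2 * L2norm (tail_fun f l) ^+ 2)%:E)%E.
Proof.
move=> l0 f0; have g0 := L2_0_L2 (L2_0_tail_fun l f0).
rewrite total_formE; apply: lime_le.
  by apply: is_cvg_nneseries => j _ _; rewrite lee_fin mulr_ge0 ?sqr_ge0// ltW// lam_gt0.
apply: nearW => m; rewrite sumEFin lee_fin big_mkord L2norm_sqr.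
apply: le_trans (ler_wpM2l _ (bessel m g0)); last by rewrite divr_ge0.
rewrite mulr_sumr; apply: ler_sum => j _; rewrite /drift coef_tail_fun//.
case: ifPn => [lj|_]; last by rewrite mulr0 expr0n/= !mulr0.
rewrite exprMn sqr_sqrtr// mulrA; apply: ler_wpM2r; first exact: sqr_ge0.
rewrite mulrC; apply: ler_wpM2l => //.
rewrite /lam lef_pV2 ?posrE ?exprn_gt0 ?mulr_gt0 ?pi_gt0 ?ltr0n//.
rewrite lerXn2r ?nnegrE ?mulr_ge0 ?pi_ge0//; have := @pi_ge2 R.
have : l%:R <= j.+1%:R :> R by rewrite ler_nat ltnW.
have : 0 <= l%:R :> R by [].
nra.
Qed.

(** The tail is the midpoint of [f] and the function obtained by changing the sign of its first [l]
    coefficients. *)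
Lemma tail_fun_mem (V : set (R -> R)) f l : V `<=` @L2_0 R -> Defs.convex_set V -> ortho_sym V -> V f ->
  V (tail_fun f l).
Proof.
move=> V2 Vc Vo Vf; have f0 := V2 _ Vf.
pose f' x := 1 * f x + (-2) * tpoly (fun j => coef f j.+1) l x.
have f'0 : L2_0 f' by apply: L2_0_comb => //; exact: L2_0_tpoly.
have Vf' : V f'.
  apply: (Vo f Vf (fun j => (j <= l)%N) f' f'0) => -[//|j] _.
  rewrite coef_comb; [|exact: L2_0_L2|exact: L2_tpoly].
  rewrite coef_tpoly; case: ltnP => _; rewrite ?expr1 ?expr0 ?mulr0 ?addr0//; ring.
have h12 : 0 <= (2^-1 : R) <= 1 by apply/andP; split; lra.
rewrite (_ : tail_fun f l = (fun x => 2^-1 * f x + (1 - 2^-1) * f' x)); first exact: Vc.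
by apply/funext => x; rewrite /tail_fun /f'; field.
Qed.

Lemma inconsistent_of_small_signal (n : nat -> nat) (g : nat -> R -> R) (u : nat -> R) :
  (fun i => (n i)%:R : R) @ \oo --> +oo -> (forall i, dens_alt (g i)) ->
  (fun i => L2norm (g i)) @ \oo --> (0 : R) -> u @ \oo --> (0 : R) ->
  (forall i, (total_form (drift (g i) (n i)) <= (u i)%:E)%E) -> inconsistent n g.
Proof.
move=> ny gd gc uc ub t; apply/lee_addgt0Pr => eps eps0.
have [c c0 [e1 e10 [n0 H]]] := no_power eps0.
rewrite -leeBlDr//; apply: limn_einf_ge; near=> i.
rewrite -EFinB lee_fin.
have ni0 : (0 < n i)%N by near: i; exact: nat_cvgy_geN.
have nn : (n0 <= n i)%N by near: i; exact: nat_cvgy_geN.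
have ge : L2norm (g i) <= e1 by near: i; exact: (cvgr_le _ gc).
have uc' : u i <= c by near: i; exact: (cvgr_le _ uc).
have hc : (total_form (drift (g i) (n i)) <= c%:E)%E by apply: (le_trans (ub i)); rewrite lee_fin.
have := H (n i) nn (g i) (gd i) ge hc (t i).
rewrite (alpha_errE _ ni0) (beta_errE (gd i) _ ni0) -/(accR _ _ _) -/(accR _ _ _); lra.
Unshelve. all: by end_near. Qed.

Lemma not_cone_inconsistent (r s P0 : R) f (V : set (R -> R)) :
  0 < r -> r < 1 / 2 -> s = 2 * r / (1 - 2 * r) -> 0 < P0 ->
  L2_0 f -> ~ cone (Bbar s P0) f -> condD f ->
  V `<=` @L2_0 R -> Defs.convex_set V -> ortho_sym V -> V f ->
  exists c C : R, 0 < c /\ c < C /\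
  exists (n : nat -> nat) (g : nat -> R -> R),
    [/\ (fun i => (n i)%:R : R) @ \oo --> +oo, (forall i, V (g i) /\ dens_alt (g i)),
        rate_band r c C n g & inconsistent n g].
Proof.
move=> r0 r12 sE P00 f0 nc [l0 cD] V2 Vc Vo Vf.
have r2 : 0 < 1 - 2 * r by lra.
have s0 : 0 < s by rewrite sE divr_gt0// mulr_gt0.
(* The three requirements serve condition D, the convergence of the norms to 0, and the vanishing of
   the signal. *)
have ex i : exists l : nat, [/\ (l0 < l)%N, L2norm (tail_fun f l) ^+ 2 <= i.+1%:R^-1 &
    i.+1%:R < l%:R `^ (2 * s) * L2norm (tail_fun f l) ^+ 2].
  have i0 : 0 < i.+1%:R^-1 :> R by rewrite invr_gt0.
  have [l1 H1] := tail_fun_small f0 i0.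
  have [l ll Hl] := not_cone_tail s0 P00 f0 nc i.+1%:R (l0 + l1).
  exists l; split => //; first exact: leq_ltn_trans (leq_addr _ _) ll.
  apply: H1; exact: leq_trans (leq_addl _ _) (ltnW ll).
have [l lP] := choice ex.
pose g i := tail_fun f (l i); pose N i := L2norm (g i).
have N0 i : 0 < N i.
  have [_ _ h] := lP i; rewrite lt_neqAle sqrtr_ge0 andbT eq_sym; apply/negP => /eqP e.
  by move: h; rewrite -/(N i) e expr0n mulr0 ltNge ler0n.
have N1 i : N i <= 1.
  have [_ h _] := lP i; rewrite -(@ler_pXn2r _ 2)// ?nnegrE ?(ltW (N0 i))// expr1n.
  by rewrite (le_trans h)// invf_le1// ler1n.
(* The real sample size at which the norm equals [x ^ -r]; [n i] rounds it up within a factor 2. *)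
pose x i := N i `^ (- r^-1).
have x1 i : 1 <= x i.
  rewrite /x powRN -[leLHS]invr1 lef_pV2 ?posrE ?powR_gt0//.
  have -> : 1 = 1 `^ r^-1 :> R by rewrite powR1.
  apply: ge0_ler_powR; rewrite ?nnegrE ?invr_ge0 ?(ltW r0) ?(ltW (N0 i))//.
pose n i := (Num.truncn (x i)).+1.
have xn i : x i < (n i)%:R by exact: truncnS_gt.
have nx i : (n i)%:R <= 2 * x i.
  have : (Num.truncn (x i))%:R <= x i by rewrite truncn_le// (le_trans ler01).
  by rewrite /n -(natr1 (Num.truncn _)); have := x1 i; lra.
have x0 i : 0 < x i by exact: lt_le_trans (x1 i).
have xr i : x i `^ (- r) = N i.
  by rewrite /x -powRrM mulrNN mulVf ?gt_eqF// powRr1// ltW.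
have Nc : N @ \oo --> (0 : R).
  have h : (fun i => N i ^+ 2) @ \oo --> (0 : R).
    apply: (@squeeze_cvgr _ _ _ _ (cst 0) (@harmonic R)); [|exact: cvg_cst|exact: cvg_harmonic].
    by apply: nearW => i; rewrite sqr_ge0/=; have [_ h _] := lP i.
  have -> : N = (fun i => Num.sqrt (N i ^+ 2)).
    by apply/funext => i; rewrite sqrtr_sqr gtr0_norm.
  by rewrite -[X in _ --> X](@sqrtr0 R); exact: (cvg_comp _ _ h (@sqrt_continuous _ _)).
have ny : (fun i => (n i)%:R : R) @ \oo --> +oo.
  apply/cvgryPge => A; pose B := Num.max 1 A.
  have B0 : 0 < B by rewrite lt_max ltr01.
  have Br : 0 < B `^ (- r) by exact: powR_gt0.
  near=> i.
  have h : N i <= B `^ (- r) by near: i; exact: (cvgr_le _ Nc).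
  apply: (@le_trans _ _ B); first by rewrite le_max lexx orbT.
  apply: (le_trans _ (ltW (xn i))).
  rewrite -[leLHS]powRr1 ?(ltW B0)// (_ : 1 = - r * - r^-1); last by rewrite mulrNN mulfV ?gt_eqF.
  rewrite powRrM /x !(powRN _ r^-1) lef_pV2 ?posrE ?powR_gt0//.
  by apply: ge0_ler_powR; rewrite ?nnegrE ?invr_ge0 ?powR_ge0 ?(ltW r0) ?(ltW (N0 i)).
have gd i : V (g i) /\ dens_alt (g i).
  have [ll _ _] := lP i; split; first exact: tail_fun_mem.
  split; first exact: L2_0_tail_fun.
  apply: (cD (l i) ll); first exact: L2_0_tail_fun.
  by case=> // j _; rewrite coef_tail_fun.
have i1y : (fun i => i.+1%:R : R) @ \oo --> +oo.
  apply/cvgryPge => A; near=> i; apply: (@le_trans _ _ (Num.truncn A).+1%:R); first by rewrite ltW// truncnS_gt.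
  by rewrite ler_nat ltnS; near: i; exact: nbhs_infty_ge.
(* [x < n <= 2 * x] puts the norm between [n ^ -r] and [2 ^ r * n ^ -r]; the added 1 makes the upper
   inequality strict. *)
exists 1, (2 `^ r + 1); split => //; split; first by rewrite ltrDr powR_gt0.
exists n, g; split => //.
- move=> i; rewrite -/(N i) mul1r; apply/andP; split.
    rewrite -xr !powRN ltf_pV2 ?posrE ?powR_gt0 ?ltr0n//.
    by apply: gt0_ltr_powR; rewrite ?nnegrE ?(ltW (x0 i)).
  apply: (@le_lt_trans _ _ (2 `^ r * (n i)%:R `^ (- r))); last by rewrite ltr_pM2r ?powR_gt0 ?ltr0n// ltrDl.
  rewrite -xr !powRN -[leLHS]mul1r ler_pdivrMr ?powR_gt0// mulrAC ler_pdivlMr ?powR_gt0 ?ltr0n//.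
  rewrite mul1r -powRM ?(ltW (x0 i))//; apply: ge0_ler_powR; rewrite ?nnegrE ?mulr_ge0 ?(ltW r0) ?(ltW (x0 i))//.
- pose u (i : nat) : R := 2 * i.+1%:R `^ (- s^-1).
  apply: (@inconsistent_of_small_signal n g u) => //.
  + by move=> i; exact: (gd i).2.
  + have is0 : 0 < s^-1 by rewrite invr_gt0.
    apply/cvgrPdist_le => e e0; near=> i; rewrite sub0r normrN ger0_norm ?mulr_ge0 ?powR_ge0//.
    by near: i; exact: (@rate_small s^-1 2 e (fun i => i.+1)).
  + move=> i; have [ll _ h] := lP i.
    have li : (0 < l i)%N by exact: leq_ltn_trans ll.
    have lR : 0 < (l i)%:R :> R by rewrite ltr0n.
    apply: (le_trans (tail_total_form _ li f0)); rewrite lee_fin -/(g i) -/(N i) /u.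
    have i0 : 0 < i.+1%:R :> R by [].
    have hs : (i.+1%:R / N i ^+ 2) `^ s^-1 <= (l i)%:R ^+ 2.
      have -> : (l i)%:R ^+ 2 = ((l i)%:R `^ (2 * s)) `^ s^-1 :> R.
        by rewrite -powRrM -mulrA mulfV ?gt_eqF// mulr1 powR_mulrn// ltW.
      apply: ge0_ler_powR; rewrite ?nnegrE ?invr_ge0 ?(ltW s0) ?powR_ge0 ?divr_ge0 ?sqr_ge0//.
      by rewrite ler_pdivrMr ?exprn_gt0// ltW.
    have hs0 : 0 < (i.+1%:R / N i ^+ 2) `^ s^-1 by rewrite powR_gt0// divr_gt0// exprn_gt0.
    (* With [n] at most [2 * x] and the lower bound [hs] on the squared cutoff, the relation
       [1 / r = 2 + 2 / s] cancels all powers of the norm and leaves [u i]. *)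
    apply: (@le_trans _ _ (2 * x i / (i.+1%:R / N i ^+ 2) `^ s^-1 * N i ^+ 2)).
      apply: ler_wpM2r; first exact: sqr_ge0.
      apply: ler_pM; rewrite ?invr_ge0 ?sqr_ge0//.
      by rewrite lef_pV2 ?posrE// exprn_gt0.
    rewrite le_eqVlt; apply/orP; left; apply/eqP.
    rewrite powRM ?invr_ge0 ?sqr_ge0// powRN.
    have -> : (N i ^+ 2)^-1 `^ s^-1 = x i * N i ^+ 2.
      rewrite /x -!powR_mulrn ?(ltW (N0 i))// -powR_inv1 ?powR_ge0// -!powRrM -powRD.
        by congr (_ `^ _); rewrite sE; field; rewrite ?gt_eqF ?mulr_gt0.
      by apply/implyP => _; rewrite gt_eqF.
    have a1 : x i != 0 by rewrite gt_eqF.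
    have a2 : N i != 0 by rewrite gt_eqF.
    have a3 : i.+1%:R `^ s^-1 != 0 :> R by rewrite gt_eqF// powR_gt0.
    move: (x i) (N i) (i.+1%:R `^ s^-1) a1 a2 a3 => X Y W a1 a2 a3.
    by field; rewrite a1 a2 a3.
Unshelve. all: by end_near. Qed.

End maxiset.

Theorem theorem17 (R : realType) (r s P0 : R) :
  0 < r -> r < 1 / 2 -> s = 2 * r / (1 - 2 * r) -> 0 < P0 ->
  maxiset r (Bbar s P0).
Proof.
move=> r0 r12 sE P00; split.
- split; first by move=> f [].
  by split; [exact: Bbar_bounded|exact: Bbar_closed].
- exact: Bbar_convex.
- exact: Bbar_ortho_sym.
- by move=> c C c0 cC n f ny Uf rb; exact: (Bbar_consistent r0 r12 sE P00 c0 cC ny Uf rb).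
- by move=> f f0 nc cD V V2 Vc Vo Vf; exact: (not_cone_inconsistent r0 r12 sE P00 f0 nc cD V2 Vc Vo Vf).
Qed.
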